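(* Let $x_0\in\mathbb{R}^d$, $\eta_0\in(0,1/2]$, $\alpha\in(0,1]$, $\mathfrak a\in[1,2]$, let $f:\mathbb{R}^d\to\mathbb{R}$ be Lipschitz continuous, and assume that (H1)--(H4) (as defined in the context) hold for these data, with constants $c_1(\cdot),c_2,c_3,c_4$ and exponent $\delta$. Let $\gamma_0\in(0,\eta_0]$, $r_0\ge 1$, $\mathfrak t>0$. For $\varepsilon\in(0,1)$ set $$\gamma_r=\gamma_02^{-r},\qquad R_\varepsilon=\Big\lceil \tfrac1\delta\log_2(r_0\varepsilon^{-1})\Big\rceil,\qquad T_r=\begin{cases}\mathfrak t\,\varepsilon^{-2}2^{-\frac{1+\mathfrak a}{2}r}&\text{if }\mathfrak a>1,\\ \mathfrak t\,\varepsilon^{-2}R_\varepsilon^2\,2^{-r}&\text{if }\mathfrak a=1,\end{cases}\qquad r=0,\dots,R_\varepsilon,$$ and write $\mathcal Y=\mathcal Y(R_\varepsilon,(\gamma_r)_r,\tau,(T_r)_r,x_0,f)$ for the multilevel estimator defined in the context and $\mathcal C(\mathcal Y)$ for its complexity. (i) Let $\tau_1>\frac{1+\mathfrak a-2\delta}{2\alpha\delta}$. There exist constants $\mathfrak C_1,\mathfrak C_2$, depending only on the parameters $\alpha,\mathfrak a,\delta,\gamma_0,r_0,\mathfrak t,\tau_1,c_1(x_0),c_2,c_3,c_4$ (and not otherwise on $f$), such that for every $\varepsilon\in(0,1)$ and every $\tau\in\big[\tau_1\log(\varepsilon^{-1})\wedge\tfrac12T_{R_\varepsilon},\ \tfrac12T_{R_\varepsilon}\big]$,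 $$\|\mathcal Y-\pi(f)\|_2\le \mathfrak C_1[f]_1\,\varepsilon,\qquad\text{(A)}$$ $$\mathcal C(\mathcal Y)\le\mathfrak C_2\begin{cases}\varepsilon^{-2}&\text{if }\mathfrak a>1,\\ \varepsilon^{-2}R_\varepsilon^3&\text{if }\mathfrak a=1,\end{cases}\qquad\text{(B)}$$ with $\mathfrak C_2=\mathfrak c_{\mathfrak a}\,\gamma_0^{-1}\mathfrak t$, where $\mathfrak c_{\mathfrak a}=1+\frac32\big(2^{\frac{\mathfrak a-1}{2}}-1\big)^{-1}$ if $\mathfrak a>1$ and $\mathfrak c_{\mathfrak a}=\frac52$ if $\mathfrak a=1$. (ii) Let $\mathfrak d_{\mathfrak a}=(\mathfrak a-1)^{-2}$ if $\mathfrak a>1$ and $\mathfrak d_{\mathfrak a}=1$ if $\mathfrak a=1$. Assume that $r_0\ge 1\vee(c_3\gamma_0^\delta)$ and $$\mathfrak t\ge\mathfrak t_0:=\frac{\mathfrak d_{\mathfrak a}}{\alpha}\max\big(c_2^2\gamma_0^{\mathfrak a}\log(\gamma_0^{-1}),\,c_4^2\big),$$ and set $$\tau_1=\frac{1+\mathfrak a-2\delta}{\alpha\delta},\qquad \tau_2=0\vee\frac1\alpha\log\Big(r_0^{\frac{1+\mathfrak a}{2\delta}}(\mathfrak d_{\mathfrak a}c_4)^{-1}\Big),\qquad \varepsilon_0=\sup\big\{\varepsilon\in(0,1]:\ \tau_1|\log\varepsilon|+\tau_2\le\tfrac12T_{R_\varepsilon}\big\}.$$ Then (A) and (B) hold for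 every $\varepsilon\in(0,\varepsilon_0)$ and every $\tau\in[\tau_1|\log\varepsilon|+\tau_2,\ \tfrac12T_{R_\varepsilon}]$, with the same $\mathfrak C_2=\mathfrak c_{\mathfrak a}\gamma_0^{-1}\mathfrak t$ and with $\mathfrak C_1$ an absolute constant (independent of all the parameters of the problem).
   Context: Notation: $|\cdot|$ is the Euclidean norm, $\|\cdot\|_2$ the $L^2(\mathbb P)$ norm, $[f]_1$ the Lipschitz constant of $f$, $a\wedge b=\min(a,b)$, $a\vee b=\max(a,b)$. Setting: $b:\mathbb{R}^d\to\mathbb{R}^d$ and $\sigma:\mathbb{R}^d\to\mathbb M_{d,d}$ (real $d\times d$ matrices) are Lipschitz; the SDE $dX_t=b(X_t)dt+\sigma(X_t)dB_t$ ($B$ a $d$-dimensional Brownian motion) is assumed to have a unique invariant distribution $\pi$. For $\eta>0$, $\underline t_\eta:=\eta\max\{k\in\mathbb N: k\eta\le t\}$. The (continuous-time) Euler scheme with step $\gamma>0$ started at $x$ is $\bar X_t^{\gamma,x}=x+\int_0^tb(\bar X^{\gamma,x}_{\underline s_\gamma})ds+\int_0^t\sigma(\bar X^{\gamma,x}_{\underline s_\gamma})dB_s$; write $\bar X^{\gamma,x,B}$ to stress the driving Brownian motion. For every $\gamma\in(0,\eta_0]$ the chain $(\bar X_{n\gamma}^{\gamma})_{n\ge0}$ is assumed to have a unique invariant distribution $\pi^\gamma$. Assumptions (for given $f$, $x_0$, $\eta_0$, $\alpha>0$, $\mathfrak a\in[1,2]$): (H1) For all $x\in\mathbb{R}^d$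 there is a finite constant $c_1(x)$ such that for all $\gamma\in(0,\eta_0]$, $t\ge0$: $|\mathbb E[f(\bar X^{\gamma,x}_{\underline t_\gamma})]-\pi^\gamma(f)|\le c_1(x)[f]_1e^{-\alpha\underline t_\gamma}$. (H2) There is $c_2>0$ such that for all $\gamma\in(0,\eta_0]$: $\sup_{t\ge0}\|\bar X^{\gamma,x_0}_{\underline t_\gamma}-\bar X^{\gamma/2,x_0}_{\underline t_\gamma}\|_2\le c_2\gamma^{\mathfrak a/2}$ (both schemes driven by the same Brownian motion). (H3) There is $c_3>0$ such that for all $\gamma\in(0,\eta_0]$: $|\pi(f)-\pi^\gamma(f)|\le c_3[f]_1\gamma^\delta$, where $\delta\in[1/2,1]$ if $\mathfrak a=1$ and $\delta\in(\frac{1+\mathfrak a}{4},1]$ if $\mathfrak a>1$. (H4) There is $c_4\ge0$ such that for all $\gamma\in(0,\eta_0]$: $\sup_{t\ge0}\big(\|\bar X_t^{\gamma,x_0}-x_0\|_2+\|c_1(\bar X_t^{\gamma,x_0})\|_2\big)\le c_4$. Multilevel estimator: for $R\in\mathbb N^*$, $\gamma_r=\gamma_02^{-r}$, positive decreasing $(T_r)_{0\le r\le R}$, $\tau>0$, and independent Brownian motions $B^{(0)},\dots,B^{(R)}$, $$\mathcal Y(R,(\gamma_r)_r,\tau,(T_r)_r,x_0,f)=\frac1{T_0-\tau}\int_\tau^{T_0}f(\bar X^{\gamma_0,x_0,B^{(0)}}_{\underline s_{\gamma_0}})ds+\sum_{r=1}^R\frac1{T_r-\tau}\int_\tau^{T_r}\Big(f(\bar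 X^{\gamma_r,x_0,B^{(r)}}_{\underline s_{\gamma_{r-1}}})-f(\bar X^{\gamma_{r-1},x_0,B^{(r)}}_{\underline s_{\gamma_{r-1}}})\Big)ds.$$ Its complexity $\mathcal C(\mathcal Y)$ is the number of Euler iterations needed to compute it; it equals $\frac{T_0}{\gamma_0}+\sum_{r=1}^R\big(\frac{T_r}{\gamma_r}+\frac{T_r}{\gamma_{r-1}}\big)$ when the $T_r$ are multiples of the steps, and is at most this quantity in general. *)

(* Defs.v *)
From HB Require Import structures.
From mathcomp Require Import all_boot all_order all_algebra.
From mathcomp Require Import all_classical all_reals all_analysis.

Set Implicit Arguments.
Unset Strict Implicit.
Unset Printing Implicit Defensive.

Import Order.TTheory GRing.Theory Num.Theory.
Import numFieldNormedType.Exports.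

Local Open Scope classical_set_scope.
Local Open Scope ring_scope.

(* Points of R^d are column vectors; [Borel R d] is the same carrier equipped
   with the sigma-algebra generated by the open sets.  Processes are functions
   of a real time of which only the values at times t >= 0 are relevant. *)
Notation Borel R d := (g_sigma_algebraType (@open 'cV[R]_d)).

(* Euclidean norm on column vectors, Frobenius norm on matrices.  (The norm
   that the library puts on matrices is the sup norm.) *)
Definition enorm {R : realType} {m n : nat} (A : 'M[R]_(m, n)) : R :=
  Num.sqrt (\sum_i \sum_j A i j ^+ 2).

Definition elipschitz {R : realType} {d m n : nat}
    (g : 'cV[R]_d -> 'M[R]_(m, n)) : Prop :=
  exists L : R, forall x y, enorm (g x - g y) <= L * enorm (x - y).

Definition lipschitzR {R : realType} {d : nat} (f : 'cV[R]_d -> R) : Prop :=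
  exists L : R, forall x y, `|f x - f y| <= L * enorm (x - y).

(* The Lipschitz constant [f]_1; it is only used for Lipschitz f, for which the
   supremum is over a bounded set (empty, with supremum 0, when d = 0). *)
Definition lip {R : realType} {d : nat} (f : 'cV[R]_d -> R) : R :=
  sup [set l : R | exists x y, x != y /\ l = `|f x - f y| / enorm (x - y)].

Definition L2norm {R : realType} {disp} {T : measurableType disp}
    (P : probability T R) (Z : T -> R) : \bar R :=
  Lnorm P 2%:E (fun w => (Z w)%:E).

Definition filtration {R : realType} {disp} {T : measurableType disp}
    (F : R -> set (set T)) : Prop :=
  [/\ forall t, 0 <= t -> sigma_algebra setT (F t),
      forall t, 0 <= t -> F t `<=` measurable
    & forall s t, 0 <= s -> s <= t -> F s `<=` F t].

Definition adapted {R : realType} {disp} {T : measurableType disp} {d : nat}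
    (F : R -> set (set T)) (X : R -> T -> 'cV[R]_d) : Prop :=
  forall t (A : set (Borel R d)), 0 <= t -> measurable A -> F t (X t @^-1` A).

Definition natural_filtration {R : realType} {T : Type} {d : nat}
    (X : R -> T -> 'cV[R]_d) (t : R) : set (set T) :=
  <<s [set E | exists s (A : set (Borel R d)),
               [/\ 0 <= s, s <= t, measurable A & E = X s @^-1` A] ] >>.

Definition path_sigma_algebra {R : realType} {T : Type} {d : nat}
    (X : R -> T -> 'cV[R]_d) : set (set T) :=
  <<s [set E | exists s (A : set (Borel R d)),
               [/\ 0 <= s, measurable A & E = X s @^-1` A] ] >>.

(* B is a d-dimensional F-Brownian motion.  The last clause says that, for
   s < t, the increment B_t - B_s is independent of F_s and has law
   N(0, (t - s) I_d), the product of d centred normal laws with standard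
   deviation sqrt(t - s). *)
Definition brownian_wrt {R : realType} {disp} {T : measurableType disp}
    {d : nat} (P : probability T R) (F : R -> set (set T))
    (B : R -> T -> 'cV[R]_d) : Prop :=
  [/\ filtration F,
      adapted F B,
      {ae P, forall w, B 0 w = 0},
      {ae P, forall w, {within `[0, +oo[, continuous (fun t => B t w)}}
    & forall s t (E : set T) (A : 'I_d -> set R), 0 <= s -> s < t -> F s E ->
        (forall i, measurable (A i)) ->
        P (E `&` [set w | forall i, A i ((B t w - B s w) i 0)]) =
        (P E * \big[*%E/1]_(i < d)
                 normal_prob (0 : R) (Num.sqrt (t - s)) (A i))%E].

Definition brownian {R : realType} {disp} {T : measurableType disp} {d : nat}
    (P : probability T R) (B : R -> T -> 'cV[R]_d) : Prop :=
  brownian_wrt P (natural_filtration B) B.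

Definition independent_brownians {R : realType} {disp}
    {T : measurableType disp} {d : nat} (P : probability T R) (N : nat)
    (B : nat -> R -> T -> 'cV[R]_d) : Prop :=
  (forall r, (r <= N)%N -> brownian P (B r)) /\
  (forall E : nat -> set T,
     (forall r, (r <= N)%N -> path_sigma_algebra (B r) (E r)) ->
     P (\bigcap_(r in [set r | (r <= N)%N]) E r) =
     \big[*%E/1%E]_(r < N.+1) P (E r)).

Definition cvg_proba0 {R : realType} {disp} {T : measurableType disp}
    (P : probability T R) (Z : nat -> T -> \bar R) : Prop :=
  forall e : R, 0 < e ->
    (fun n => P [set w | (e%:E < Z n w)%E]) @ \oo --> 0%E.

(* A simple process is sum_(k < n) xi_k 1_(]u_k, u_(k+1)]) with bounded,
   F_(u_k)-measurable matrices xi_k. *)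
Record simple_process (R : realType) (T : Type) (d : nat) := SimpleProcess {
  sp_size : nat;
  sp_time : nat -> R;
  sp_coef : nat -> T -> 'M[R]_d }.

Definition simple_wf {R : realType} {disp} {T : measurableType disp} {d : nat}
    (F : R -> set (set T)) (H : simple_process R T d) : Prop :=
  0 <= sp_time H 0%N /\
  forall k, (k < sp_size H)%N ->
    [/\ sp_time H k <= sp_time H k.+1,
        exists M : R, forall w, enorm (sp_coef H k w) <= M
      & forall i j (A : set R), measurable A ->
          F (sp_time H k) ((fun w => sp_coef H k w i j) @^-1` A)].

Definition simple_val {R : realType} {T : Type} {d : nat}
    (H : simple_process R T d) (t : R) (w : T) : 'M[R]_d :=
  \sum_(k < sp_size H)
    (if (sp_time H k < t) && (t <= sp_time H k.+1) then sp_coef H k w else 0).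

Definition simple_integral {R : realType} {T : Type} {d : nat}
    (B : R -> T -> 'cV[R]_d) (H : simple_process R T d) (t : R) (w : T) :
    'cV[R]_d :=
  \sum_(k < sp_size H)
    sp_coef H k w *m (B (Num.min (sp_time H k.+1) t) w -
                      B (Num.min (sp_time H k) t) w).

(* [ito_integral P F B G t I]: almost surely, I = int_0^t G_s dB_s.  It is the
   limit in probability of the integrals of simple processes H^n such that
   int_0^t |H^n_s - G_s|^2 ds tends to 0 in probability. *)
Definition ito_integral {R : realType} {disp} {T : measurableType disp}
    {d : nat} (P : probability T R) (F : R -> set (set T))
    (B : R -> T -> 'cV[R]_d) (G : R -> T -> 'M[R]_d) (t : R)
    (I : T -> 'cV[R]_d) : Prop :=
  exists H : nat -> simple_process R T d,
    [/\ forall n, simple_wf F (H n),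
        cvg_proba0 P (fun n w =>
          (\int[lebesgue_measure]_(s in `[0%R, t])
             (enorm (simple_val (H n) s w - G s w) ^+ 2)%:E)%E)
      & cvg_proba0 P (fun n w =>
          (enorm (simple_integral B (H n) t w - I w))%:E)].

Definition time_integral {R : realType} {d : nat} (g : R -> 'cV[R]_d) (t : R) :
    'cV[R]_d :=
  \col_i (\int[lebesgue_measure]_(s in `[0, t]) (g s i 0)).

(* X solves dX_t = b(X_t) dt + sigma(X_t) dB_t, B being an F-Brownian motion. *)
Definition sde_solution {R : realType} {disp} {T : measurableType disp}
    {d : nat} (P : probability T R) (F : R -> set (set T))
    (b : 'cV[R]_d -> 'cV[R]_d) (sigma : 'cV[R]_d -> 'M[R]_d)
    (B X : R -> T -> 'cV[R]_d) : Prop :=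
  [/\ brownian_wrt P F B,
      adapted F X,
      forall w, {within `[0, +oo[, continuous (fun t => X t w)}
    & forall t, 0 <= t ->
        ito_integral P F B (fun s w => sigma (X s w)) t
          (fun w => X t w - X 0 w - time_integral (fun s => b (X s w)) t)].

Definition has_law {R : realType} {disp} {T : measurableType disp} {d : nat}
    (P : probability T R) (Z : T -> 'cV[R]_d)
    (nu : probability (Borel R d) R) : Prop :=
  forall A : set (Borel R d), measurable A -> P (Z @^-1` A) = nu A.

(* Every solution, on whatever filtered probability space, that starts from the
   law nu has law nu at all times. *)
Definition sde_invariant {R : realType} {d : nat}
    (b : 'cV[R]_d -> 'cV[R]_d) (sigma : 'cV[R]_d -> 'M[R]_d)
    (nu : probability (Borel R d) R) : Prop :=
  forall disp (T : measurableType disp) (P : probability T R)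
    (F : R -> set (set T)) (B X : R -> T -> 'cV[R]_d),
    sde_solution P F b sigma B X -> has_law P (X 0) nu ->
    forall t, 0 <= t -> has_law P (X t) nu.

Definition unique_law {R : realType} {d : nat}
    (Q : probability (Borel R d) R -> Prop) (nu : probability (Borel R d) R) :
    Prop :=
  Q nu /\ forall nu', Q nu' ->
    forall A : set (Borel R d), measurable A -> nu' A = nu A.

(* The largest multiple of eta that is at most t (t >= 0, eta > 0). *)
Definition tfloor {R : realType} (eta t : R) : R :=
  eta * (Num.truncn (t / eta))%:R.

Fixpoint euler_chain {R : realType} {T : Type} {d : nat}
    (b : 'cV[R]_d -> 'cV[R]_d) (sigma : 'cV[R]_d -> 'M[R]_d)
    (gamma : R) (x : 'cV[R]_d) (B : R -> T -> 'cV[R]_d) (n : nat) (w : T) :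
    'cV[R]_d :=
  if n is m.+1 then
    let y := euler_chain b sigma gamma x B m w in
    y + gamma *: b y +
      sigma y *m (B (gamma * m.+1%:R) w - B (gamma * m%:R) w)
  else x.

(* The process x + int_0^t b(X_(s_gamma)) ds + int_0^t sigma(X_(s_gamma)) dB_s:
   both integrands are constant in s on each cell of the grid. *)
Definition euler {R : realType} {T : Type} {d : nat}
    (b : 'cV[R]_d -> 'cV[R]_d) (sigma : 'cV[R]_d -> 'M[R]_d)
    (gamma : R) (x : 'cV[R]_d) (B : R -> T -> 'cV[R]_d) (t : R) (w : T) :
    'cV[R]_d :=
  let u := tfloor gamma t in
  let y := euler_chain b sigma gamma x B (Num.truncn (t / gamma)) w in
  y + (t - u) *: b y + sigma y *m (B t w - B u w).

(* nu is invariant for the kernel (x, A) |-> P(X^(gamma,x)_gamma \in A). *)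
Definition euler_invariant {R : realType} {disp} {T : measurableType disp}
    {d : nat} (P : probability T R) (B : R -> T -> 'cV[R]_d)
    (b : 'cV[R]_d -> 'cV[R]_d) (sigma : 'cV[R]_d -> 'M[R]_d) (gamma : R)
    (nu : probability (Borel R d) R) : Prop :=
  forall A : set (Borel R d), measurable A ->
    (\int[nu]_x P [set w | A (euler b sigma gamma x B gamma w)] = nu A)%E.

(* Standing assumptions: B is the Brownian motion that drives the schemes in
   the assumptions H1-H4, pi is the unique invariant distribution of the SDE
   and pig gamma the one of the Euler chain with step gamma <= eta0. *)
Definition mlmc_setting {R : realType} {disp} {T : measurableType disp}
    {d : nat} (P : probability T R) (B : R -> T -> 'cV[R]_d)
    (b : 'cV[R]_d -> 'cV[R]_d) (sigma : 'cV[R]_d -> 'M[R]_d) (eta0 : R)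
    (pi : probability (Borel R d) R) (pig : R -> probability (Borel R d) R) :
    Prop :=
  [/\ brownian P B,
      elipschitz b,
      elipschitz sigma,
      unique_law (sde_invariant b sigma) pi
    & forall gamma, 0 < gamma <= eta0 ->
        unique_law (euler_invariant P B b sigma gamma) (pig gamma)].

(* The inequalities of H1 and H3 are in \bar R, so that they fail, rather than
   hold by accident, if f is not integrable for pi or pig gamma. *)
Definition H1 {R : realType} {disp} {T : measurableType disp} {d : nat}
    (P : probability T R) (B : R -> T -> 'cV[R]_d)
    (b : 'cV[R]_d -> 'cV[R]_d) (sigma : 'cV[R]_d -> 'M[R]_d)
    (pig : R -> probability (Borel R d) R) (f : 'cV[R]_d -> R)
    (eta0 alpha : R) (c1 : 'cV[R]_d -> R) : Prop :=
  forall x gamma t, 0 < gamma <= eta0 -> 0 <= t ->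
    (`| 'E_P[(fun w => f (euler b sigma gamma x B (tfloor gamma t) w))]
        - \int[pig gamma]_y (f y)%:E |
     <= (c1 x * lip f * expR (- alpha * tfloor gamma t))%:E)%E.

Definition H2 {R : realType} {disp} {T : measurableType disp} {d : nat}
    (P : probability T R) (B : R -> T -> 'cV[R]_d)
    (b : 'cV[R]_d -> 'cV[R]_d) (sigma : 'cV[R]_d -> 'M[R]_d)
    (x0 : 'cV[R]_d) (eta0 a c2 : R) : Prop :=
  0 < c2 /\
  forall gamma, 0 < gamma <= eta0 ->
    (ereal_sup [set L2norm P (fun w =>
         enorm (euler b sigma gamma x0 B (tfloor gamma t) w -
                euler b sigma (gamma / 2) x0 B (tfloor gamma t) w)) |
       t in [set t : R | 0 <= t]%R]
     <= (c2 * gamma `^ (a / 2))%:E)%E.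

Definition H3 {R : realType} {d : nat}
    (pi : probability (Borel R d) R) (pig : R -> probability (Borel R d) R)
    (f : 'cV[R]_d -> R) (eta0 a delta c3 : R) : Prop :=
  [/\ 0 < c3,
      a = 1 -> 1 / 2 <= delta <= 1,
      1 < a -> (1 + a) / 4 < delta <= 1
    & forall gamma, 0 < gamma <= eta0 ->
        (`| \int[pi]_y (f y)%:E - \int[pig gamma]_y (f y)%:E |
         <= (c3 * lip f * gamma `^ delta)%:E)%E].

(* Measurability of c1 is what gives || c1(X_t) ||_2 a meaning. *)
Definition H4 {R : realType} {disp} {T : measurableType disp} {d : nat}
    (P : probability T R) (B : R -> T -> 'cV[R]_d)
    (b : 'cV[R]_d -> 'cV[R]_d) (sigma : 'cV[R]_d -> 'M[R]_d)
    (x0 : 'cV[R]_d) (eta0 : R) (c1 : 'cV[R]_d -> R) (c4 : R) : Prop :=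
  [/\ 0 <= c4,
      measurable_fun [set: Borel R d] (c1 : Borel R d -> R)
    & forall gamma, 0 < gamma <= eta0 ->
      (ereal_sup [set
           L2norm P (fun w => enorm (euler b sigma gamma x0 B t w - x0)) +
           L2norm P (fun w => c1 (euler b sigma gamma x0 B t w)) |
         t in [set t : R | 0 <= t]%R]
       <= c4%:E)%E].

Definition mlmc {R : realType} {T : Type} {d : nat}
    (b : 'cV[R]_d -> 'cV[R]_d) (sigma : 'cV[R]_d -> 'M[R]_d)
    (B : nat -> R -> T -> 'cV[R]_d) (N : nat) (gam : nat -> R) (tau : R)
    (Th : nat -> R) (x0 : 'cV[R]_d) (f : 'cV[R]_d -> R) (w : T) : R :=
  (Th 0%N - tau)^-1 *
    (\int[lebesgue_measure]_(s in `[tau, Th 0%N])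
       f (euler b sigma (gam 0%N) x0 (B 0%N) (tfloor (gam 0%N) s) w)) +
  \sum_(1 <= r < N.+1)
    (Th r - tau)^-1 *
      (\int[lebesgue_measure]_(s in `[tau, Th r])
         (f (euler b sigma (gam r) x0 (B r) (tfloor (gam r.-1) s) w) -
          f (euler b sigma (gam r.-1) x0 (B r) (tfloor (gam r.-1) s) w))).

(* Number of Euler iterations: one for each grid point in ]0, T_0] at level 0,
   and one for each point in ]0, T_r] of both grids at level r >= 1. *)
Definition complexity {R : realType} (N : nat) (gam Th : nat -> R) : nat :=
  (Num.truncn (Th 0%N / gam 0%N) +
   \sum_(1 <= r < N.+1)
     (Num.truncn (Th r / gam r) + Num.truncn (Th r / gam r.-1)))%N.

Definition mlstep {R : realType} (gamma0 : R) (r : nat) : R :=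
  gamma0 / 2 ^+ r.

Definition nlevels {R : realType} (delta r0 eps : R) : nat :=
  `|Num.ceil (delta^-1 * (ln (r0 / eps) / ln 2))|%N.

Definition horizon {R : realType} (a delta r0 th eps : R) (r : nat) : R :=
  if a == 1 then
    th * eps ^- 2 * (nlevels delta r0 eps)%:R ^+ 2 * 2 ^- r
  else th * eps ^- 2 * 2 `^ (- ((1 + a) / 2) * r%:R).

Definition error_bound {R : realType} {disp} {T : measurableType disp}
    {d : nat} (P : probability T R)
    (pi : probability (Borel R d) R) (f : 'cV[R]_d -> R)
    (Y : T -> R) (C eps : R) : Prop :=
  (Lnorm P 2%:E (fun w => (Y w)%:E - \int[pi]_y (f y)%:E)
   <= (C * lip f * eps)%:E)%E.

Definition cost_const {R : realType} (a : R) : R :=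
  if a == 1 then 5 / 2 else 1 + 3 / 2 * (2 `^ ((a - 1) / 2) - 1)^-1.

Definition cost_bound {R : realType} (a delta gamma0 r0 th eps : R) : Prop :=
  (complexity (nlevels delta r0 eps) (mlstep gamma0)
     (horizon a delta r0 th eps))%:R
  <= cost_const a * gamma0^-1 * th *
     (if a == 1 then eps ^- 2 * (nlevels delta r0 eps)%:R ^+ 3 else eps ^- 2).

Definition d_const {R : realType} (a : R) : R :=
  if a == 1 then 1 else (a - 1) ^- 2.

Definition t0_const {R : realType} (alpha a gamma0 c2 c4 : R) : R :=
  d_const a / alpha *
  Num.max (c2 ^+ 2 * gamma0 `^ a * ln gamma0^-1) (c4 ^+ 2).

Definition tau1_const {R : realType} (alpha a delta : R) : R :=
  (1 + a - 2 * delta) / (alpha * delta).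

(* For c4 = 0 the library's conventions (0^-1 = 0 and ln 0 = 0) give the value
   0. *)
Definition tau2_const {R : realType} (alpha a delta r0 c4 : R) : R :=
  Num.max 0
    (alpha^-1 * ln (r0 `^ ((1 + a) / (2 * delta)) * (d_const a * c4)^-1)).

Definition eps0_const {R : realType} (alpha a delta r0 th c4 : R) : R :=
  sup [set eps : R | 0 < eps <= 1 /\
    tau1_const alpha a delta * `|ln eps| + tau2_const alpha a delta r0 c4
    <= horizon a delta r0 th eps (nlevels delta r0 eps) / 2].

(* Main.v *)
(** The mean square error splits into the squared bias and the sum of the variances
of the levels, which are independent.  On level [r] the time average is a weighted
sum over the coarse grid of [g_k = f(X^{gamma_r}) - f(X^{gamma_(r-1)})], whose
[L^2] norm is at most [A = [f]_1 c2 gamma_(r-1)^(a/2)] by (H2).  By the Markov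
property, (H1) at the random point reached by the chain, and (H4), the covariance of
[g_k] and [g_l] is at most [A * min(A, 2 c4 [f]_1 exp(- alpha eta |k - l|))]; summing
over [l] costs a factor [log(1/gamma_r) / alpha], so the variance of level [r] is of
order [gamma_r^a log(1/gamma_r) / T_r], and the horizons [T_r] make the sum over [r]
of order [eps^2].  The bias is the distance from [pi^gamma_R(f)] to [pi(f)], given by
(H3), plus the transient [exp(- alpha tau) / T_r] of each level, which [tau] kills.
(H1), (H2) and (H4) speak of one Brownian motion; they transfer to the independent
ones since the law of an Euler chain depends only on the law of the increments. *)
Require Import Defs.
From HB Require Import structures.
From mathcomp Require Import all_boot all_order all_algebra.
From mathcomp Require Import all_classical all_reals all_analysis.
From mathcomp Require Import measurable_realfun.
From mathcomp Require Import ring lra.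

Set Implicit Arguments.
Unset Strict Implicit.
Unset Printing Implicit Defensive.

Import Order.TTheory GRing.Theory Num.Theory.
Import numFieldNormedType.Exports.

Local Open Scope classical_set_scope.
Local Open Scope ring_scope.

(** * Borel sets of R^d *)

(** The Markov property is used without conditional expectations. A chain is a recursion whose
    innovation is independent of the past, and its kernel acts on functions valued in [0, +oo], so
    that Tonelli suffices. A signed [f] is split into its two parts, whose images under the kernel
    are finite because (H1), read in the extended reals, fails otherwise. Increment laws are
    prescribed on boxes only, hence the pi-systems. (H2) concerns a joint law, so it is transferred
    through a chain on pairs that makes one coarse and two fine steps at a time. The logarithm
    counts the steps until the decaying bound falls below [A]; as [A] shrinks geometrically with the
    level, it grows linearly with the level. With x = 2^(-(a-1)/2) the variances then sum like (s+1)
    x^s: of order R_eps^2 at a = 1, which the factor R_eps^2 in T_r absorbs, and of order (a-1)^(-2)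
    otherwise, which is d_a. Before the factor exp(- alpha tau), the transients are of order
    eps^(1-c) with c = (1+a)/(2 delta) - 1; this c dictates the thresholds on tau. *)

Definition box {R : realType} {d : nat} (A : 'I_d -> set R) : set 'cV[R]_d :=
  [set v | forall i, A i (v i 0)].

Definition boxes {R : realType} {d : nat} : set (set 'cV[R]_d) :=
  [set E | exists A : 'I_d -> set R, (forall i, measurable (A i)) /\ E = box A].

Lemma boxes_setI {R : realType} {d : nat} : setI_closed (@boxes R d).
Proof.
move=> _ _ [A [mA ->]] [A' [mA' ->]]; exists (fun i => A i `&` A' i).
split; first by move=> i; exact: measurableI.
rewrite predeqE => v; split; first by case=> h h' i; split; [exact: h|exact: h'].
by move=> h; split => i; case: (h i).
Qed.

Lemma boxes_setT {R : realType} {d : nat} : @boxes R d setT.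
Proof. by exists (fun=> setT); split=> //; rewrite predeqE. Qed.

Lemma continuous_Borel {R : realType} {d : nat} (g : 'cV[R]_d -> R) :
  continuous g -> measurable_fun setT (g : Borel R d -> R).
Proof.
move=> /continuousP cg.
apply: (measurability _ (RGenOpens.measurableE R)).
move=> _ [_ [a [b ->] <-]]; rewrite setTI; apply: sub_sigma_algebra.
exact/cg/interval_open.
Qed.

Lemma measurable_coord {R : realType} {d : nat} (i : 'I_d) :
  measurable_fun setT ((fun v => v i 0) : Borel R d -> R).
Proof. apply: continuous_Borel; exact: coord_continuous. Qed.

Lemma measurable_box {R : realType} {d : nat} (A : 'I_d -> set R) :
  (forall i, measurable (A i)) -> measurable (box A : set (Borel R d)).
Proof.
move=> mA.
rewrite (_ : box A = \bigcap_(i in setT) ((fun v : Borel R d => v i 0) @^-1` A i)).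
  apply: fin_bigcap_measurable; first exact: finite_finset.
  move=> i _; rewrite -[X in measurable X]setTI.
  by apply: measurable_coord => //; exact: mA.
by rewrite predeqE => v; split => [h i _|h i]; exact: h.
Qed.

(** Balls for the library's sup norm are boxes, so an open set is the union of the countably many
    boxes with rational centre and radius 1/(n+1) that it contains. *)
Lemma open_boxes {R : realType} {d : nat} (U : set 'cV[R]_d) :
  open U -> <<s @boxes R d >> U.
Proof.
move=> oU.
pose K (p : 'cV[rat]_d * nat) : set 'cV[R]_d :=
  box (fun i => ball (ratr (p.1 i 0) : R) p.2.+1%:R^-1).
(* Boxes that leave [U] are replaced by the empty set, so that the union runs over a fixed countable
   type. *)
pose F p := if `[< K p `<=` U >] then K p else set0.
have -> : U = \bigcup_(p in setT) F p.
  apply/seteqP; split=> [v Uv|v [p _]]; last first.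
    by rewrite /F; case: asboolP => // KU; exact: KU.
  have /nbhs_ballP [e /= e0 He] := open_nbhs_nbhs (conj oU Uv).
  have [n ne] : exists n, n.+1%:R^-1 + n.+1%:R^-1 < e :> R.
    have := near_infty_natSinv_lt (PosNum (divr_gt0 e0 (ltr0n R 2))).
    move=> [n _ /(_ n (leqnn n)) /= h]; exists n.
    by rewrite [e]splitr ltrD.
  have n0 : 0 < n.+1%:R^-1 :> R by rewrite invr_gt0.
  have hq i : exists q : rat, (ratr q : R) \in `](v i 0 - n.+1%:R^-1), (v i 0 + n.+1%:R^-1)[.
    by apply: rat_in_itvoo; rewrite ltrD2l gtrN.
  have [q hq'] := choice hq.
  have vK : K (\col_i q i, n) v.
    move=> i /=; rewrite mxE /ball /=; move: (hq' i); rewrite in_itv /= => /andP[h1 h2].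
    by rewrite ltr_distl h1 h2.
  have KU : K (\col_i q i, n) `<=` U.
    move=> u Ku; apply: He; split=> // i j.
    have := vK i; have := Ku i; rewrite ord1 /= mxE /ball /= => h1 h2.
    apply: le_lt_trans ne.
    rewrite (_ : v i 0 - u i 0 = (v i 0 - ratr (q i)) + (ratr (q i) - u i 0)); last by ring.
    apply: (le_trans (ler_normD _ _)); apply: lerD; last exact: ltW.
    by rewrite distrC ltW.
  by exists (\col_i q i, n) => //; rewrite /F; case: asboolP.
have hF p : <<s @boxes R d >> (F p).
  rewrite /F; case: ifP => _; last exact: sigma_algebra0.
  apply: sub_sigma_algebra; eexists; split; last reflexivity.
  by move=> i /=; exact: measurable_ball.
exact: (@countable_bigcupT_measurable _
  (g_sigma_algebraType (@boxes R d)) _ F (countableP _) hF).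
Qed.

(** The law of a Brownian increment is given on boxes only; with [boxes_setI], this makes it
    determined on all Borel sets. *)
Lemma Borel_boxes {R : realType} {d : nat} :
  (@measurable _ (Borel R d)) = <<s @boxes R d >>.
Proof.
apply/seteqP; split.
  apply: smallest_sub; first exact: smallest_sigma_algebra.
  exact: open_boxes.
apply: smallest_sub; first exact: sigma_algebra_measurable.
by move=> _ [A [mA ->]]; exact: measurable_box.
Qed.

Lemma measurable_to_Borel {R : realType} {d : nat} {disp}
    {T : measurableType disp} (g : T -> Borel R d) :
  (forall i, measurable_fun setT (fun w => g w i 0)) -> measurable_fun setT g.
Proof.
move=> mg; apply: (measurability _ Borel_boxes).
move=> _ [_ [A [mA ->]] <-]; rewrite setTI.
rewrite (_ : _ @^-1` _ = \bigcap_(i in setT) ((fun w => g w i 0) @^-1` A i)).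
  apply: fin_bigcap_measurable; first exact: finite_finset.
  by move=> i _; rewrite -[X in measurable X]setTI; apply: mg => //; exact: mA.
by rewrite predeqE => v; split => [h i _|h i]; exact: h.
Qed.

(** * Independence and Markov chains *)

Section Independence.
Context {R : realType} {d1 d2 d3 : measure_display} {T : measurableType d1}
  {S : measurableType d2} {N : measurableType d3}.

(** The joint law of [Z] and [xi] is the product of the law of [Z] with [nu], since they agree on
    rectangles; Tonelli does the rest. Freezing the past in this way replaces conditional
    expectation. *)
Lemma indep_integral (P : probability T R) (Z : T -> S) (xi : T -> N)
    (nu : probability N R) (phi : S * N -> \bar R) :
  measurable_fun setT Z -> measurable_fun setT xi ->
  (forall A B, measurable A -> measurable B ->
     P (Z @^-1` A `&` xi @^-1` B) = (P (Z @^-1` A) * nu B)%E) ->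
  measurable_fun setT phi -> (forall p, (0 <= phi p)%E) ->
  (\int[P]_w phi (Z w, xi w) = \int[P]_w \int[nu]_z phi (Z w, z))%E.
Proof.
move=> mZ mxi ind mphi phi0.
pose X : {mfun T >-> S} := HB.pack Z (isMeasurableFun.Build _ _ _ _ Z mZ).
pose zx w := (Z w, xi w).
have mzx : measurable_fun setT zx by exact: measurable_fun_pair.
pose X2 : {mfun T >-> (S * N)%type} :=
  HB.pack zx (isMeasurableFun.Build _ _ _ _ zx mzx).
have E : forall C, measurable C ->
    (distribution P X \x nu)%E C = distribution P X2 C.
  by move=> C mC; apply: product_measure_unique => // A B mA mB; exact: ind.
have -> : (\int[P]_w phi (Z w, xi w) = \int[distribution P X2]_p phi p)%E.
  by rewrite ge0_integral_distribution.
rewrite (eq_measure_integral (distribution P X \x nu)%E); last first.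
  by move=> C mC _; apply/esym; exact: E.
rewrite fubini_tonelli1// ge0_integral_distribution//.
- exact: measurable_fun_fubini_tonelli_F.
- by move=> x; exact: integral_ge0.
Qed.

End Independence.

Section SubSigma.
Context {d : measure_display} {T : measurableType d}.

(** Measurability for a sub-sigma-algebra, encoded by changing the type of the source, so that the
    library's lemmas on measurable functions apply unchanged. *)
Definition Fmeas (F : set (set T)) {d'} {S : measurableType d'} (Z : T -> S) :=
  measurable_fun setT (Z : g_sigma_algebraType F -> S).

Lemma Fmeas_preimage (F : set (set T)) {d'} {S : measurableType d'} (Z : T -> S) :
  sigma_algebra setT F -> Fmeas F Z -> forall A, measurable A -> F (Z @^-1` A).
Proof.
move=> sF mZ A mA; have := mZ measurableT _ mA.
by rewrite setTI /measurable /= sigma_algebra_id.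
Qed.

Lemma preimage_Fmeas (F : set (set T)) {d'} {S : measurableType d'} (Z : T -> S) :
  (forall A, measurable A -> F (Z @^-1` A)) -> Fmeas F Z.
Proof. by move=> h _ A mA; rewrite setTI; apply: sub_sigma_algebra; exact: h. Qed.

Lemma Fmeas_mono (F G : set (set T)) {d'} {S : measurableType d'} (Z : T -> S) :
  F `<=` G -> Fmeas F Z -> Fmeas G Z.
Proof. by move=> FG mZ mT A mA; apply: (sub_sigma_algebra2 FG); exact: mZ. Qed.

Lemma Fmeas_measurable (F : set (set T)) {d'} {S : measurableType d'} (Z : T -> S) :
  F `<=` measurable -> Fmeas F Z -> measurable_fun setT Z.
Proof.
move=> FM mZ mT A mA; have := mZ measurableT A mA.
by apply: smallest_sub => //; exact: sigma_algebra_measurable.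
Qed.

Lemma Fmeas_pair (F : set (set T)) {d1 d2} {S1 : measurableType d1}
    {S2 : measurableType d2} (Z1 : T -> S1) (Z2 : T -> S2) :
  Fmeas F Z1 -> Fmeas F Z2 -> Fmeas F (fun w => (Z1 w, Z2 w)).
Proof.
by move=> m1 m2; apply: (@measurable_fun_pair _ _ _ (g_sigma_algebraType F)).
Qed.

End SubSigma.

Lemma integrable_sub {d} {T : measurableType d} {R : realType}
    (mu : {measure set T -> \bar R}) (f g : T -> R) :
  mu.-integrable setT (EFin \o f) -> mu.-integrable setT (EFin \o g) ->
  mu.-integrable setT (EFin \o (fun x => f x - g x)).
Proof. by move=> mf mg; exact: (integrableB measurableT mf mg). Qed.

Section Markov.
Context {R : realType} {d2 d3 : measure_display}
  {S : measurableType d2} {N : measurableType d3}.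
Variables (nu : probability N R) (Phi : S * N -> S).
Hypothesis mPhi : measurable_fun setT Phi.

(** The transition kernel of the chain. With values in the extended reals, its iterates on
    nonnegative functions need no integrability. *)
Definition trans (h : S -> \bar R) (x : S) : \bar R :=
  (\int[nu]_z h (Phi (x, z)))%E.

Definition nonneg_meas (h : S -> \bar R) :=
  measurable_fun setT h /\ forall x, (0 <= h x)%E.

Lemma trans_nonneg_meas h : nonneg_meas h -> nonneg_meas (trans h).
Proof.
move=> [mh h0]; split; last by move=> x; exact: integral_ge0.
apply: (@measurable_fun_fubini_tonelli_F _ _ _ _ _ _ (h \o Phi)).
- exact: measurableT_comp.
- by move=> p; exact: h0.
Qed.

Lemma iter_trans_nonneg_meas k h : nonneg_meas h -> nonneg_meas (iter k trans h).
Proof. by move=> hh; elim: k => //= k ih; exact: trans_nonneg_meas. Qed.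

Context {d1 : measure_display} {T : measurableType d1} (P : probability T R).
Variables (F : nat -> set (set T)) (Z : nat -> T -> S) (xi : nat -> T -> N).

(** A Markov chain given by its recursion. The product formula says at once that [xi n] is
    independent of the past and, with [E] the whole space, that its law is [nu]. *)
Definition driven :=
  [/\ forall n, sigma_algebra setT (F n),
      forall n, F n `<=` measurable,
      forall n m, (n <= m)%N -> F n `<=` F m &
      [/\ forall n, Fmeas (F n) (Z n),
      forall n, measurable_fun setT (xi n),
      forall n E A, F n E -> measurable A ->
        P (E `&` xi n @^-1` A) = (P E * nu A)%E &
      forall n w, Z n.+1 w = Phi (Z n w, xi n w)] ].

Hypothesis HD : driven.

Lemma driven_measurable n : measurable_fun setT (Z n).
Proof. by case: HD => _ FM _ [mZ _ _ _]; exact: Fmeas_measurable (mZ n). Qed.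

Lemma markov_step n (W : T -> R) h : Fmeas (F n) W -> (forall w, 0 <= W w) ->
  nonneg_meas h ->
  (\int[P]_w ((W w)%:E * h (Z n.+1 w)) =
   \int[P]_w ((W w)%:E * trans h (Z n w)))%E.
Proof.
case: HD => sF FM Fmono [mZ mxi ind ZE] mW W0 [mh h0].
pose phi (p : (R * S) * N) : \bar R := ((p.1.1)%:E * h (Phi (p.1.2, p.2)))%E.
(* [indep_integral] wants an integrand that is nonnegative on the whole product space, whereas its
   first variable ranges over all reals; hence the truncation at 0, invisible along [W]. *)
pose phi' (p : (R * S) * N) : \bar R :=
  ((Num.max p.1.1 0)%:E * h (Phi (p.1.2, p.2)))%E.
have mWZ : Fmeas (F n) (fun w => (W w, Z n w)).
    exact: Fmeas_pair.
have mphi' : measurable_fun setT phi'.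
  apply: emeasurable_funM.
    apply/measurable_EFinP; apply: measurable_maxr => //.
    by apply: measurableT_comp => //; exact: measurable_fst.
  apply: measurableT_comp => //; apply: measurableT_comp => //.
  apply: measurable_fun_pair; last exact: measurable_snd.
  by apply: measurableT_comp; [exact: measurable_snd|exact: measurable_fst].
have maxW w : Num.max (W w) 0 = W w by apply/max_idPl.
transitivity (\int[P]_w phi' ((W w, Z n w), xi n w))%E.
  by apply: eq_integral => w _; rewrite /phi' /= maxW ZE.
rewrite (indep_integral (nu := nu))//.
- apply: eq_integral => w _; rewrite /phi' /= maxW ge0_integralZl//.
  + apply: measurableT_comp => //; apply: measurableT_comp => //.
  + by rewrite lee_fin.
- exact: Fmeas_measurable mWZ.
- move=> A B mA mB; apply: ind => //.
  by apply: (Fmeas_preimage _ mWZ).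
- by move=> p; apply: mule_ge0; rewrite ?lee_fin ?le_max ?lexx ?orbT.
Qed.

Lemma markov_ge0 n k (W : T -> R) h : Fmeas (F n) W -> (forall w, 0 <= W w) ->
  nonneg_meas h ->
  (\int[P]_w ((W w)%:E * h (Z (n + k) w)) =
   \int[P]_w ((W w)%:E * iter k trans h (Z n w)))%E.
Proof.
move=> mW W0; elim: k h => [|k ih] h hh; first by rewrite addn0.
rewrite addnS (@markov_step (n + k) W h _ W0 hh); last first.
  case: HD => _ _ Fmono _; apply: Fmeas_mono mW; apply: Fmono; exact: leq_addr.
by rewrite ih ?iterSr//; exact: trans_nonneg_meas.
Qed.

Lemma markov_start x k h : (forall w, Z 0%N w = x) -> nonneg_meas h ->
  (\int[P]_w h (Z k w) = iter k trans h x)%E.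
Proof.
move=> Z0 hh; have := @markov_ge0 0 k (cst 1) h (measurable_cst _) _ hh.
rewrite add0n => e.
transitivity (\int[P]_w ((cst 1 w)%:E * h (Z k w)))%E.
  by apply: eq_integral => w _; rewrite mul1e.
rewrite e// (eq_integral (cst (iter k trans h x))); last first.
  by move=> w _; rewrite mul1e Z0.
rewrite integral_cst// [X in (_ * X)%E](_ : _ = 1%E) ?mule1//.
exact: probability_setT.
Qed.

(** The two sides of [markov_ge0] are equal extended reals, so integrability of the first passes to
    the second; recombining the parts of a signed [f] needs both. *)
Lemma markov_real_ge0 n k (W : T -> R) (h : S -> R) : Fmeas (F n) W ->
  (forall w, 0 <= W w) -> measurable_fun setT h -> (forall x, 0 <= h x) ->
  (forall x, iter k trans (EFin \o h) x \is a fin_num) ->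
  P.-integrable setT (fun w => (W w * h (Z (n + k) w))%:E) ->
  P.-integrable setT (fun w => (W w * fine (iter k trans (EFin \o h) (Z n w)))%:E)
  /\ \int[P]_w (W w * h (Z (n + k) w)) =
     \int[P]_w (W w * fine (iter k trans (EFin \o h) (Z n w))).
Proof.
move=> mW W0 mh h0 fin /integrableP[mi lty].
have hh : nonneg_meas (EFin \o h).
  by split; [exact/measurable_EFinP|move=> x; rewrite lee_fin].
have [mk k0] := iter_trans_nonneg_meas k hh.
have E := markov_ge0 k mW W0 hh.
have E2 : (\int[P]_w (W w * h (Z (n + k) w))%:E =
   \int[P]_w (W w * fine (iter k trans (EFin \o h) (Z n w)))%:E)%E.
  under eq_integral do rewrite EFinM.
  rewrite E; apply: eq_integral => w _.
  by rewrite EFinM fineK.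
split; last by rewrite /Rintegral E2.
apply/integrableP; split.
  apply/measurable_EFinP; apply: measurable_funM.
    by case: HD => _ FM _ _; exact: Fmeas_measurable mW.
  apply: measurableT_comp; first exact: fine_measurable.
  by apply: measurableT_comp => //; exact: driven_measurable.
apply: le_lt_trans lty.
rewrite (eq_integral (fun w => (W w * fine (iter k trans (EFin \o h) (Z n w)))%:E)).
  rewrite -E2; apply: ge0_le_integral => //.
  - by move=> w _; rewrite lee_fin mulr_ge0.
  - by apply: measurableT_comp.
  - by move=> w _; rewrite lee_fin ler_norm.
by move=> w _; rewrite gee0_abs// lee_fin mulr_ge0// fine_ge0.
Qed.

(** [W] and [f] are each split into positive and negative part; the four products are nonnegative
    and dominated by the absolute value of the whole, and their identities are recombined. *)
Lemma markov_real n k (W : T -> R) (f : S -> R)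
    (hp := iter k trans (EFin \o (fun x => Num.max (f x) 0)))
    (hm := iter k trans (EFin \o (fun x => Num.max (- f x) 0))) :
  Fmeas (F n) W -> measurable_fun setT f ->
  (forall x, hp x \is a fin_num) -> (forall x, hm x \is a fin_num) ->
  P.-integrable setT (fun w => (W w * f (Z (n + k) w))%:E) ->
  P.-integrable setT
    (fun w => (W w * (fine (hp (Z n w)) - fine (hm (Z n w))))%:E) /\
  \int[P]_w (W w * f (Z (n + k) w)) =
  \int[P]_w (W w * (fine (hp (Z n w)) - fine (hm (Z n w)))).
Proof.
move=> mW mf fp fm Wf.
pose p (x : R) := Num.max x 0; pose q (x : R) := Num.max (- x) 0.
have pq x : x = p x - q x.
  rewrite /p /q; case: (leP 0 x) => x0.
    by rewrite max_r ?subr0// oppr_le0.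
  by rewrite max_l ?opprK ?add0r// oppr_ge0 ltW.
have p0 x : 0 <= p x by rewrite le_max lexx orbT.
have q0 x : 0 <= q x by rewrite le_max lexx orbT.
have pn x : p x <= `|x| by rewrite ge_max ler_norm normr_ge0.
have qn x : q x <= `|x| by rewrite ge_max -normrN ler_norm normr_ge0.
have mp : measurable_fun setT p by exact: measurable_maxr.
have mq : measurable_fun setT q.
  by apply: measurable_maxr => //; exact: measurable_funN.
have mWT : measurable_fun setT W.
  by case: HD => _ FM _ _; exact: Fmeas_measurable mW.
have key (u v : R -> R) : measurable_fun setT u -> measurable_fun setT v ->
    (forall x, 0 <= u x <= `|x|) -> (forall x, 0 <= v x <= `|x|) ->
    (forall x, iter k trans (EFin \o (v \o f)) x \is a fin_num) ->
    [/\ P.-integrable setT (EFin \o (fun w => u (W w) * v (f (Z (n + k) w)))),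
    P.-integrable setT (EFin \o (fun w => u (W w) * fine (iter k trans (EFin \o (v \o f)) (Z n w))))
    & \int[P]_w (u (W w) * v (f (Z (n + k) w))) =
      \int[P]_w (u (W w) * fine (iter k trans (EFin \o (v \o f)) (Z n w)))].
  move=> mu mv hu hv fv.
  have I1 : P.-integrable setT (EFin \o (fun w => u (W w) * v (f (Z (n + k) w)))).
    apply: le_integrable Wf => //.
      apply/measurable_EFinP; apply: measurable_funM; first exact: measurableT_comp.
      do 2 apply: measurableT_comp => //; exact: driven_measurable.
    move=> w _; rewrite /= lee_fin !normrM.
    have /andP[a1 a2] := hu (W w); have /andP[b1 b2] := hv (f (Z (n + k)%N w)).
    by rewrite ler_pM// ger0_norm.
  have [] := @markov_real_ge0 n k (u \o W) (v \o f) _ _ _ _ fv I1 => //.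
  - by rewrite /Fmeas; apply: measurableT_comp.
  - by move=> w /=; case/andP: (hu (W w)).
  - exact: measurableT_comp.
  - by move=> x /=; case/andP: (hv (f x)).
have Hp x : 0 <= p x <= `|x| by rewrite p0 pn.
have Hq x : 0 <= q x <= `|x| by rewrite q0 qn.
have [a1 a2 a3] := key p p mp mp Hp Hp fp.
have [b1 b2 b3] := key p q mp mq Hp Hq fm.
have [c1 c2 c3] := key q p mq mp Hq Hp fp.
have [e1 e2 e3] := key q q mq mq Hq Hq fm.
have EA (A B C D : T -> R) : P.-integrable setT (EFin \o A) ->
   P.-integrable setT (EFin \o B) -> P.-integrable setT (EFin \o C) ->
   P.-integrable setT (EFin \o D) ->
   P.-integrable setT (EFin \o (fun w => (A w - B w) - (C w - D w))) /\
   \int[P]_w ((A w - B w) - (C w - D w)) = (\int[P]_w A w - \int[P]_w B w)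
     - (\int[P]_w C w - \int[P]_w D w).
  move=> iA iB iC iD.
  have iAB := integrable_sub iA iB; have iCD := integrable_sub iC iD.
  by split; [exact: integrable_sub|rewrite !RintegralB].
have [_ L] := EA _ _ _ _ a1 b1 c1 e1.
have [I2 L2] := EA _ _ _ _ a2 b2 c2 e2.
have E1 : (fun w => W w * f (Z (n + k) w)) = (fun w =>
  (p (W w) * p (f (Z (n + k) w)) - p (W w) * q (f (Z (n + k) w))) -
  (q (W w) * p (f (Z (n + k) w)) - q (W w) * q (f (Z (n + k) w)))).
  apply/funext => w; rewrite {1}(pq (W w)) {1}(pq (f (Z (n + k)%N w))); ring.
have E2 : (fun w => W w * (fine (hp (Z n w)) - fine (hm (Z n w)))) = (fun w =>
  (p (W w) * fine (hp (Z n w)) - p (W w) * fine (hm (Z n w))) -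
  (q (W w) * fine (hp (Z n w)) - q (W w) * fine (hm (Z n w)))).
  apply/funext => w; rewrite {1}(pq (W w)); ring.
split; first by rewrite (_ : (fun w => _) = EFin \o (fun w => W w * (fine (hp (Z n w)) - fine (hm (Z n w)))))// E2.
by rewrite E1 E2 L L2 a3 b3 c3 e3.
Qed.

End Markov.

(** * Brownian increments and Euler chains *)

Lemma enorm_ge0 {R : realType} {m n : nat} (A : 'M[R]_(m, n)) : 0 <= enorm A.
Proof. exact: sqrtr_ge0. Qed.

Lemma enorm_coord {R : realType} {m n : nat} (A : 'M[R]_(m, n)) i j :
  `|A i j| <= enorm A.
Proof.
rewrite -sqrtr_sqr ler_wsqrtr//.
rewrite (bigD1 i)//= (bigD1 j)//= -addrA lerDl addr_ge0//.
  by apply: sumr_ge0 => k _; exact: sqr_ge0.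
by apply: sumr_ge0 => k _; apply: sumr_ge0 => l _; exact: sqr_ge0.
Qed.

Lemma enorm_le_sup {R : realType} {d : nat} (v : 'cV[R]_d) (e : R) :
  0 <= e -> (forall i, `|v i 0| <= e) -> enorm v <= Num.sqrt d%:R * e.
Proof.
move=> e0 h; rewrite -[e in leRHS]ger0_norm// -sqrtr_sqr -sqrtrM// ler_wsqrtr//.
rewrite -[d in leRHS]card_ord mulr_natl -sumr_const; apply: ler_sum => i _.
rewrite big_ord1 -[leLHS]real_normK ?num_real// lerXn2r ?nnegrE ?h//.
Qed.

Lemma enorm_lip_continuous {R : realType} {d : nat} (g : 'cV[R]_d -> R) (L : R) :
  (forall x y, `|g x - g y| <= L * enorm (x - y)) -> continuous g.
Proof.
move=> hL x; apply/(@cvgrPdist_lt _ _ _ (nbhs x) (nbhs_filter x)) => e e0.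
(* The root of [d] compares the Euclidean norm with the sup norm of the topology; [+ 1] keeps the
   divisor positive when [L = 0] or [d = 0]. *)
have K0 : 0 < `|L| * Num.sqrt d%:R + 1.
  by rewrite ltr_wpDl// mulr_ge0// sqrtr_ge0.
apply/nbhs_ballP; exists (e / (`|L| * Num.sqrt d%:R + 1)); first exact: divr_gt0.
move=> y [d0 xy] /=.
apply: le_lt_trans (hL _ _) _.
have h : enorm (x - y) <= Num.sqrt d%:R * (e / (`|L| * Num.sqrt d%:R + 1)).
  apply: enorm_le_sup; first exact: ltW.
  by move=> i; rewrite !mxE; apply: ltW; exact: xy.
apply: (@le_lt_trans _ _ (`|L| * enorm (x - y))).
  by rewrite ler_wpM2r ?enorm_ge0// ler_norm.
apply: le_lt_trans (ler_wpM2l (normr_ge0 _) h) _.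
rewrite !mulrA ltr_pdivrMr// -[ltLHS]mulrC ltr_pM2l//.
by rewrite ltrDl.
Qed.

Lemma elipschitz_measurable {R : realType} {d m n : nat}
    (g : 'cV[R]_d -> 'M[R]_(m, n)) i j :
  elipschitz g -> measurable_fun setT ((fun x => g x i j) : Borel R d -> R).
Proof.
move=> [L hL]; apply: continuous_Borel; apply: (@enorm_lip_continuous _ _ _ L).
move=> x y; apply: le_trans (hL x y).
by have := enorm_coord (g x - g y) i j; rewrite !mxE.
Qed.

Lemma lipschitzR_measurable {R : realType} {d : nat} (f : 'cV[R]_d -> R) :
  lipschitzR f -> measurable_fun setT (f : Borel R d -> R).
Proof. by move=> [L hL]; apply: continuous_Borel; exact: enorm_lip_continuous hL. Qed.

Section BorelOps.
Context {R : realType} {d : nat} {disp} {T : measurableType disp}.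
Implicit Types u v : T -> Borel R d.

Lemma measurable_BorelD u v : measurable_fun setT u -> measurable_fun setT v ->
  measurable_fun setT ((fun w => u w + v w : 'cV[R]_d) : T -> Borel R d).
Proof.
move=> mu mv; apply: measurable_to_Borel => i.
rewrite (_ : (fun w => _) = (fun w => u w i 0 + v w i 0)); last first.
  by apply/funext => w; rewrite mxE.
by apply: measurable_funD; apply: measurableT_comp (measurable_coord i) _.
Qed.

Lemma measurable_BorelB u v : measurable_fun setT u -> measurable_fun setT v ->
  measurable_fun setT ((fun w => u w - v w : 'cV[R]_d) : T -> Borel R d).
Proof.
move=> mu mv; apply: measurable_to_Borel => i.
rewrite (_ : (fun w => _) = (fun w => u w i 0 - v w i 0)); last first.
  by apply/funext => w; rewrite !mxE.
by apply: measurable_funB; apply: measurableT_comp (measurable_coord i) _.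
Qed.

Lemma measurable_enorm u : measurable_fun setT u ->
  measurable_fun setT (fun w => enorm (u w : 'cV[R]_d)).
Proof.
move=> mu; rewrite (_ : (fun w => _) =
  (fun w => Num.sqrt (\sum_(i < d) u w i 0 ^+ 2))); last first.
  apply/funext => w; rewrite /enorm; congr Num.sqrt; apply: eq_bigr => i _.
  by rewrite big_ord1.
apply: measurableT_comp.
  by apply: continuous_measurable_fun; exact: sqrt_continuous.
apply: measurable_sum => i; apply: measurable_funX.
exact: measurableT_comp (measurable_coord i) _.
Qed.

Lemma measurable_step (b : 'cV[R]_d -> 'cV[R]_d) (sigma : 'cV[R]_d -> 'M[R]_d)
    (gamma : R) u v : elipschitz b -> elipschitz sigma ->
  measurable_fun setT u -> measurable_fun setT v ->
  measurable_fun setT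
    ((fun w => u w + gamma *: b (u w) + sigma (u w) *m v w : 'cV[R]_d) :
     T -> Borel R d).
Proof.
move=> lb ls mu mv; apply: measurable_to_Borel => i.
rewrite (_ : (fun w => _) = (fun w => (u w i 0 + gamma * b (u w) i 0) +
   \sum_(k < d) sigma (u w) i k * v w k 0)); last first.
  by apply/funext => w; rewrite !mxE.
apply: measurable_funD.
  apply: measurable_funD; first exact: measurableT_comp (measurable_coord i) _.
  apply: measurable_funM => //.
  exact: measurableT_comp (elipschitz_measurable i 0 lb) _.
apply: measurable_sum => k; apply: measurable_funM.
  exact: measurableT_comp (elipschitz_measurable i k ls) _.
exact: measurableT_comp (measurable_coord k) _.
Qed.

End BorelOps.

(** Both sides are finite measures in [A], the left one being the image under [xi] of [P] restricted
    to [E]; they agree on a generating pi-system that contains the whole space. *)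
Lemma indep_from_pisystem {R : realType} {d1 d2} {T : measurableType d1}
    {N : measurableType d2} (P : probability T R) (nu : probability N R)
    (xi : T -> N) (E : set T) (G : set (set N)) :
  measurable_fun setT xi -> measurable E ->
  (@measurable _ N) = <<s G >> -> setI_closed G -> G setT ->
  (forall A, G A -> P (E `&` xi @^-1` A) = (P E * nu A)%E) ->
  forall A, measurable A -> P (E `&` xi @^-1` A) = (P E * nu A)%E.
Proof.
move=> mxi mE NG GI GT h A mA.
pose r : {nonneg R} := NngNum (fine_ge0 (measure_ge0 P E)).
have rE : (r%:num)%:E = P E by rewrite /= fineK// fin_num_measure.
pose m1' : {measure set N -> \bar R} := pushforward (mrestr P mE) xi.
pose m1 := m1' mxi.
pose m2 : {measure set N -> \bar R} := mscale r nu.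
have E1 B : m1 B = P (E `&` xi @^-1` B).
  by rewrite /m1 /= /pushforward /mrestr setIC.
have E2 B : m2 B = (P E * nu B)%E by rewrite /m2 /= /mscale rE.
rewrite -E1 -E2; apply: (measure_unique G (fun=> setT)) => //.
- by rewrite bigcup_const//; exists 0%N.
- by move=> B GB; rewrite E1 E2; exact: h.
- by move=> n; rewrite E1 preimage_setT setIT (le_lt_trans (probability_le1 _ _)) ?ltry.
Qed.

Lemma sigma_algebra_setI {T : pointedType} (F : set (set T)) :
  sigma_algebra setT F -> setI_closed F.
Proof.
move=> sF A C; rewrite -(sigma_algebra_id sF) => mA mC.
exact: (@measurableI _ (g_sigma_algebraType F)).
Qed.

(** This pins down [nu] as N(0, h I_d). *)
Definition gaussian_boxes {R : realType} {d : nat}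
    (nu : probability (Borel R d) R) (h : R) : Prop :=
  forall A : 'I_d -> set R, (forall i, measurable (A i)) ->
    nu (box A) =
    (\big[*%E/1]_(i < d) normal_prob (0 : R) (Num.sqrt h) (A i))%E.

Section Brownian.
Context {R : realType} {disp : measure_display} {T : measurableType disp}
  {d : nat} (P : probability T R) (B : R -> T -> 'cV[R]_d).
Hypothesis HB : brownian P B.

Let NF := natural_filtration B.

Definition incr (s t : R) (w : T) : Borel R d := (B t w - B s w : 'cV[R]_d).

Lemma nf_sigma_algebra t : 0 <= t -> sigma_algebra setT (NF t).
Proof. by move=> t0; case: HB => [[h _ _] _ _ _ _]; exact: h. Qed.

Lemma nf_sub t : 0 <= t -> NF t `<=` measurable.
Proof. by move=> t0; case: HB => [[_ h _] _ _ _ _]; exact: h. Qed.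

Lemma nf_mono s t : 0 <= s -> s <= t -> NF s `<=` NF t.
Proof. by move=> s0 st; case: HB => [[_ _ h] _ _ _ _]; exact: h. Qed.

Lemma brownian_Fmeas s t : 0 <= s -> s <= t ->
  Fmeas (NF t) (B s : T -> Borel R d).
Proof.
move=> s0 st; apply: (Fmeas_mono (nf_mono s0 st)).
apply: preimage_Fmeas => A mA; case: HB => _ ad _ _ _; exact: ad.
Qed.

Lemma incr_Fmeas s t u : 0 <= s -> s <= t -> t <= u -> Fmeas (NF u) (incr s t).
Proof.
move=> s0 st tu; apply: measurable_BorelB.
  by apply: brownian_Fmeas => //; exact: le_trans st.
by apply: brownian_Fmeas => //; exact: le_trans tu.
Qed.

Lemma incr_measurable s t : 0 <= s -> s <= t -> measurable_fun setT (incr s t).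
Proof.
move=> s0 st; apply: (Fmeas_measurable (nf_sub (le_trans s0 st))).
exact: incr_Fmeas.
Qed.

Lemma incr_indep (nu : probability (Borel R d) R) (h s t : R) :
  gaussian_boxes nu h -> 0 <= s -> 0 < h -> t = s + h ->
  forall E A, NF s E -> measurable A ->
    P (E `&` incr s t @^-1` A) = (P E * nu A)%E.
Proof.
move=> gnu s0 h0 ts E A FE mA.
have st : s < t by rewrite ts ltrDl.
apply: (@indep_from_pisystem _ _ _ _ (Borel R d) P nu (incr s t) E (@boxes R d)) => //.
- by apply: incr_measurable => //; exact: ltW.
- exact: (nf_sub s0).
- exact: Borel_boxes.
- exact: boxes_setI.
- exact: boxes_setT.
- move=> _ [C [mC ->]]; rewrite gnu//.
  case: HB => _ _ _ _ inc; have := inc s t E C s0 st FE mC.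
  by rewrite ts addrAC subrr add0r.
Qed.

(** The Gaussian law on R^d is not constructed: it is the law of the increment of the given Brownian
    motion over [0, h]. *)
Lemma incr_gaussian (h : R) : 0 < h ->
  exists nu : probability (Borel R d) R, gaussian_boxes nu h.
Proof.
move=> h0; have mi := incr_measurable (lexx 0) (ltW h0).
pose X : {mfun T >-> Borel R d} :=
  HB.pack (incr 0 h) (isMeasurableFun.Build _ _ _ _ (incr 0 h) mi).
exists (distribution P X) => A mA.
case: HB => _ _ _ _ inc.
have FT : NF 0 setT.
  have [h1 h2 _] := nf_sigma_algebra (lexx 0).
  by rewrite -(setD0 setT); exact: h2.
have := inc 0 h setT A (lexx 0) h0 FT mA.
by rewrite setTI probability_setT mul1e subr0.
Qed.

Variables (b : 'cV[R]_d -> 'cV[R]_d) (sigma : 'cV[R]_d -> 'M[R]_d).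
Hypotheses (lb : elipschitz b) (ls : elipschitz sigma).

Definition euler_step (gamma : R) (p : Borel R d * Borel R d) : Borel R d :=
  (p.1 + gamma *: b p.1 + sigma p.1 *m p.2 : 'cV[R]_d).

Lemma euler_step_measurable gamma : measurable_fun setT (euler_step gamma).
Proof.
exact: measurable_step.
Qed.

Lemma euler_chain_Fmeas gamma x n : 0 < gamma ->
  Fmeas (NF (gamma * n%:R)) (euler_chain b sigma gamma x B n : T -> Borel R d).
Proof.
move=> g0.
have tle m k : (m <= k)%N -> gamma * m%:R <= gamma * k%:R.
  by move=> mk; rewrite ler_wpM2l ?ler_nat// ltW.
have t0 m : 0 <= gamma * m%:R by rewrite mulr_ge0// ltW.
elim: n => [|n ih]; first exact: measurable_cst.
apply: measurable_step => //.
  by apply: Fmeas_mono ih; apply: nf_mono => //; exact: tle.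
by apply: incr_Fmeas => //; exact: tle.
Qed.

Lemma euler_chain_driven nu gamma x : 0 < gamma -> gaussian_boxes nu gamma ->
  driven nu (euler_step gamma) P (fun n => NF (gamma * n%:R))
    (fun n => (euler_chain b sigma gamma x B n : T -> Borel R d))
    (fun n => incr (gamma * n%:R) (gamma * n.+1%:R)).
Proof.
move=> g0 gnu.
have t0 n : 0 <= gamma * n%:R by rewrite mulr_ge0// ltW.
have tS n : gamma * n.+1%:R = gamma * n%:R + gamma by rewrite -addn1 natrD mulrDr mulr1.
have tle n m : (n <= m)%N -> gamma * n%:R <= gamma * m%:R.
  by move=> nm; rewrite ler_wpM2l ?ler_nat// ltW.
split.
- by move=> n; exact: nf_sigma_algebra.
- by move=> n; exact: nf_sub.
- by move=> n m nm; apply: nf_mono => //; exact: tle.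
split.
- by move=> n; exact: euler_chain_Fmeas.
- by move=> n; apply: incr_measurable => //; exact: tle.
- by move=> n E A FE mA; apply: (incr_indep gnu).
- by [].
Qed.

(** The coupled schemes as one chain on pairs. The innovation consists of two half-step increments,
    and the coarse component moves with their sum. *)
Definition pair_step (gamma : R)
    (p : (Borel R d * Borel R d) * (Borel R d * Borel R d)) :
    Borel R d * Borel R d :=
  (euler_step gamma (p.1.1, (p.2.1 + p.2.2 : 'cV[R]_d)),
   euler_step (gamma / 2) (euler_step (gamma / 2) (p.1.2, p.2.1), p.2.2)).

Lemma pair_step_measurable gamma : measurable_fun setT (pair_step gamma).
Proof.
have m1 : measurable_fun setT
    (fun p : (Borel R d * Borel R d) * (Borel R d * Borel R d) => p.1.1).
  by apply: measurableT_comp => //; exact: measurable_fst.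
have m2 : measurable_fun setT
    (fun p : (Borel R d * Borel R d) * (Borel R d * Borel R d) => p.1.2).
  by apply: measurableT_comp => //; exact: measurable_snd.
have m3 : measurable_fun setT
    (fun p : (Borel R d * Borel R d) * (Borel R d * Borel R d) => p.2.1).
  by apply: measurableT_comp => //; exact: measurable_fst.
have m4 : measurable_fun setT
    (fun p : (Borel R d * Borel R d) * (Borel R d * Borel R d) => p.2.2).
  by apply: measurableT_comp => //; exact: measurable_snd.
apply: measurable_fun_pair.
  exact: (measurableT_comp (euler_step_measurable gamma)
    (measurable_fun_pair m1 (measurable_BorelD m3 m4))).
have m5 := measurableT_comp (euler_step_measurable (gamma / 2))
  (measurable_fun_pair m2 m3).
exact: (measurableT_comp (euler_step_measurable (gamma / 2))
  (measurable_fun_pair m5 m4)).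
Qed.

Lemma euler_pair_driven nu gamma x : 0 < gamma -> gaussian_boxes nu (gamma / 2) ->
  driven (nu \x nu)%E (pair_step gamma) P (fun n => NF (gamma * n%:R))
    (fun n w => (euler_chain b sigma gamma x B n w : Borel R d,
                 euler_chain b sigma (gamma / 2) x B n.*2 w : Borel R d))
    (fun n w => (incr (gamma / 2 * n.*2%:R) (gamma / 2 * n.*2.+1%:R) w,
                 incr (gamma / 2 * n.*2.+1%:R) (gamma / 2 * n.*2.+2%:R) w)).
Proof.
move=> g0 gnu; have h0 : 0 < gamma / 2 by rewrite divr_gt0.
have [sF FM Fmono [mZ mxi ind ZE]] := euler_chain_driven x h0 gnu.
have tE n : gamma / 2 * n.*2%:R = gamma * n%:R.
  by rewrite -muln2 natrM; field.
have g2 n : (n <= n.+1)%N by [].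
have t0 n : 0 <= gamma * n%:R by rewrite mulr_ge0// ltW.
split.
- by move=> n; exact: nf_sigma_algebra.
- by move=> n; exact: nf_sub.
- move=> n m nm; apply: nf_mono => //; by rewrite ler_wpM2l ?ler_nat// ltW.
split.
- move=> n; apply: Fmeas_pair; first exact: euler_chain_Fmeas.
  by rewrite -tE; exact: euler_chain_Fmeas.
- by move=> n; apply: measurable_fun_pair.
- move=> n E A FE mA.
  have FE' : NF (gamma / 2 * n.*2%:R) E by rewrite tE.
  apply: (indep_from_pisystem (G := [set C | exists A1 A2,
     [/\ measurable A1, measurable A2 & C = A1 `*` A2]])) => //.
  + by apply: measurable_fun_pair.
  + exact: nf_sub FE.
  + rewrite measurable_prod_measurableType; congr (<<s _ >>).
    rewrite predeqE; split => [[A1 mA1 [A2 mA2 <-]]|[A1 [A2 [mA1 mA2 ->]]]].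
      by exists A1, A2.
    by exists A1 => //; exists A2.
  + move=> _ _ [A1 [A2 [mA1 mA2 ->]]] [C1 [C2 [mC1 mC2 ->]]].
    rewrite -setXI; exists (A1 `&` C1), (A2 `&` C2).
    by split => //; exact: measurableI.
  + by exists setT, setT; split => //; rewrite setXTT.
  (* On a rectangle, independence is used twice: the first half-increment is independent of the past
     at time gamma n, the second of the past half a step later, to which [E] and the first event
     both belong. *)
  + move=> _ [A1 [A2 [mA1 mA2 ->]]].
    rewrite [X in _ = (_ * X)%E](_ : _ = (nu A1 * nu A2)%E); last first.
      exact: product_measure1E.
    rewrite muleA -(ind n.*2 E A1)//.
    rewrite -(ind n.*2.+1 _ A2)//; last first.
      have hE : NF (gamma / 2 * n.*2.+1%:R) E by apply: (Fmono n.*2).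
      have sN : sigma_algebra setT (NF (gamma / 2 * n.*2.+1%:R)).
        by apply: nf_sigma_algebra; rewrite mulr_ge0// ltW.
      apply: (sigma_algebra_setI sN) => //.
      apply: (Fmeas_preimage sN _ mA1); apply: incr_Fmeas => //.
        by rewrite mulr_ge0// ltW.
      by rewrite ler_wpM2l ?ler_nat// ltW.
    by congr (P _); rewrite -setIA.
- move=> n w; rewrite doubleS -[RHS]/(_, _) /=; congr pair.
  rewrite /euler_step /= /incr; congr (_ + _ *m _).
  by rewrite -!tE doubleS [RHS]addrC addrA subrK.
Qed.

End Brownian.

(** * Square-integrable variables *)

Section SquareIntegrable.
Context {R : realType} {disp : measure_display} {T : measurableType disp}
  (P : probability T R).
Implicit Types (X Y : T -> R) (a b c : R).

Definition Ex X : R := \int[P]_w X w.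

(** The second moment is bounded in the extended reals, so that the bound itself entails
    square-integrability. *)
Definition L2le X a := [/\ measurable_fun setT X, 0 <= a &
  (\int[P]_w (X w ^+ 2)%:E <= (a ^+ 2)%:E)%E].

Definition sqi X := exists a, L2le X a.

Lemma L2le_sqi X a : L2le X a -> sqi X. Proof. by exists a. Qed.

Lemma sqr_integrable X : sqi X -> P.-integrable setT (EFin \o (fun w => X w ^+ 2)).
Proof.
move=> [a [mX a0 h]]; apply/integrableP; split.
  by apply/measurable_EFinP; exact: measurable_funX.
apply: (@le_lt_trans _ _ (a ^+ 2)%:E); last exact: ltry.
apply: le_trans h; rewrite le_eqVlt; apply/orP; left; apply/eqP.
by apply: eq_integral => w _; rewrite /= ger0_norm// sqr_ge0.
Qed.

Lemma mul_integrable X Y : sqi X -> sqi Y ->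
  P.-integrable setT (EFin \o (fun w => X w * Y w)).
Proof.
move=> sX sY; have iX := sqr_integrable sX; have iY := sqr_integrable sY.
have [a [mX _ _]] := sX; have [b [mY _ _]] := sY.
have /= iS := integrableD measurableT iX iY.
apply: le_integrable iS => //.
  by apply/measurable_EFinP; exact: measurable_funM.
move=> w _ /=; rewrite lee_fin.
rewrite [leRHS]ger0_norm ?addr_ge0 ?sqr_ge0// normrM.
rewrite -[X w ^+ 2]real_normK ?num_real// -[Y w ^+ 2]real_normK ?num_real//.
have := sqr_ge0 (`|X w| - `|Y w|); nra.
Qed.

Lemma cst_sqi c : sqi (cst c).
Proof.
exists `|c|; split => //; rewrite (eq_integral (cst (c ^+ 2)%:E))//.
rewrite integral_cst// [X in (_ * X)%E](_ : _ = 1%E); last exact: probability_setT.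
by rewrite mule1 lee_fin real_normK ?num_real.
Qed.

Lemma sqi_integrable X : sqi X -> P.-integrable setT (EFin \o X).
Proof.
move=> sX; have := mul_integrable sX (cst_sqi 1).
by apply: eq_integrable => // w _; rewrite /= mulr1.
Qed.

Lemma Ex_sqr_le X a : L2le X a -> Ex (fun w => X w ^+ 2) <= a ^+ 2.
Proof.
move=> hX; have [mX a0 h] := hX.
rewrite -lee_fin /Ex /Rintegral fineK//.
by apply: integrable_fin_num => //; exact: (sqr_integrable (L2le_sqi hX)).
Qed.

Lemma L2leP X a : sqi X -> 0 <= a -> Ex (fun w => X w ^+ 2) <= a ^+ 2 -> L2le X a.
Proof.
move=> sX a0 h; have [b [mX _ _]] := sX; split => //.
rewrite -lee_fin /Ex /Rintegral fineK// in h.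
by apply: integrable_fin_num => //; exact: sqr_integrable sX.
Qed.

Lemma sqi_measurable X : sqi X -> measurable_fun setT X.
Proof. by case=> a []. Qed.

Lemma ExD X Y : P.-integrable setT (EFin \o X) -> P.-integrable setT (EFin \o Y) ->
  Ex (fun w => X w + Y w) = Ex X + Ex Y.
Proof. by move=> iX iY; rewrite /Ex RintegralD. Qed.

Lemma ExB X Y : P.-integrable setT (EFin \o X) -> P.-integrable setT (EFin \o Y) ->
  Ex (fun w => X w - Y w) = Ex X - Ex Y.
Proof. by move=> iX iY; rewrite /Ex RintegralB. Qed.

Lemma ExZ c X : P.-integrable setT (EFin \o X) ->
  Ex (fun w => c * X w) = c * Ex X.
Proof. by move=> iX; rewrite /Ex RintegralZl. Qed.

Lemma Ex_cst c : Ex (fun=> c) = c.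
Proof.
by rewrite /Ex Rintegral_cst// [X in fine X](_ : _ = 1%E) ?mulr1//; exact: probability_setT.
Qed.

Lemma Ex_le X Y : P.-integrable setT (EFin \o X) -> P.-integrable setT (EFin \o Y) ->
  (forall w, X w <= Y w) -> Ex X <= Ex Y.
Proof. by move=> iX iY h; rewrite /Ex le_Rintegral. Qed.

Lemma Ex_ge0 X : (forall w, 0 <= X w) -> 0 <= Ex X.
Proof. by move=> h; apply: Rintegral_ge0. Qed.

Lemma integrable_scale c X : P.-integrable setT (EFin \o X) ->
  P.-integrable setT (EFin \o (fun w => c * X w)).
Proof.
by move=> iX; have := integrableZl measurableT c iX; apply: eq_integrable => // w _ /=; rewrite EFinM.
Qed.

Lemma integrable_add X Y : P.-integrable setT (EFin \o X) ->
  P.-integrable setT (EFin \o Y) ->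
  P.-integrable setT (EFin \o (fun w => X w + Y w)).
Proof. by move=> mf mg; exact: (integrableD measurableT mf mg). Qed.

Lemma sqi_norm X : sqi X -> sqi (fun w => `|X w|).
Proof.
move=> [a [mX a0 h]]; exists a; split => //; first exact: measurableT_comp.
by under eq_integral do rewrite real_normK ?num_real//.
Qed.

Lemma cauchy_schwarz X Y a b : L2le X a -> L2le Y b ->
  Ex (fun w => `|X w * Y w|) <= a * b.
Proof.
move=> hX hY; have sX := L2le_sqi hX; have sY := L2le_sqi hY.
have [_ a0 _] := hX; have [_ b0 _] := hY.
have iX := sqr_integrable sX; have iY := sqr_integrable sY.
have eX := Ex_sqr_le hX; have eY := Ex_sqr_le hY.
have iXY : P.-integrable setT (EFin \o (fun w => `|X w * Y w|)).
  have := mul_integrable (sqi_norm sX) (sqi_norm sY).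
  by apply: eq_integrable => // w _; rewrite /= normrM.
(* AM-GM with weights [t] and [t^-1], then optimise over [t] *)
have key t : 0 < t -> Ex (fun w => `|X w * Y w|) <=
    t / 2 * a ^+ 2 + t^-1 / 2 * b ^+ 2.
  move=> t0; apply: (@le_trans _ _ (Ex (fun w => t / 2 * X w ^+ 2 + t^-1 / 2 * Y w ^+ 2))).
    apply: Ex_le => //.
      by apply: integrable_add; exact: integrable_scale.
    move=> w; rewrite normrM.
    rewrite -[X w ^+ 2]real_normK ?num_real// -[Y w ^+ 2]real_normK ?num_real//.
    have ti : 0 < t^-1 by rewrite invr_gt0.
    have tt : t * t^-1 = 1 by rewrite mulfV// gt_eqF.
    set x := `|X w|; set y := `|Y w|.
    have : 0 <= t^-1 * (t * x - y) ^+ 2 by rewrite mulr_ge0 ?sqr_ge0// ltW.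
    have -> : t^-1 * (t * x - y) ^+ 2 = (t * t^-1) * t * x ^+ 2
        - 2 * (t * t^-1) * x * y + t^-1 * y ^+ 2 by ring.
    rewrite tt; lra.
  rewrite ExD ?ExZ//; try exact: integrable_scale.
  have ti : 0 <= t^-1 by rewrite invr_ge0 ltW.
  by apply: lerD; apply: ler_wpM2l => //; apply: divr_ge0 => //; exact: ltW.
have E0 : 0 <= Ex (fun w => `|X w * Y w|) by exact: Ex_ge0.
apply/ler_addgt0Pr => e e0.
(* The optimal weight b/a needs positive numbers, so both bounds are first raised by an amount that
   adds at most [e] to their product. *)
pose a' := a + e / (a + b + e + 1); pose b' := b + e / (a + b + e + 1).
have D0 : 0 < a + b + e + 1 by rewrite ltr_wpDl// addr_ge0 ?(ltW e0)// addr_ge0.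
have de0 : 0 < e / (a + b + e + 1) by exact: divr_gt0.
have a'0 : 0 < a' by rewrite /a' ltr_wpDl.
have b'0 : 0 < b' by rewrite /b' ltr_wpDl.
apply: (@le_trans _ _ (a' * b')).
  apply: le_trans (key (b' / a') (divr_gt0 b'0 a'0)) _.
  apply: (@le_trans _ _ (b' / a' / 2 * a' ^+ 2 + (b' / a')^-1 / 2 * b' ^+ 2)).
    apply: lerD; apply: ler_wpM2l.
    - by apply: divr_ge0 => //; apply: divr_ge0; exact: ltW.
    - by rewrite lerXn2r ?nnegrE ?(ltW a'0)// lerDl ltW.
    - by apply: divr_ge0 => //; rewrite invr_ge0; apply: divr_ge0; exact: ltW.
    - by rewrite lerXn2r ?nnegrE ?(ltW b'0)// lerDl ltW.
  rewrite le_eqVlt; apply/orP; left; apply/eqP.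
  by field; rewrite !gt_eqF.
rewrite /a' /b'; set f := e / _ in de0 *.
have fe : f * (a + b + e + 1) = e by rewrite /f divfK// gt_eqF.
have fle : f <= 1.
  by rewrite /f ler_pdivrMr// mul1r; lra.
have : f * f <= f * 1 by rewrite ler_wpM2l// ltW.
have : 0 <= f * e by apply: mulr_ge0; exact: ltW.
have : f * e = e - f * (a + b) - f by rewrite -[in RHS]fe; ring.
by nra.
Qed.

Lemma norm_Ex_le X : P.-integrable setT (EFin \o X) ->
  `|Ex X| <= Ex (fun w => `|X w|).
Proof. by move=> iX; exact: le_normr_Rintegral. Qed.

Lemma cauchy_schwarz_norm X Y a b : L2le X a -> L2le Y b ->
  `|Ex (fun w => X w * Y w)| <= a * b.
Proof.
move=> hX hY; apply: le_trans (cauchy_schwarz hX hY).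
by apply: norm_Ex_le; apply: mul_integrable; [exact: L2le_sqi hX|exact: L2le_sqi hY].
Qed.

Lemma L2le_scale c X a : L2le X a -> L2le (fun w => c * X w) (`|c| * a).
Proof.
move=> [mX a0 h]; split; first exact: measurable_funM.
  exact: mulr_ge0.
under eq_integral do rewrite exprMn EFinM.
rewrite ge0_integralZl//.
- rewrite exprMn real_normK ?num_real// (EFinM (c ^+ 2) (a ^+ 2)).
  by apply: lee_pmul => //; [rewrite lee_fin sqr_ge0|apply: integral_ge0 => w _; rewrite lee_fin sqr_ge0].
- by apply/measurable_EFinP; exact: measurable_funX.
- by move=> w _; rewrite lee_fin sqr_ge0.
- by rewrite lee_fin sqr_ge0.
Qed.

Lemma sqiD X Y : sqi X -> sqi Y -> sqi (fun w => X w + Y w).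
Proof.
move=> sX sY; have mX := sqi_measurable sX; have mY := sqi_measurable sY.
have iX := sqr_integrable sX; have iY := sqr_integrable sY.
have iS := integrable_add (integrable_scale 2 iX) (integrable_scale 2 iY).
have E0 : 0 <= Ex (fun w => 2 * X w ^+ 2 + 2 * Y w ^+ 2).
  by apply: Ex_ge0 => w; rewrite addr_ge0// mulr_ge0// sqr_ge0.
exists (Num.sqrt (Ex (fun w => 2 * X w ^+ 2 + 2 * Y w ^+ 2))); split.
- exact: measurable_funD.
- exact: sqrtr_ge0.
rewrite sqr_sqrtr// /Ex /Rintegral fineK; last exact: integrable_fin_num.
apply: ge0_le_integral => //.
- by move=> w _; rewrite lee_fin sqr_ge0.
- by apply/measurable_EFinP; apply: measurable_funX; exact: measurable_funD.
- by case/integrableP: iS.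
- move=> w _; rewrite lee_fin; have := sqr_ge0 (X w - Y w); nra.
Qed.

Lemma sqiZ c X : sqi X -> sqi (fun w => c * X w).
Proof. by move=> [a h]; exists (`|c| * a); exact: L2le_scale. Qed.

Lemma sqiB X Y : sqi X -> sqi Y -> sqi (fun w => X w - Y w).
Proof.
move=> sX sY; have := sqiD sX (sqiZ (-1) sY).
by under eq_fun do rewrite mulN1r.
Qed.

Lemma sqi_sum n (X : nat -> T -> R) : (forall k, (k < n)%N -> sqi (X k)) ->
  sqi (fun w => \sum_(k < n) X k w).
Proof.
elim: n => [|n ih] h.
  by under eq_fun do rewrite big_ord0; exact: cst_sqi.
under eq_fun do rewrite big_ord_recr/=.
by apply: sqiD; [apply: ih => k kn; apply: h; exact: ltnW|exact: h].
Qed.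

Lemma Ex_sum n (X : nat -> T -> R) :
  (forall k, (k < n)%N -> P.-integrable setT (EFin \o X k)) ->
  P.-integrable setT (EFin \o (fun w => \sum_(k < n) X k w)) /\
  Ex (fun w => \sum_(k < n) X k w) = \sum_(k < n) Ex (X k).
Proof.
elim: n => [|n ih] h.
  have F : (fun w => \sum_(k < 0) X k w) = cst 0.
    by apply/funext => w; rewrite big_ord0.
  rewrite F big_ord0; split; last exact: Ex_cst.
  exact/sqi_integrable/cst_sqi.
have [i e] := ih (fun k kn => h k (ltnW kn)).
have F : (fun w => \sum_(k < n.+1) X k w) = (fun w => \sum_(k < n) X k w + X n w).
  by apply/funext => w; rewrite big_ord_recr.
rewrite F big_ord_recr/= -e ExD//; last exact: h.
by split => //; apply: integrable_add => //; exact: h.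
Qed.

Lemma L2le_dominated X Y a L : measurable_fun setT Y -> 0 <= L ->
  (forall w, `|Y w| <= L * `|X w|) -> L2le X a -> L2le Y (L * a).
Proof.
move=> mY L0 h hX; have [mX' a0 _] := hX.
have [_ _ e] := L2le_scale L hX; split => //; first exact: mulr_ge0.
rewrite ger0_norm// in e; apply: le_trans e; apply: ge0_le_integral => //.
- by move=> w _; rewrite lee_fin sqr_ge0.
- by apply/measurable_EFinP; exact: measurable_funX.
- by apply/measurable_EFinP; apply: measurable_funX; exact: measurable_funM.
- move=> w _; rewrite lee_fin -[leLHS]real_normK ?num_real//.
  rewrite -[leRHS]real_normK ?num_real//.
  by rewrite lerXn2r ?nnegrE// normrM (ger0_norm L0).
Qed.

(** The mean is the constant nearest to [X] in L^2. In the application [c] is f(x_0), because (H4)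
    bounds f(X_t) - f(x_0) and not f(X_t). *)
Lemma L2le_center_at X a c : L2le (fun w => X w - c) a ->
  L2le (fun w => X w - Ex X) a.
Proof.
move=> hX; have sX := L2le_sqi hX; have [_ a0 _] := hX.
have sX' : sqi X.
  have := sqiD sX (cst_sqi c); by under eq_fun do rewrite /= subrK.
have iX := sqi_integrable sX'.
have EXc : Ex (fun w => X w - c) = Ex X - c.
  by rewrite ExB ?Ex_cst//; exact/sqi_integrable/(cst_sqi c).
apply: L2leP => //; first exact: sqiB sX' (cst_sqi _).
apply: le_trans (Ex_sqr_le hX); set m := Ex X.
have F : (fun w => (X w - m) ^+ 2) =
    (fun w => ((X w - c) ^+ 2 - 2 * (m - c) * (X w - c)) + (m - c) ^+ 2).
  by apply/funext => w; ring.
have i1 := sqr_integrable sX.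
have i2 := integrable_scale (2 * (m - c)) (sqi_integrable sX).
have i3 := sqi_integrable (cst_sqi ((m - c) ^+ 2)).
rewrite F ExD//; last exact: integrable_sub.
rewrite ExB// ExZ ?Ex_cst//; last exact: sqi_integrable.
rewrite EXc -/m; have := sqr_ge0 (m - c); lra.
Qed.

Lemma L2le_center X a : L2le X a -> L2le (fun w => X w - Ex X) a.
Proof.
by move=> hX; apply: (@L2le_center_at _ _ 0); under eq_fun do rewrite subr0.
Qed.

Lemma Ex_center X : sqi X -> Ex (fun w => X w - Ex X) = 0.
Proof.
move=> sX; rewrite ExB ?Ex_cst ?subrr//; first exact: sqi_integrable.
exact/sqi_integrable/(cst_sqi _).
Qed.

Lemma L2norm_sqr X : L2norm P X = ((\int[P]_w (X w ^+ 2)%:E) `^ (2^-1))%E.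
Proof.
rewrite /L2norm unlock; congr (_ `^ _)%E; apply: eq_integral => w _.
by rewrite /= powR_mulrn// real_normK ?num_real.
Qed.

Lemma L2norm_le X a : measurable_fun setT X -> (L2norm P X <= a%:E)%E -> L2le X a.
Proof.
move=> mX h; have a0 : 0 <= a by rewrite -lee_fin; apply: le_trans h; exact: Lnorm_ge0.
split => //; move: h; rewrite L2norm_sqr.
have I0 : (0 <= \int[P]_w (X w ^+ 2)%:E)%E.
  by apply: integral_ge0 => w _; rewrite lee_fin sqr_ge0.
case: (\int[P]_w _)%E I0 => [x|_|//]; last first.
  by rewrite poweRyr ?invr_neq0// leye_eq.
rewrite lee_fin => x0; rewrite poweR_EFin !lee_fin powR12_sqrt// => h.
by rewrite -(sqr_sqrtr x0) lerXn2r ?nnegrE ?sqrtr_ge0.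
Qed.

Lemma le_L2norm X a : L2le X a -> (L2norm P X <= a%:E)%E.
Proof.
move=> [mX a0 h]; rewrite L2norm_sqr; move: h.
have I0 : (0 <= \int[P]_w (X w ^+ 2)%:E)%E.
  by apply: integral_ge0 => w _; rewrite lee_fin sqr_ge0.
case: (\int[P]_w _)%E I0 => [x|_|//]; last by rewrite leye_eq.
rewrite lee_fin => x0; rewrite poweR_EFin !lee_fin powR12_sqrt// => h.
by rewrite -[leRHS]ger0_norm// -sqrtr_sqr ler_wsqrtr.
Qed.

End SquareIntegrable.

(** The joint law is the product of the two laws. Square-integrability makes [U * V] integrable, and
    this is carried over to the product measure, where Fubini applies. *)
Lemma indep_Ex_mul {R : realType} {disp} {T : measurableType disp}
    (P : probability T R) (U V : T -> R) :
  sqi P U -> sqi P V ->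
  (forall A B, measurable A -> measurable B ->
     P (U @^-1` A `&` V @^-1` B) = (P (U @^-1` A) * P (V @^-1` B))%E) ->
  Ex P (fun w => U w * V w) = Ex P U * Ex P V.
Proof.
move=> sU sV ind; have mU := sqi_measurable sU; have mV := sqi_measurable sV.
pose X : {mfun T >-> R} := HB.pack U (isMeasurableFun.Build _ _ _ _ U mU).
pose Y : {mfun T >-> R} := HB.pack V (isMeasurableFun.Build _ _ _ _ V mV).
pose uv w := (U w, V w).
have muv : measurable_fun setT uv by exact: measurable_fun_pair.
pose Z : {mfun T >-> (R * R)%type} :=
  HB.pack uv (isMeasurableFun.Build _ _ _ _ uv muv).
have E : forall C, measurable C ->
    (distribution P X \x distribution P Y)%E C = distribution P Z C.
  by move=> C mC; apply: product_measure_unique => // A B mA mB; exact: ind.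
have iU := sqi_integrable sU; have iV := sqi_integrable sV.
have iUV := mul_integrable sU sV.
pose h (p : R * R) : \bar R := (p.1 * p.2)%:E.
have mh : measurable_fun setT h.
  apply/measurable_EFinP; apply: measurable_funM; first exact: measurable_fst.
  exact: measurable_snd.
have mi : measurable_fun setT (EFin : R -> \bar R) by exact: EFin_measurable.
have EUV : (\int[P]_w (U w * V w)%:E = (Ex P U * Ex P V)%:E)%E.
  transitivity (\int[distribution P Z]_p h p)%E.
    by rewrite integral_distribution.
  have iZ : (distribution P Z).-integrable setT h.
    by apply: integrable_pushforward.
  rewrite (eq_measure_integral (distribution P X \x distribution P Y)%E); last first.
    by move=> C mC _; apply/esym; exact: E.
  rewrite -integral12_prod_meas1; last first.
    apply/integrableP; split => //.
    rewrite (eq_measure_integral (distribution P Z)).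
      by case/integrableP: iZ.
    by move=> C mC _; exact: E.
  have iY : (distribution P Y).-integrable setT (EFin : R -> \bar R).
    by apply: integrable_pushforward.
  have iX : (distribution P X).-integrable setT (EFin : R -> \bar R).
    by apply: integrable_pushforward.
  have EY : (\int[distribution P Y]_y y%:E = (Ex P V)%:E)%E.
    by rewrite integral_distribution// /Ex /Rintegral fineK//; exact: integrable_fin_num.
  have EX : (\int[distribution P X]_y y%:E = (Ex P U)%:E)%E.
    by rewrite integral_distribution// /Ex /Rintegral fineK//; exact: integrable_fin_num.
  transitivity (\int[distribution P X]_x (x%:E * (Ex P V)%:E))%E.
    apply: eq_integral => x _; rewrite /fubini_F /h /=.
    under eq_integral do rewrite EFinM.
    by rewrite integralZl// EY.
  by rewrite integralZr// EX EFinM.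
by rewrite {1}/Ex /Rintegral EUV.
Qed.

(** * Time averages over a grid *)

Section Weights.
Context {R : realType}.
Implicit Types (eta tau h alpha : R).

(** Neither [tau] nor [h] need be a grid point, so the cells at both ends can be cut. *)
Definition cell eta tau h (k : nat) : set R :=
  `[tau, h] `&` `[eta * k%:R, eta * k.+1%:R[.

Definition weight eta tau h k : R := fine (lebesgue_measure (cell eta tau h k)).

Lemma cell_measurable eta tau h k : measurable (cell eta tau h k).
Proof. by apply: measurableI; exact: measurable_itv. Qed.

Lemma cell_le eta tau h k : 0 < eta ->
  (lebesgue_measure (cell eta tau h k) <= eta%:E)%E.
Proof.
move=> e0; have lt : eta * k%:R < eta * k.+1%:R by rewrite ltr_pM2l// ltr_nat.
apply: (@le_trans _ _ (lebesgue_measure `[eta * k%:R, eta * k.+1%:R[)).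
  by apply: le_measure; rewrite ?inE; [exact: cell_measurable|exact: measurable_itv|apply: subIsetr].
rewrite lebesgue_measure_itv /= lte_fin lt lee_fin.
by rewrite -addn1 natrD mulrDr mulr1 addrAC subrr add0r.
Qed.

Lemma cell_fin eta tau h k : 0 < eta ->
  lebesgue_measure (cell eta tau h k) \is a fin_num.
Proof.
move=> e0; rewrite ge0_fin_numE ?measure_ge0//.
by apply: le_lt_trans (cell_le _ _ _ e0) _; exact: ltry.
Qed.

Lemma weight_bounds eta tau h k : 0 < eta -> 0 <= weight eta tau h k <= eta.
Proof.
move=> e0; rewrite /weight fine_ge0 ?measure_ge0//=.
by rewrite -lee_fin fineK ?cell_fin ?cell_le.
Qed.

Lemma weight_eq0 eta tau h k : eta * k.+1%:R <= tau -> weight eta tau h k = 0.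
Proof.
move=> le; rewrite /weight (_ : cell _ _ _ _ = set0) ?measure0//.
rewrite predeqE => s; split => //; rewrite /cell /= !in_itv /= => -[/andP[a _] /andP[_ c]].
by have := lt_le_trans c (le_trans le a); rewrite ltxx.
Qed.

Lemma truncn_cell eta s k : 0 < eta -> 0 <= s ->
  (eta * k%:R <= s < eta * k.+1%:R) = (Num.truncn (s / eta) == k).
Proof.
move=> e0 s0; have se : 0 <= s / eta by rewrite divr_ge0// ltW.
rewrite truncn_eq//.
by rewrite ler_pdivlMr// ltr_pdivrMr// ![_ * eta]mulrC.
Qed.

(** The cell that contains [h] is counted; when [h] is a multiple of [eta], it is cut to one point
    and has weight zero. *)
Definition ncells eta h := (Num.truncn (h / eta)).+1.

Lemma step_Rintegral eta tau h (phi : nat -> R) : 0 < eta -> 0 <= tau ->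
  \int[lebesgue_measure]_(s in `[tau, h]) phi (Num.truncn (s / eta)) =
  \sum_(k < ncells eta h) weight eta tau h k * phi k.
Proof.
move=> e0 t0; rewrite /Rintegral.
have -> : (\int[lebesgue_measure]_(s in `[tau, h]) (phi (Num.truncn (s / eta)))%:E
  = \int[lebesgue_measure]_(s in `[tau, h])
      \sum_(k < ncells eta h) (phi k * \1_(cell eta tau h k) s)%:E)%E.
  apply: eq_integral => s; rewrite inE /= => sI.
  have /andP[ts sh] : tau <= s <= h by move: sI; rewrite in_itv.
  have s0 : 0 <= s by exact: le_trans ts.
  have kn : (Num.truncn (s / eta) < ncells eta h)%N.
    by rewrite ltnS; apply: le_truncn; rewrite ler_pM2r// invr_gt0.
  rewrite sumEFin; congr EFin.
  rewrite (bigD1 (Ordinal kn))//= big1 ?addr0.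
    rewrite indicE mem_set ?mulr1//.
    by split => //=; rewrite in_itv /= truncn_cell.
  move=> k; rewrite -val_eqE /= => kn'.
  rewrite indicE memNset ?mulr0//.
  move=> [_] /=; rewrite in_itv /= truncn_cell// => /eqP kE.
  by rewrite -kE eqxx in kn'.
have int1 (k : nat) : (\int[lebesgue_measure]_(s in `[tau, h])
    (\1_(cell eta tau h k) s)%:E = (weight eta tau h k)%:E)%E.
  rewrite integral_indic//; last exact: cell_measurable.
  by rewrite (_ : _ `&` _ = cell eta tau h k) ?fineK ?cell_fin// setIidl// => s [].
have ind1 (k : nat) : lebesgue_measure.-integrable `[tau, h]
    (fun s => (\1_(cell eta tau h k) s)%:E).
  apply/integrableP; split.
    apply/measurable_EFinP; apply: measurable_funTS; apply: measurable_indic.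
    exact: cell_measurable.
  under eq_integral do rewrite gee0_abs ?lee_fin//.
  by rewrite int1 ltry.
have mI : measurable (`[tau, h] : set (measurableTypeR R)) by exact: measurable_itv.
have ik (k : nat) : lebesgue_measure.-integrable `[tau, h]
    (fun s => (phi k * \1_(cell eta tau h k) s)%:E).
  have := integrableZl mI (phi k) (ind1 k).
  by apply: eq_integrable => // s _; rewrite EFinM.
have -> : (\int[lebesgue_measure]_(s in `[tau, h])
    \sum_(k < ncells eta h) (phi k * \1_(cell eta tau h k) s)%:E =
  \sum_(k < ncells eta h) \int[lebesgue_measure]_(s in `[tau, h])
    (phi k * \1_(cell eta tau h k) s)%:E)%E.
  apply: (@integral_sum _ (measurableTypeR R) R lebesgue_measure _ mI _
    (fun (k : 'I_(ncells eta h)) (s : measurableTypeR R) =>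
    (phi k * \1_(cell eta tau h k) s)%:E)) => //.
have Ek (k : nat) : (\int[lebesgue_measure]_(s in `[tau, h])
    (phi k * \1_(cell eta tau h k) s)%:E = (weight eta tau h k * phi k)%:E)%E.
  under eq_integral do rewrite EFinM.
  by rewrite integralZl// int1 -EFinM mulrC.
under eq_bigr do rewrite Ek.
by rewrite sumEFin.
Qed.

Lemma sum_weight eta tau h : 0 < eta -> 0 <= tau -> tau <= h ->
  \sum_(k < ncells eta h) weight eta tau h k = h - tau.
Proof.
move=> e0 t0 th; have := @step_Rintegral eta tau h (fun=> 1) e0 t0.
under eq_bigr do rewrite mulr1.
move=> <-; rewrite Rintegral_cst// mul1r.
apply: (etrans (congr1 fine (lebesgue_measure_itv `[tau, h]))) => /=.
rewrite lte_fin; case: ltP => //= ht.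
by rewrite (@le_anti _ _ tau h) ?subrr// th ht.
Qed.

Lemma geom_sum_le (q : R) n : 0 <= q < 1 -> \sum_(j < n) q ^+ j <= (1 - q)^-1.
Proof.
move=> /andP[q0 q1]; have d0 : 0 < 1 - q by rewrite subr_gt0.
rewrite -[leRHS]mul1r ler_pdivlMr//.
have := subrX1 q n; rewrite -opprB -[q - 1]opprB mulNr => /oppr_inj.
by rewrite mulrC => <-; rewrite gerBl exprn_ge0.
Qed.

(** In units of time, the memory of the chain is [eta] / (1 - q): it stays of order 1/alpha however
    small the step. The reason is exp(-y) <= 1 - y/2 for 0 < y <= 1/2, at y = alpha eta. *)
Lemma step_ratio_le alpha eta : 0 < alpha <= 1 -> 0 < eta <= 1 / 2 ->
  eta * (1 - expR (- alpha * eta))^-1 <= 2 / alpha.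
Proof.
move=> /andP[a0 a1] /andP[e0 e1]; set x := alpha * eta.
have x0 : 0 < x by rewrite mulr_gt0.
have x1 : x <= 1 / 2 by rewrite /x; nra.
have E : expR (- alpha * eta) <= 1 - x / 2.
  rewrite mulNr expRN -/x invf_ple ?posrE ?expR_gt0//; last lra.
  apply: le_trans (expR_ge1Dx x).
  by rewrite -[leLHS]mul1r ler_pdivrMr; [nra|lra].
have d0 : 0 < x / 2 by lra.
apply: (@le_trans _ _ (eta * (x / 2)^-1)).
  rewrite ler_wpM2l ?(ltW e0)// lef_pV2 ?posrE//; lra.
by rewrite le_eqVlt; apply/orP; left; apply/eqP; rewrite /x; field; rewrite !gt_eqF.
Qed.

Lemma expR_half_le2 (x : R) : x <= 1 / 2 -> expR x <= 2.
Proof.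
move=> x1; rewrite -[x]opprK expRN invf_ple ?posrE ?expR_gt0//.
by apply: le_trans (expR_ge1Dx (- x)); lra.
Qed.

(** A Riemann sum for the integral of exp(- alpha s) over s >= tau. One factor 2 comes from
    [step_ratio_le], the other from the first cell, which may begin almost [eta] before [tau]. *)
Lemma sum_weight_exp alpha eta tau h : 0 < alpha <= 1 -> 0 < eta <= 1 / 2 ->
  0 <= tau ->
  \sum_(k < ncells eta h) weight eta tau h k * expR (- alpha * eta) ^+ k
    <= 4 / alpha * expR (- alpha * tau).
Proof.
move=> ha he t0; have /andP[a0 a1] := ha; have /andP[e0 e1] := he.
set q := expR _; have q0 : 0 <= q by exact: expR_ge0.
have q1 : q < 1 by rewrite /q expR_lt1 mulNr oppr_lt0 mulr_gt0.
pose k0 := Num.truncn (tau / eta).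
have te0 : 0 <= tau / eta by rewrite divr_ge0// ltW.
have /andP[k1 k2] : k0%:R <= tau / eta < k0.+1%:R by rewrite -truncn_eq.
rewrite ler_pdivlMr// in k1; rewrite ltr_pdivrMr// in k2.
have bnd k : weight eta tau h k * q ^+ k <= if (k0 <= k)%N then eta * q ^+ k else 0.
  case: leqP => kk.
    by rewrite ler_wpM2r ?exprn_ge0//; case/andP: (weight_bounds tau h k e0).
  rewrite weight_eq0 ?mul0r//; apply: le_trans k1.
  by rewrite mulrC ler_pM2r// ler_nat.
apply: (@le_trans _ _ (\sum_(k < k0 + ncells eta h)
    if (k0 <= k)%N then eta * q ^+ k else 0)).
  apply: (@le_trans _ _ (\sum_(k < ncells eta h)
    if (k0 <= k)%N then eta * q ^+ k else 0)); first exact: ler_sum.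
  rewrite [in leRHS]addnC big_split_ord /= lerDl; apply: sumr_ge0 => k _.
  by case: ifP => // _; rewrite mulr_ge0 ?exprn_ge0// ltW.
rewrite big_split_ord /= big1 ?add0r; last by move=> k _; rewrite leqNgt ltn_ord.
under eq_bigr do rewrite leq_addr exprD mulrA.
rewrite -mulr_sumr.
have qk0 : q ^+ k0 <= 2 * expR (- alpha * tau).
  rewrite /q -expRM_natl.
  apply: (@le_trans _ _ (expR (alpha * eta + - alpha * tau))).
    rewrite ler_expR; rewrite -addn1 natrD mulrDl mul1r in k2; nra.
  by rewrite expRD ler_wpM2r ?expR_ge0// expR_half_le2//; nra.
apply: (@le_trans _ _ (eta * q ^+ k0 * (1 - q)^-1)).
  by rewrite ler_wpM2l ?mulr_ge0 ?exprn_ge0 ?(ltW e0)// geom_sum_le// q0.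
rewrite mulrAC; have h1 := step_ratio_le ha he.
apply: (@le_trans _ _ (2 / alpha * (2 * expR (- alpha * tau)))).
  apply: ler_pM => //; last exact: exprn_ge0.
    by apply: mulr_ge0; [exact: ltW|rewrite invr_ge0 subr_ge0 ltW].
by rewrite le_eqVlt; apply/orP; left; apply/eqP; field; rewrite gt_eqF.
Qed.

(** The decaying bound falls below [A] after about log(B/A) / (alpha eta) terms: up to there each
    term is at most [A], beyond it the sum is geometric. Of the constant 3, 1 pays for rounding this
    index up and 2 for the geometric tail. *)
Lemma sum_min_geom alpha eta (A B : R) n : 0 < alpha <= 1 -> 0 < eta <= 1 / 2 ->
  0 <= A -> 0 <= B ->
  eta * \sum_(j < n) Num.min A (B * expR (- alpha * eta) ^+ j) <=
  A / alpha * (Num.max 0 (ln (B / A)) + 3).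
Proof.
move=> ha he A0 B0; have /andP[a0 a1] := ha; have /andP[e0 e1] := he.
(* For [A = 0] the ratio B/A is only a default value, but every minimum vanishes. *)
have [A1|A1] := eqVneq A 0.
  rewrite big1 ?mulr0 ?A1 ?mul0r// => j _; apply/min_idPl.
  by rewrite mulr_ge0// exprn_ge0// expR_ge0.
set q := expR _; have q0 : 0 <= q by exact: expR_ge0.
have q1 : q < 1 by rewrite /q expR_lt1 mulNr oppr_lt0 mulr_gt0.
have ae0 : 0 < alpha * eta by rewrite mulr_gt0.
set l := Num.max 0 _; have l0 : 0 <= l by rewrite le_max lexx.
pose m := (Num.truncn (l / (alpha * eta))).+1.
have lae0 : 0 <= l / (alpha * eta) by rewrite divr_ge0// ltW.
have /andP[m1 m2] : m.-1%:R <= l / (alpha * eta) < m%:R by rewrite -truncn_eq.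
rewrite ler_pdivlMr// in m1; rewrite ltr_pdivrMr// in m2.
have mE : m%:R = m.-1%:R + 1 :> R by rewrite -natr1.
have Bq : B * q ^+ m <= A.
  have [->|B1] := eqVneq B 0; first by rewrite mul0r.
  have Bp : 0 < B by rewrite lt_def B1.
  have Ap : 0 < A by rewrite lt_def A1.
  have h1 : q ^+ m <= expR (- ln (B / A)).
    rewrite /q -expRM_natl ler_expR.
    have : ln (B / A) <= l by rewrite /l le_max lexx orbT.
    by move: m2; nra.
  rewrite -lnV ?posrE ?divr_gt0// lnK ?posrE ?invr_gt0 ?divr_gt0// invf_div in h1.
  apply: le_trans (ler_wpM2l B0 h1) _.
  by rewrite mulrCA mulfV// mulr1.
have bnd1 j : 0 <= Num.min A (B * q ^+ j).
  by rewrite le_min A0 mulr_ge0// exprn_ge0.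
apply: (@le_trans _ _ (eta * (m%:R * A + A * (1 - q)^-1))).
  rewrite ler_wpM2l ?(ltW e0)//.
  apply: (@le_trans _ _ (\sum_(j < m + n) Num.min A (B * q ^+ j))).
    rewrite addnC big_split_ord /= lerDl; exact: sumr_ge0.
  rewrite big_split_ord /=; apply: lerD.
    rewrite -[m in leRHS]card_ord mulr_natl -sumr_const; apply: ler_sum => j _.
    by rewrite ge_min lexx.
  apply: (@le_trans _ _ (A * \sum_(j < n) q ^+ j)).
    rewrite mulr_sumr; apply: ler_sum => j _; rewrite ge_min; apply/orP; right.
    by rewrite exprD mulrA ler_wpM2r ?exprn_ge0.
  by rewrite ler_wpM2l// geom_sum_le// q0.
have h1 := step_ratio_le ha he.
rewrite mulrDr mulrCA; have -> : A / alpha * (l + 3) = A * (l / alpha + 1 / alpha) + A * (2 / alpha).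
  by field; rewrite gt_eqF.
have ai : 1 <= 1 / alpha by rewrite ler_pdivlMr// mul1r.
apply: lerD; last by rewrite mulrCA ler_wpM2l.
rewrite [leLHS](_ : _ = A * (eta * m%:R)); last by ring.
rewrite ler_wpM2l//.
have : eta * m.-1%:R <= l / alpha by rewrite ler_pdivlMr// -mulrA mulrCA [eta * _]mulrC.
rewrite mE mulrDr mulr1 => h2; apply: lerD h2 _.
by apply: le_trans e1 (le_trans _ ai); rewrite div1r invf_le1 ?ler1n.
Qed.

End Weights.

(** * Variance of one level *)

Lemma sum_delta_le1 {R : realType} n (m : nat) :
  \sum_(l < n) ((l : nat) == m)%:R <= 1 :> R.
Proof.
have [mn|nm] := ltnP m n.
  rewrite (bigD1 (Ordinal mn))//= eqxx big1 ?addr0// => l.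
  by rewrite -val_eqE /= => /negbTE ->.
rewrite big1// => l _; rewrite (_ : (_ == _) = false)//.
by apply/negbTE; rewrite neq_ltn (leq_trans (ltn_ord l) nm).
Qed.

Section Variance.
Context {R : realType} {disp : measure_display} {T : measurableType disp}
  (P : probability T R).

(** A Schur-type bound: one weight of each pair is bounded by [eta] and the other is summed. A row
    of the covariance matrix contributes [rho] at most twice, once for each side of the diagonal. *)
Lemma var_sum n (w : nat -> R) (G : nat -> T -> R) (eta A : R) (rho : nat -> R) :
  (forall k, sqi P (G k)) -> 0 <= A -> (forall k, 0 <= w k <= eta) ->
  (forall j, 0 <= rho j) ->
  (forall k l, (k <= l)%N -> `|Ex P (fun x => G k x * G l x)| <= A * rho (l - k)%N) ->
  Ex P (fun x => (\sum_(k < n) w k * G k x) ^+ 2) <=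
  2 * (\sum_(k < n) w k) * A * (eta * \sum_(j < n) rho j).
Proof.
move=> sG A0 hw rho0 hC.
have F : (fun x => (\sum_(k < n) w k * G k x) ^+ 2) =
    (fun x => \sum_(k < n) \sum_(l < n) w k * w l * (G k x * G l x)).
  apply/funext => x; rewrite expr2 mulr_suml; apply: eq_bigr => k _.
  by rewrite mulr_sumr; apply: eq_bigr => l _; ring.
have i2 k l : P.-integrable setT (EFin \o (fun x => w k * w l * (G k x * G l x))).
  by apply: integrable_scale; exact: mul_integrable.
have i1 k := Ex_sum (n := n) (fun l _ => i2 k l).
have [_ E] := Ex_sum (n := n) (X := fun k x => \sum_(l < n) w k * w l * (G k x * G l x))
  (fun k _ => (i1 k).1).
rewrite F E; under eq_bigr => k _ do rewrite (i1 k).2.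
have eta0 : 0 <= eta by have /andP[h1 h2] := hw 0%N; exact: le_trans h2.
(* The distance between [k] and [l] is encoded by indicators summed over [j], so that a row sum
   becomes an exchange of sums. On the diagonal both indicators fire, which an upper bound can
   afford. *)
have hC' k l : (k < n)%N -> (l < n)%N -> `|Ex P (fun x => G k x * G l x)| <=
    A * \sum_(j < n) rho j * ((((l : nat) == k + j)%N)%:R + ((k == l + j)%N)%:R).
  move=> kn ln; have [kl|lk] := leqP k l.
    apply: le_trans (hC k l kl) _; rewrite ler_wpM2l//.
    have jn : (l - k < n)%N by rewrite (leq_ltn_trans _ ln)// leq_subr.
    rewrite (bigD1 (Ordinal jn))//= subnKC// eqxx mulrDr mulr1 -addrA lerDl.
    by rewrite addr_ge0 ?mulr_ge0//; apply: sumr_ge0 => j _; rewrite mulr_ge0.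
  under eq_fun do rewrite mulrC.
  apply: le_trans (hC l k (ltnW lk)) _; rewrite ler_wpM2l//.
  have jn : (k - l < n)%N by rewrite (leq_ltn_trans _ kn)// leq_subr.
  rewrite (bigD1 (Ordinal jn))//= (subnKC (ltnW lk)) eqxx mulrDr mulr1 addrAC lerDr.
  by rewrite addr_ge0 ?mulr_ge0//; apply: sumr_ge0 => j _; rewrite mulr_ge0.
have rows k : (k < n)%N -> \sum_(l < n) \sum_(j < n)
    rho j * ((((l : nat) == k + j)%N)%:R + ((k == l + j)%N)%:R) <= 2 * \sum_(j < n) rho j.
  move=> kn; rewrite exchange_big /= mulr_sumr; apply: ler_sum => j _.
  rewrite -mulr_sumr mulrC ler_wpM2r// big_split /=.
  rewrite (_ : 2 = 1 + 1); last by ring.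
  apply: lerD; first exact: sum_delta_le1.
  apply: le_trans (sum_delta_le1 n (k - j)); apply: ler_sum => l _.
  by rewrite ler_nat; case: eqP => [->|//]; rewrite addnK eqxx.
have -> : 2 * (\sum_(k < n) w k) * A * (eta * \sum_(j < n) rho j) =
    \sum_(k < n) w k * (eta * (A * (2 * \sum_(j < n) rho j))).
  by rewrite -mulr_suml; ring.
apply: ler_sum => k _; have /andP[wk0 wk1] := hw k.
apply: (@le_trans _ _ (\sum_(l < n) w k * (eta * (A * \sum_(j < n)
    rho j * ((((l : nat) == k + j)%N)%:R + (((k : nat) == l + j)%N)%:R))))); last first.
  by rewrite -!mulr_sumr ler_wpM2l// ler_wpM2l// ler_wpM2l// rows.
apply: ler_sum => l _; have /andP[wl0 wl1] := hw l.
rewrite ExZ; last exact: mul_integrable.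
rewrite -mulrA ler_wpM2l//.
apply: le_trans (ler_norm _) _; rewrite normrM (ger0_norm wl0).
by apply: ler_pM => //; exact: hC'.
Qed.

End Variance.

Section Decorrelation.
Context {R : realType} {d1 d2 d3 : measure_display} {T : measurableType d1}
  {S : measurableType d2} {N : measurableType d3} (P : probability T R)
  (nu : probability N R) (Phi : S * N -> S).
Hypothesis mPhi : measurable_fun setT Phi.

(** The form of (H1) used along the chain: convergence of the kernel iterates of [f] from every
    starting point. The two parts of [f] appear separately because the kernel is iterated on
    nonnegative functions. *)
Definition mixing (f : S -> R) (c : S -> R) (K : nat -> R) (m : R) :=
  forall k x (hp := iter k (trans nu Phi) (EFin \o (fun y => Num.max (f y) 0)) x)
    (hm := iter k (trans nu Phi) (EFin \o (fun y => Num.max (- f y) 0)) x),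
  [/\ hp \is a fin_num, hm \is a fin_num &
      `|fine hp - fine hm - m| <= c x * K k].

Variables (F : nat -> set (set T)) (Z : nat -> T -> S) (xi : nat -> T -> N).
Hypothesis HD : driven nu Phi P F Z xi.

(** By the Markov property the later value of [f] can be replaced by its kernel iterate at [Z n],
    and [m] is subtracted for free since [W] is centred. What remains is at most [K k] times the
    mean of |W c(Z_n)|, where Cauchy-Schwarz applies. *)
Lemma decorrelation n k (W : T -> R) f c K m a e :
  mixing f c K m -> measurable_fun setT f -> 0 <= K k ->
  Fmeas (F n) W -> L2le P W a -> Ex P W = 0 ->
  sqi P (f \o Z (n + k)%N) -> L2le P (c \o Z n) e ->
  `|Ex P (fun w => W w * f (Z (n + k)%N w))| <= K k * (a * e).
Proof.
move=> mix mf K0 mW hW EW sf hc; have sW := L2le_sqi hW.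
pose Psi w :=
  fine (iter k (trans nu Phi) (EFin \o (fun y => Num.max (f y) 0)) (Z n w)) -
  fine (iter k (trans nu Phi) (EFin \o (fun y => Num.max (- f y) 0)) (Z n w)).
have [iPsi' E'] := markov_real mPhi HD mW mf
  (fun x => let: And3 h _ _ := mix k x in h)
  (fun x => let: And3 _ h _ := mix k x in h) (mul_integrable sW sf).
have iPsi : P.-integrable setT (EFin \o (fun w => W w * Psi w)) by exact: iPsi'.
have -> : Ex P (fun w => W w * f (Z (n + k)%N w)) = Ex P (fun w => W w * Psi w).
  exact: E'.
have hPsi w : `|Psi w - m| <= c (Z n w) * K k by case: (mix k (Z n w)).
clear iPsi' E'; clearbody Psi.
have iW := sqi_integrable sW.
have iD : P.-integrable setT (EFin \o (fun w => W w * (Psi w - m))).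
  have := integrable_sub iPsi (integrable_scale m iW).
  by apply: eq_integrable => // w _ /=; rewrite mulrBr [m * _]mulrC.
have -> : Ex P (fun w => W w * Psi w) = Ex P (fun w => W w * (Psi w - m)).
  rewrite (_ : (fun w => W w * (Psi w - m)) = (fun w => W w * Psi w - m * W w)).
    by rewrite (ExB iPsi (integrable_scale m iW)) (ExZ m iW) EW mulr0 subr0.
  by apply/funext => w; ring.
apply: le_trans (norm_Ex_le iD) _.
have iWc : P.-integrable setT (EFin \o (fun w => `|W w * c (Z n w)|)).
  have := mul_integrable (sqi_norm sW) (sqi_norm (L2le_sqi hc)).
  by apply: eq_integrable => // w _; rewrite /= normrM.
apply: (@le_trans _ _ (Ex P (fun w => K k * `|W w * c (Z n w)|))).
  apply: Ex_le; [|exact: integrable_scale|].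
    have := integrable_norm iD; by apply: eq_integrable => // w _.
  move=> w; rewrite !normrM mulrCA ler_wpM2l// mulrC.
  apply: le_trans (hPsi w) _.
  by rewrite ler_wpM2r// ler_norm.
by rewrite ExZ// ler_wpM2l//; exact: cauchy_schwarz hW hc.
Qed.

End Decorrelation.

Section LevelGeneric.
Context {R : realType} {disp : measure_display} {T : measurableType disp}
  (P : probability T R).

Definition log_plus (x : R) : R := Num.max 0 (ln x).

(** What [var_sum] and [sum_min_geom] give for a time average over a length [D], after division by
    [D ^+ 2]. *)
Definition level_var (alpha A B D : R) : R :=
  2 * A / D * (A / alpha * (log_plus (B / A) + 3)).

Definition level_value (eta tau h : R) (g : nat -> T -> R) (w : T) : R :=
  (h - tau)^-1 * \sum_(k < ncells eta h) weight eta tau h k * g k w.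

(** Shared by the base level and the corrections. [L] stays outside [A] and [B], so that the
    logarithm is free of [f]_1 and [L = 0] needs no separate case. *)
Lemma level_bounds (g : nat -> T -> R) (L eta alpha tau h A B mu e : R) :
  0 < alpha <= 1 -> 0 < eta <= 1 / 2 -> 0 <= tau -> tau < h ->
  0 <= A -> 0 <= B -> 0 <= e -> (forall k, sqi P (g k)) ->
  (forall k l, (k <= l)%N ->
     `|Ex P (fun w => (g k w - Ex P (g k)) * (g l w - Ex P (g l)))| <=
     L ^+ 2 * (A * Num.min A (B * expR (- alpha * eta) ^+ (l - k)))) ->
  (forall k, `|Ex P (g k) - mu| <= e * expR (- alpha * eta) ^+ k) ->
  let Y := level_value eta tau h g in
  [/\ sqi P Y,
      Ex P (fun w => (Y w - Ex P Y) ^+ 2) <= L ^+ 2 * level_var alpha A B (h - tau) &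
      `|Ex P Y - mu| <= e * (4 / alpha * expR (- alpha * tau)) / (h - tau)].
Proof.
move=> ha he t0 th A0 B0 e0 sg hC hmu Y.
have /andP[eta0 eta1] := he.
have D0 : 0 < h - tau by rewrite subr_gt0.
set w := weight eta tau h; set n := ncells eta h.
have hw k : 0 <= w k <= eta by exact: weight_bounds.
have Sw : \sum_(k < n) w k = h - tau by apply: sum_weight => //; exact: ltW.
have sS : sqi P (fun x => \sum_(k < n) w k * g k x).
  by apply: (@sqi_sum _ _ _ P n (fun k x => w k * g k x)) => k _; exact: sqiZ.
have sY : sqi P Y by exact: sqiZ.
have [_ ES] := Ex_sum (n := n) (X := fun k x => w k * g k x)
  (fun k _ => integrable_scale (w k) (sqi_integrable (sg k))).
have EY : Ex P Y = (h - tau)^-1 * \sum_(k < n) w k * Ex P (g k).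
  rewrite /Y /level_value ExZ; last exact: sqi_integrable.
  congr (_ * _); rewrite ES; apply: eq_bigr => k _.
  by rewrite ExZ//; exact: sqi_integrable.
split => //.
- pose G k x := g k x - Ex P (g k).
  have sG k : sqi P (G k) by apply: sqiB => //; exact: cst_sqi.
  have YE x : Y x - Ex P Y = (h - tau)^-1 * \sum_(k < n) w k * G k x.
    rewrite EY /Y /level_value -mulrBr -sumrB; congr (_ * _).
    by apply: eq_bigr => k _; rewrite mulrBr.
  under eq_fun do rewrite YE exprMn.
  rewrite ExZ; last first.
    apply: sqr_integrable.
    by apply: (@sqi_sum _ _ _ P n (fun k x => w k * G k x)) => k _; exact: sqiZ.
  have V := @var_sum _ _ _ P n w G eta (L ^+ 2 * A)
    (fun j => Num.min A (B * expR (- alpha * eta) ^+ j)) sG.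
  apply: (@le_trans _ _ ((h - tau)^-1 ^+ 2 * (2 * (h - tau) * (L ^+ 2 * A) *
     (A / alpha * (log_plus (B / A) + 3))))).
    rewrite ler_wpM2l ?sqr_ge0//.
    apply: le_trans (V _ hw _ _) _.
    + by rewrite mulr_ge0// sqr_ge0.
    + by move=> j; rewrite le_min A0 mulr_ge0// exprn_ge0// expR_ge0.
    + by move=> k l kl; rewrite -mulrA; exact: hC.
    rewrite Sw ler_wpM2l//.
      apply: mulr_ge0; first by apply: mulr_ge0 => //; exact: ltW.
      by apply: mulr_ge0 => //; exact: sqr_ge0.
    exact: sum_min_geom.
  rewrite /level_var le_eqVlt; apply/orP; left; apply/eqP; field.
  by rewrite !gt_eqF//; case/andP: ha.
- have -> : Ex P Y - mu = (h - tau)^-1 * \sum_(k < n) w k * (Ex P (g k) - mu).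
    under [in RHS]eq_bigr do rewrite mulrBr.
    by rewrite sumrB -mulr_suml Sw EY mulrBr mulrA mulVf ?mul1r// gt_eqF.
  rewrite normrM (@ger0_norm _ (h - tau)^-1) ?invr_ge0 ?(ltW D0)// [leLHS]mulrC.
  rewrite ler_wpM2r ?invr_ge0 ?(ltW D0)//.
  apply: le_trans (ler_norm_sum _ _ _) _.
  apply: (@le_trans _ _ (e * \sum_(k < n) w k * expR (- alpha * eta) ^+ k)).
    rewrite mulr_sumr; apply: ler_sum => k _; have /andP[w0 _] := hw k.
    by rewrite normrM (ger0_norm w0) mulrCA ler_wpM2l.
  by rewrite ler_wpM2l// sum_weight_exp.
Qed.

End LevelGeneric.

(** * Lipschitz constants and schemes on the grid *)

Lemma enorm_eq0 {R : realType} {m n : nat} (A : 'M[R]_(m, n)) :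
  enorm A = 0 -> A = 0.
Proof.
move=> A0; apply/matrixP => i j; rewrite mxE; apply/eqP.
by rewrite -normr_eq0 eq_le normr_ge0 andbT -A0 enorm_coord.
Qed.

Lemma enorm0 {R : realType} {m n : nat} : enorm (0 : 'M[R]_(m, n)) = 0.
Proof.
rewrite /enorm big1 ?sqrtr0// => i _; rewrite big1// => j _.
by rewrite mxE expr0n.
Qed.

Lemma lip_bounds {R : realType} {d : nat} (f : 'cV[R]_d -> R) : lipschitzR f ->
  0 <= lip f /\ forall x y, `|f x - f y| <= lip f * enorm (x - y).
Proof.
move=> [K hK]; set E := [set l : R | exists x y, x != y /\
  l = `|f x - f y| / enorm (x - y)].
have pos (x y : 'cV[R]_d) : x != y -> 0 < enorm (x - y).
  move=> xy; rewrite lt_def enorm_ge0 andbT; apply: contra xy => /eqP /enorm_eq0.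
  by move=> /eqP; rewrite subr_eq0.
have ub : has_ubound E.
  exists K => _ [x [y [xy ->]]]; rewrite ler_pdivrMr ?pos//.
have le x y : x != y -> `|f x - f y| / enorm (x - y) <= lip f.
  by move=> xy; apply: ub_le_sup => //; exists x, y.
split.
  have [[l [x [y [xy _]]]]|E0] := pselect (E !=set0).
    by apply: le_trans (le x y xy); rewrite divr_ge0// enorm_ge0.
  (* No two distinct points, as when d = 0: the supremum of the empty set is 0. *)
  rewrite /lip sup_out// => -[]; by move/E0.
move=> x y; have [->|xy] := eqVneq x y.
  by rewrite !subrr normr0 enorm0 mulr0.
by rewrite -ler_pdivrMr ?pos// le.
Qed.

(** In the extended reals [+oo - +oo] is [-oo], so any infinite term makes the distance infinite.
    This is how (H1) yields the integrability of [f]. *)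
Lemma ereal_dist_fin {R : realType} (p q I : \bar R) (r : R) :
  (0 <= p)%E -> (0 <= q)%E -> (`|(p - q) - I| <= r%:E)%E ->
  [/\ p \is a fin_num, q \is a fin_num, I \is a fin_num &
      `|fine p - fine q - fine I| <= r].
Proof.
case: p => [p| |]; case: q => [q| |]; case: I => [I| |] //=;
  rewrite ?leye_eq //.
Qed.

Section EulerGrid.
Context {R : realType} {T : Type} {d : nat}.
Variables (b : 'cV[R]_d -> 'cV[R]_d) (sigma : 'cV[R]_d -> 'M[R]_d)
  (x : 'cV[R]_d) (B : R -> T -> 'cV[R]_d).

Lemma truncn_natM (gamma : R) k : 0 < gamma -> Num.truncn (gamma * k%:R / gamma) = k.
Proof.
move=> g0; rewrite mulrAC mulfV ?gt_eqF// mul1r; apply: truncn_def.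
by rewrite lexx ltr_nat ltnSn.
Qed.

Lemma euler_grid gamma k w : 0 < gamma ->
  euler b sigma gamma x B (gamma * k%:R) w = euler_chain b sigma gamma x B k w.
Proof.
move=> g0; rewrite /euler /tfloor truncn_natM// !subrr scale0r.
by rewrite mulmx0 !addr0.
Qed.

Lemma euler_tfloor gamma s w : 0 < gamma ->
  euler b sigma gamma x B (tfloor gamma s) w =
  euler_chain b sigma gamma x B (Num.truncn (s / gamma)) w.
Proof. by move=> g0; rewrite /tfloor euler_grid. Qed.

Lemma euler_tfloor_half gamma s w : 0 < gamma ->
  euler b sigma (gamma / 2) x B (tfloor gamma s) w =
  euler_chain b sigma (gamma / 2) x B (Num.truncn (s / gamma)).*2 w.
Proof.
move=> g0; rewrite /tfloor -euler_grid ?divr_gt0//; congr (euler _ _ _ _ _ _ _).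
by rewrite -muln2 natrM; field.
Qed.

End EulerGrid.

(** * Change of the driving Brownian motion *)

Section Transfer.
Context {R : realType} {disp : measure_display} {T : measurableType disp}
  {d : nat} (P : probability T R).
Variables (b : 'cV[R]_d -> 'cV[R]_d) (sigma : 'cV[R]_d -> 'M[R]_d).
Hypotheses (lb : elipschitz b) (ls : elipschitz sigma).
Implicit Types B : R -> T -> 'cV[R]_d.

Lemma chain_measurable B gamma x k : brownian P B -> 0 < gamma ->
  measurable_fun setT (euler_chain b sigma gamma x B k : T -> Borel R d).
Proof.
move=> HB g0; apply: (Fmeas_measurable (F := natural_filtration B (gamma * k%:R))).
  by apply: (nf_sub HB); rewrite mulr_ge0// ltW.
exact: (euler_chain_Fmeas HB lb ls).
Qed.

(** By [markov_start] the second moments for [B] and [B'] are the same kernel iterate at [x], since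
    both chains are driven by the Gaussian step law [nu]. *)
Lemma L2le_transfer B B' gamma x k (phi : Borel R d -> R) e : brownian P B ->
  brownian P B' -> 0 < gamma -> measurable_fun setT phi ->
  L2le P (fun w => phi (euler_chain b sigma gamma x B k w)) e ->
  L2le P (fun w => phi (euler_chain b sigma gamma x B' k w)) e.
Proof.
move=> HB HB' g0 mphi [_ e0 h].
have [nu gnu] := incr_gaussian HB g0.
have hn : nonneg_meas (fun y => (phi y ^+ 2)%:E).
  split; last by move=> y; rewrite lee_fin sqr_ge0.
  by apply/measurable_EFinP; exact: measurable_funX.
have mst := euler_step_measurable lb ls gamma.
have E1 := markov_start mst (euler_chain_driven HB lb ls x g0 gnu) k (fun=> erefl) hn.
have E2 := markov_start mst (euler_chain_driven HB' lb ls x g0 gnu) k (fun=> erefl) hn.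
split => //.
  exact: (measurableT_comp mphi (chain_measurable x k HB' g0)).
by rewrite E2 -E1.
Qed.

(** (H2) compares two schemes along one path, hence speaks of their joint law; the chain of
    [pair_step] carries it over. *)
Lemma L2le_transfer_pair B B' gamma x k (phi : Borel R d * Borel R d -> R) e :
  brownian P B -> brownian P B' -> 0 < gamma -> measurable_fun setT phi ->
  L2le P (fun w => phi (euler_chain b sigma gamma x B k w,
                        euler_chain b sigma (gamma / 2) x B k.*2 w)) e ->
  L2le P (fun w => phi (euler_chain b sigma gamma x B' k w,
                        euler_chain b sigma (gamma / 2) x B' k.*2 w)) e.
Proof.
move=> HB HB' g0 mphi [_ e0 h]; have h0 : 0 < gamma / 2 by rewrite divr_gt0.
have [nu gnu] := incr_gaussian HB h0.
have hn : nonneg_meas (fun y => (phi y ^+ 2)%:E).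
  split; last by move=> y; rewrite lee_fin sqr_ge0.
  by apply/measurable_EFinP; exact: measurable_funX.
have mst := pair_step_measurable lb ls gamma.
have E1 := markov_start mst (euler_pair_driven HB lb ls x g0 gnu) k
  (fun=> erefl (x : Borel R d, x : Borel R d)) hn.
have E2 := markov_start mst (euler_pair_driven HB' lb ls x g0 gnu) k
  (fun=> erefl (x : Borel R d, x : Borel R d)) hn.
split => //.
  exact: (measurableT_comp mphi (measurable_fun_pair
    (chain_measurable x k HB' g0) (chain_measurable x k.*2 HB' h0))).
by rewrite E2 -E1.
Qed.

End Transfer.

(** * The multilevel estimator *)

Section Levels.
Context {R : realType} {disp : measure_display} {Omega : measurableType disp}
  {d : nat} (P : probability Omega R) (B : R -> Omega -> 'cV[R]_d)
  (b : 'cV[R]_d -> 'cV[R]_d) (sigma : 'cV[R]_d -> 'M[R]_d)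
  (pi : probability (Borel R d) R) (pig : R -> probability (Borel R d) R)
  (x0 : 'cV[R]_d) (eta0 : R) (f : 'cV[R]_d -> R) (c1 : 'cV[R]_d -> R)
  (alpha a delta c2 c3 c4 : R).
Hypotheses (ha : 0 < alpha <= 1) (he0 : 0 < eta0 <= 1 / 2).
Hypothesis Hset : mlmc_setting P B b sigma eta0 pi pig.
Hypothesis Hf : lipschitzR f.
Hypothesis HH1 : H1 P B b sigma pig f eta0 alpha c1.
Hypothesis HH2 : H2 P B b sigma x0 eta0 a c2.
Hypothesis HH4 : H4 P B b sigma x0 eta0 c1 c4.

Let L := lip f.
Let HB : brownian P B. Proof. by case: Hset. Qed.
Let lb : elipschitz b. Proof. by case: Hset. Qed.
Let ls : elipschitz sigma. Proof. by case: Hset. Qed.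
Let L0 : 0 <= L. Proof. exact: (lip_bounds Hf).1. Qed.
Let fL x y : `|f x - f y| <= L * enorm (x - y). Proof. exact: (lip_bounds Hf).2. Qed.
Let mf : measurable_fun setT (f : Borel R d -> R).
Proof. exact: lipschitzR_measurable. Qed.
Let c40 : 0 <= c4. Proof. by case: HH4. Qed.
Let mc1 : measurable_fun setT (c1 : Borel R d -> R). Proof. by case: HH4. Qed.

Definition pimean gamma : R := fine (\int[pig gamma]_y (f y)%:E)%E.

Let q gamma := expR (- alpha * gamma).

(** (H1) is applied at every starting point. Once expectations are rewritten as kernel iterates, the
    bound no longer mentions [B] and serves any scheme with the same step law. *)
Lemma pig_mixing gamma nu : 0 < gamma <= eta0 -> gaussian_boxes nu gamma ->
  (\int[pig gamma]_y (f y)%:E = (pimean gamma)%:E)%E /\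
  mixing nu (euler_step b sigma gamma) f (fun x => L * c1 x)
    (fun k => q gamma ^+ k) (pimean gamma).
Proof.
move=> hg gnu; have /andP[g0 g1] := hg.
suff key k x : let hp := iter k (trans nu (euler_step b sigma gamma))
      (EFin \o (fun y => Num.max (f y) 0)) x in
    let hm := iter k (trans nu (euler_step b sigma gamma))
      (EFin \o (fun y => Num.max (- f y) 0)) x in
    [/\ hp \is a fin_num, hm \is a fin_num,
     (\int[pig gamma]_y (f y)%:E)%E \is a fin_num
     & `|fine hp - fine hm - pimean gamma| <= L * c1 x * q gamma ^+ k].
  split; first by have [_ _ h _] := key 0%N x0; rewrite fineK.
  by move=> k x hp hm; have [h1 h2 _ h3] := key k x.
move=> hp hm.
have npos (g : Borel R d -> R) : measurable_fun setT g ->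
    nonneg_meas (EFin \o (fun y => Num.max (g y) 0)).
  move=> mg; split; last by move=> y; rewrite /= lee_fin le_max lexx orbT.
  by apply/measurable_EFinP; exact: measurable_maxr.
have np := npos f mf; have nm := npos (\- f) (measurable_funN mf).
have mst := euler_step_measurable lb ls gamma.
have HD := euler_chain_driven HB lb ls x g0 gnu.
have Ep := markov_start mst HD k (fun=> erefl) np.
have Em := markov_start mst HD k (fun=> erefl) nm.
have tk : 0 <= gamma * k%:R by rewrite mulr_ge0// ltW.
have := HH1 x hg tk.
rewrite unlock.
(* The expectation is the difference of the integrals of the two parts of the integrand, which are
   [hp] and [hm]. *)
rewrite integralE.
rewrite (_ : (\int[P]_w ((fun w => _)^\+ w))%E = hp); last first.
  apply: etrans Ep; apply: eq_integral => w _; rewrite funeposE /= EFin_max.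
  by rewrite euler_tfloor// truncn_natM.
rewrite (_ : (\int[P]_w ((fun w => _)^\- w))%E = hm); last first.
  apply: etrans Em; apply: eq_integral => w _; rewrite funenegE /= EFin_max EFinN.
  by rewrite euler_tfloor// truncn_natM.
have -> : c1 x * lip f * expR (- alpha * tfloor gamma (gamma * k%:R)) =
    L * c1 x * q gamma ^+ k.
  rewrite /tfloor truncn_natM// /q -expRM_natl [c1 x * _]mulrC; congr (_ * expR _).
  by ring.
apply: ereal_dist_fin.
- by have [_ h] := iter_trans_nonneg_meas nu mst k np; exact: h.
- by have [_ h] := iter_trans_nonneg_meas nu mst k nm; exact: h.
Qed.

(** (H4) bounds the sum of the two norms, hence each of them. *)
Lemma chain_L2 B' gamma k : brownian P B' -> 0 < gamma <= eta0 ->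
  L2le P (fun w => enorm (euler_chain b sigma gamma x0 B' k w - x0)) c4 /\
  L2le P (fun w => c1 (euler_chain b sigma gamma x0 B' k w)) c4.
Proof.
move=> HB' hg; have /andP[g0 g1] := hg.
have me : measurable_fun setT ((fun y => enorm (y - x0)) : Borel R d -> R).
  by apply: measurable_enorm; apply: measurable_BorelB.
have mc := chain_measurable lb ls x0 k HB g0.
have [_ _ h4] := HH4.
have tk : 0 <= gamma * k%:R by rewrite mulr_ge0// ltW.
have le4 : (L2norm P (fun w => enorm (euler_chain b sigma gamma x0 B k w - x0)) +
           L2norm P (fun w => c1 (euler_chain b sigma gamma x0 B k w)) <= c4%:E)%E.
  apply: le_trans (h4 _ hg); apply: ereal_sup_ubound; exists (gamma * k%:R) => //.
  by congr (L2norm P _ + L2norm P _)%E; apply/funext => w; rewrite euler_grid.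
split.
- apply: (@L2le_transfer _ _ _ _ _ _ _ lb ls B B' _ _ _ (fun y => enorm (y - x0))) => //.
  apply: L2norm_le; first exact: (measurableT_comp me).
  by apply: le_trans le4; rewrite leeDl// Lnorm_ge0.
- apply: (@L2le_transfer _ _ _ _ _ _ _ lb ls B B' _ _ _ c1) => //.
  apply: L2norm_le; first exact: (measurableT_comp mc1).
  by apply: le_trans le4; rewrite leeDr// Lnorm_ge0.
Qed.

Lemma pair_L2 B' gamma k : brownian P B' -> 0 < gamma <= eta0 ->
  L2le P (fun w => enorm (euler_chain b sigma gamma x0 B' k w -
     euler_chain b sigma (gamma / 2) x0 B' k.*2 w)) (c2 * gamma `^ (a / 2)).
Proof.
move=> HB' hg; have /andP[g0 g1] := hg; have h0 : 0 < gamma / 2 by rewrite divr_gt0.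
have me : measurable_fun setT
    ((fun y => enorm (y.1 - y.2 : 'cV[R]_d)) : Borel R d * Borel R d -> R).
  by apply: measurable_enorm; apply: measurable_BorelB.
have [_ h2] := HH2.
have tk : 0 <= gamma * k%:R by rewrite mulr_ge0// ltW.
apply: (@L2le_transfer_pair _ _ _ _ _ _ _ lb ls B B' _ _ _
  (fun y => enorm (y.1 - y.2 : 'cV[R]_d))) => //=.
apply: L2norm_le.
  apply: measurable_enorm; apply: measurable_BorelB.
    exact: (chain_measurable lb ls x0 k HB g0).
  exact: (chain_measurable lb ls x0 k.*2 HB h0).
apply: le_trans (h2 _ hg); apply: ereal_sup_ubound; exists (gamma * k%:R) => //.
congr (L2norm P _); apply/funext => w.
by rewrite euler_tfloor// euler_tfloor_half// truncn_natM.
Qed.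

Lemma fchain_L2 B' gamma k : brownian P B' -> 0 < gamma <= eta0 ->
  L2le P (fun w => f (euler_chain b sigma gamma x0 B' k w) - f x0) (L * c4).
Proof.
move=> HB' hg; have /andP[g0 g1] := hg.
apply: L2le_dominated (chain_L2 k HB' hg).1 => //.
  apply: measurable_funB => //; apply: (measurableT_comp mf).
  exact: (chain_measurable lb ls x0 k HB' g0).
by move=> w; rewrite [`|enorm _|]ger0_norm ?enorm_ge0.
Qed.

Lemma fchain_sqi B' gamma k : brownian P B' -> 0 < gamma <= eta0 ->
  sqi P (fun w => f (euler_chain b sigma gamma x0 B' k w)).
Proof.
move=> HB' hg; have := sqiD (L2le_sqi (fchain_L2 k HB' hg)) (cst_sqi P (f x0)).
by under eq_fun do rewrite /= subrK.
Qed.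

Lemma fchain_mean B' gamma k : brownian P B' -> 0 < gamma <= eta0 ->
  `|Ex P (fun w => f (euler_chain b sigma gamma x0 B' k w)) - pimean gamma| <=
  L * `|c1 x0| * q gamma ^+ k.
Proof.
move=> HB' hg; have /andP[g0 g1] := hg.
have [nu gnu] := incr_gaussian HB g0.
have [_ mix] := pig_mixing hg gnu.
have HD := euler_chain_driven HB' lb ls x0 g0 gnu.
have mst := euler_step_measurable lb ls gamma.
have [_ E] := @markov_real _ _ _ _ _ nu _ mst _ _ P _ _ _ HD 0%N k (cst 1) f
  (measurable_cst _) mf (fun x => let: And3 h _ _ := mix k x in h)
  (fun x => let: And3 _ h _ := mix k x in h)
  (mul_integrable (cst_sqi P 1) (fchain_sqi k HB' hg)).
have -> : Ex P (fun w => f (euler_chain b sigma gamma x0 B' k w)) =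
  Ex P (fun w => cst 1 w * f (euler_chain b sigma gamma x0 B' (0 + k) w)).
  by congr Ex; apply/funext => w; rewrite mul1r.
rewrite {1}/Ex E -/(Ex P _) /=.
under eq_fun do rewrite mul1r.
rewrite Ex_cst; have [_ _ h] := mix k x0; apply: le_trans h _.
by rewrite ler_wpM2r ?exprn_ge0 ?expR_ge0// ler_wpM2l// ler_norm.
Qed.

(* [W] is a function of the past, so the later value of [f] along the chain only
   contributes through its conditional mean, which has almost reached [pimean]. *)
Lemma fchain_decorrelation B' gamma n k W e : brownian P B' ->
  0 < gamma <= eta0 -> Fmeas (natural_filtration B' (gamma * n%:R)) W ->
  L2le P W e -> Ex P W = 0 ->
  `|Ex P (fun w => W w * f (euler_chain b sigma gamma x0 B' (n + k) w))| <=
  q gamma ^+ k * (e * (L * c4)).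
Proof.
move=> HB' hg mW hW EW; have /andP[g0 g1] := hg.
have [nu gnu] := incr_gaussian HB g0.
have [_ mix] := pig_mixing hg gnu.
have HD := euler_chain_driven HB' lb ls x0 g0 gnu.
have mst := euler_step_measurable lb ls gamma.
apply: (decorrelation mst HD mix mf _ mW hW EW).
- by rewrite exprn_ge0// expR_ge0.
- exact: fchain_sqi.
- have := L2le_scale L (chain_L2 n HB' hg).2.
  by rewrite (ger0_norm L0).
Qed.


Lemma min_bound (x u A C : R) : 0 <= u -> x <= u * A -> x <= u * C ->
  x <= u * Num.min A C.
Proof. by move=> u0 h1 h2; rewrite minEle; case: ifP. Qed.

Lemma cov_shift (G Y : Omega -> R) c : sqi P G -> sqi P Y -> Ex P G = 0 ->
  Ex P (fun w => G w * (Y w - c)) = Ex P (fun w => G w * Y w).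
Proof.
move=> sG sY EG; have iG := sqi_integrable sG; have iGY := mul_integrable sG sY.
have -> : (fun w => G w * (Y w - c)) = (fun w => G w * Y w - c * G w).
  by apply/funext => w; ring.
by rewrite (ExB iGY (integrable_scale c iG)) (ExZ c iG) EG mulr0 subr0.
Qed.

(** Both covariance bounds have the scale (L c4)^2, so [A] and [B] are both [c4] and the logarithm
    vanishes. *)
Lemma base_level B' gamma tau h : brownian P B' -> 0 < gamma <= eta0 ->
  0 <= tau -> tau < h ->
  let Y := level_value gamma tau h
    (fun k w => f (euler_chain b sigma gamma x0 B' k w)) in
  [/\ sqi P Y,
      Ex P (fun w => (Y w - Ex P Y) ^+ 2) <=
        L ^+ 2 * level_var alpha c4 c4 (h - tau) &
      `|Ex P Y - pimean gamma| <=
        L * `|c1 x0| * (4 / alpha * expR (- alpha * tau)) / (h - tau)].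
Proof.
move=> HB' hg t0 th; have /andP[g0 g1] := hg.
have hg2 : 0 < gamma <= 1 / 2 by rewrite g0 (le_trans g1)//; case/andP: he0.
apply: level_bounds => //.
- by rewrite mulr_ge0.
- by move=> k; exact: fchain_sqi.
- move=> k l kl.
  pose Y (j : nat) w := f (euler_chain b sigma gamma x0 B' j w).
  pose G w := Y k w - Ex P (Y k).
  rewrite -[X in `|X|]/(Ex P (fun w => G w * (Y l w - Ex P (Y l)))).
  have hc j := L2le_center_at (fchain_L2 j HB' hg).
  have EG := Ex_center (fchain_sqi k HB' hg).
  have mG : Fmeas (natural_filtration B' (gamma * k%:R)) G.
    apply: measurable_funB => //; apply: (measurableT_comp mf).
    exact: (euler_chain_Fmeas HB' lb ls).
  rewrite mulrA; apply: min_bound; first by rewrite mulr_ge0 ?sqr_ge0.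
    have := cauchy_schwarz_norm (hc k) (hc l); congr (_ <= _); ring.
  rewrite (cov_shift _ (L2le_sqi (hc k)) (fchain_sqi l HB' hg) EG).
  have := fchain_decorrelation (l - k) HB' hg mG (hc k) EG.
  rewrite subnKC//; congr (_ <= _); ring.
- by move=> k; exact: fchain_mean.
Qed.

(** [A] comes from (H2). (H1) speaks of one scheme, so the fine and the coarse value at the later
    time are decorrelated from the past separately; this gives [B = 2 * c4]. *)
Lemma correction_level B' gamma tau h : brownian P B' -> 0 < gamma <= eta0 ->
  0 <= tau -> tau < h ->
  let Y := level_value gamma tau h
    (fun k w => f (euler_chain b sigma (gamma / 2) x0 B' k.*2 w) -
                f (euler_chain b sigma gamma x0 B' k w)) in
  [/\ sqi P Y,
      Ex P (fun w => (Y w - Ex P Y) ^+ 2) <=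
        L ^+ 2 * level_var alpha (c2 * gamma `^ (a / 2)) (2 * c4) (h - tau) &
      `|Ex P Y - (pimean (gamma / 2) - pimean gamma)| <=
        2 * (L * `|c1 x0|) * (4 / alpha * expR (- alpha * tau)) / (h - tau)].
Proof.
move=> HB' hg t0 th; have /andP[g0 g1] := hg.
have hg2 : 0 < gamma <= 1 / 2 by rewrite g0 (le_trans g1)//; case/andP: he0.
have hgh : 0 < gamma / 2 <= eta0 by rewrite divr_gt0//=; lra.
have qh k : q (gamma / 2) ^+ k.*2 = q gamma ^+ k.
  rewrite /q -muln2 mulnC exprM -expRM_natl; by congr (expR _ ^+ _); field.
have g2 k : gamma / 2 * k.*2%:R = gamma * k%:R.
  by rewrite -muln2 natrM; field.
set A := c2 * _; have A0 : 0 <= A by rewrite mulr_ge0 ?powR_ge0//; case: HH2 => /ltW.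
have sf j := fchain_sqi j HB' hgh; have sc j := fchain_sqi j HB' hg.
have sg k : sqi P (fun w => f (euler_chain b sigma (gamma / 2) x0 B' k.*2 w) -
                f (euler_chain b sigma gamma x0 B' k w)).
  exact: sqiB (sf _) (sc _).
have hgk k : L2le P (fun w => f (euler_chain b sigma (gamma / 2) x0 B' k.*2 w) -
                f (euler_chain b sigma gamma x0 B' k w)) (L * A).
  apply: L2le_dominated (pair_L2 k HB' hg) => //; first exact: sqi_measurable.
  by move=> w; rewrite [`|enorm _|]ger0_norm ?enorm_ge0// distrC.
apply: level_bounds => //.
- by rewrite mulr_ge0.
- by rewrite mulr_ge0// mulr_ge0.
- move=> k l kl.
  pose Y (j : nat) w := f (euler_chain b sigma (gamma / 2) x0 B' j.*2 w) -
    f (euler_chain b sigma gamma x0 B' j w).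
  pose G w := Y k w - Ex P (Y k).
  rewrite -[X in `|X|]/(Ex P (fun w => G w * (Y l w - Ex P (Y l)))).
  have hG : L2le P G (L * A) by exact: (L2le_center (hgk k)).
  have EG : Ex P G = 0 by exact: Ex_center (sg k).
  (* [G] involves both schemes, yet only through the path up to time gamma k, which is also 2k half
     steps; so it is an admissible past for either chain. *)
  have mGc : Fmeas (natural_filtration B' (gamma * k%:R)) G.
    apply: measurable_funB => //; apply: measurable_funB; apply: (measurableT_comp mf).
      by rewrite -g2; case/andP: hgh => h0 _; exact: (euler_chain_Fmeas HB' lb ls).
    exact: (euler_chain_Fmeas HB' lb ls).
  have mGf : Fmeas (natural_filtration B' (gamma / 2 * k.*2%:R)) G by rewrite g2.
  have sG := L2le_sqi hG.
  rewrite mulrA; apply: min_bound; first by rewrite mulr_ge0 ?sqr_ge0.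
    have := cauchy_schwarz_norm hG (L2le_center (hgk l)); congr (_ <= _); ring.
  rewrite (cov_shift _ sG (sg l) EG).
  have d1 := fchain_decorrelation (l - k) HB' hg mGc hG EG.
  have d2 := fchain_decorrelation (l - k).*2 HB' hgh mGf hG EG.
  rewrite qh -doubleD !subnKC// in d1 d2.
  have -> : (fun w => G w * (f (euler_chain b sigma (gamma / 2) x0 B' l.*2 w) -
      f (euler_chain b sigma gamma x0 B' l w))) =
    (fun w => G w * f (euler_chain b sigma (gamma / 2) x0 B' l.*2 w) -
      G w * f (euler_chain b sigma gamma x0 B' l w)).
    by apply/funext => w; ring.
  rewrite (ExB (mul_integrable sG (sf _)) (mul_integrable sG (sc _))).
  apply: le_trans (ler_normB _ _) _; apply: le_trans (lerD d2 d1) _.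
  by rewrite le_eqVlt; apply/orP; left; apply/eqP; ring.
- move=> k; rewrite (ExB (sqi_integrable (sf _)) (sqi_integrable (sc _))).
  have m1 := fchain_mean k HB' hg; have m2 := fchain_mean k.*2 HB' hgh.
  rewrite qh in m2.
  set u := Ex P _ in m2 *; set v := Ex P _ in m1 *.
  have -> : u - v - (pimean (gamma / 2) - pimean gamma) =
    (u - pimean (gamma / 2)) - (v - pimean gamma) by ring.
  apply: le_trans (ler_normB _ _) _; apply: le_trans (lerD m2 m1) _.
  by rewrite le_eqVlt; apply/orP; left; apply/eqP; rewrite /q; ring.
Qed.

Lemma fchain_path_Fmeas B' gamma k : brownian P B' -> 0 < gamma ->
  Fmeas (path_sigma_algebra B') (fun w => f (euler_chain b sigma gamma x0 B' k w)).
Proof.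
move=> HB' g0; rewrite /Fmeas; apply: (measurableT_comp mf).
have := @euler_chain_Fmeas _ _ _ _ _ _ HB' _ _ lb ls _ x0 k g0; apply: Fmeas_mono.
by apply: sub_sigma_algebra2 => _ [s [A [s0 _ mA ->]]]; exists s, A.
Qed.

Lemma level_value_Fmeas (F : set (set Omega)) eta tau h (g : nat -> Omega -> R) :
  (forall k, Fmeas F (g k)) -> Fmeas F (level_value eta tau h g).
Proof.
move=> mg; rewrite /Fmeas /level_value; apply: measurable_funM => //.
by apply: measurable_sum => k; apply: measurable_funM => //; exact: mg.
Qed.

(** * Mean square error of the estimator *)

Section Estimator.
Variables (gamma0 tau : R) (Th : nat -> R) (N : nat)
  (Bs : nat -> R -> Omega -> 'cV[R]_d).
Hypotheses (hg0 : 0 < gamma0 <= eta0) (t0 : 0 <= tau)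
  (hTh : forall r, (r <= N)%N -> tau < Th r)
  (HBs : independent_brownians P N Bs).
Let gam := mlstep gamma0.

Let gam0 r : 0 < gam r. Proof. by rewrite divr_gt0// ?exprn_gt0//; case/andP: hg0. Qed.

Let gamS r : gam r.+1 = gam r / 2.
Proof. by rewrite /gam /mlstep exprSr invfM mulrA. Qed.

Let gam_le r : 0 < gam r <= eta0.
Proof.
rewrite gam0 /=; case/andP: hg0 => h1 h2; apply: le_trans h2.
by rewrite /gam /mlstep ler_pdivrMr ?exprn_gt0// ler_peMr ?(ltW h1)// exprn_ege1// ler1n.
Qed.

Definition level (r : nat) : Omega -> R :=
  if r is s.+1 then level_value (gam s) tau (Th r)
    (fun k w => f (euler_chain b sigma (gam s / 2) x0 (Bs r) k.*2 w) -
                f (euler_chain b sigma (gam s) x0 (Bs r) k w))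
  else level_value (gam 0%N) tau (Th 0%N)
    (fun k w => f (euler_chain b sigma (gam 0%N) x0 (Bs 0%N) k w)).

Lemma mlmc_levels w :
  mlmc b sigma Bs N gam tau Th x0 f w = \sum_(r < N.+1) level r w.
Proof.
rewrite /mlmc big_ord_recl; congr (_ + _).
  rewrite /= /level_value; congr (_ * _).
  rewrite -(@step_Rintegral _ _ _ _ (fun k =>
    f (euler_chain b sigma (gam 0%N) x0 (Bs 0%N) k w)) (gam0 0) t0).
  by apply: eq_Rintegral => s _; rewrite euler_tfloor.
rewrite big_add1 /= big_mkord; apply: eq_bigr => r _.
rewrite /= /level_value /bump /= add1n; congr (_ * _).
rewrite -(@step_Rintegral _ _ _ _ (fun k =>
  f (euler_chain b sigma (gam r / 2) x0 (Bs r.+1) k.*2 w) -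
  f (euler_chain b sigma (gam r) x0 (Bs r.+1) k w)) (gam0 r) t0).
by apply: eq_Rintegral => s _; rewrite gamS euler_tfloor_half// euler_tfloor.
Qed.

(** [mse_var] and [mse_bias] are in units of [f]_1^2 and [f]_1. *)
Definition mse_var : R := \sum_(r < N.+1)
  (if r : nat is s.+1 then level_var alpha (c2 * gam s `^ (a / 2)) (2 * c4) (Th r - tau)
   else level_var alpha c4 c4 (Th 0%N - tau)).

Definition mse_bias : R := c3 * gam N `^ delta +
  \sum_(r < N.+1) 2 * `|c1 x0| * (4 / alpha * expR (- alpha * tau)) / (Th r - tau).

(** The value that the mean of level [r] approaches; these telescope to the invariant mean of the
    finest scheme. *)
Let dpi (r : nat) : R :=
  if r is s.+1 then pimean (gam s / 2) - pimean (gam s) else pimean (gam 0%N).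

Lemma level_spec r : (r <= N)%N ->
  [/\ sqi P (level r),
      Ex P (fun w => (level r w - Ex P (level r)) ^+ 2) <=
        L ^+ 2 * (if r is s.+1
          then level_var alpha (c2 * gam s `^ (a / 2)) (2 * c4) (Th r - tau)
          else level_var alpha c4 c4 (Th 0%N - tau)),
      `|Ex P (level r) - dpi r| <=
        L * (2 * `|c1 x0| * (4 / alpha * expR (- alpha * tau)) / (Th r - tau)) &
      Fmeas (path_sigma_algebra (Bs r)) (level r)].
Proof.
case: HBs => HB' _; have /andP[a0 _] := ha.
case: r => [|r] rN.
  have [h1 h2 h3] := base_level (HB' _ rN) (gam_le 0) t0 (hTh rN).
  split => //.
    (* The base level has half of this transient; the factor 2 makes the bound uniform in [r]. *)
    apply: le_trans h3 _; rewrite !mulrA ler_wpM2r ?invr_ge0 ?subr_ge0 ?(ltW (hTh rN))//.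
    rewrite ler_wpM2r ?expR_ge0// ler_wpM2r ?invr_ge0 ?(ltW a0)// ler_wpM2r//.
    by rewrite ler_wpM2r// ler_peMr// ler1n.
  by apply: level_value_Fmeas => k; apply: fchain_path_Fmeas => //; exact: HB'.
have [h1 h2 h3] := correction_level (HB' _ rN) (gam_le r) t0 (hTh rN).
split => //.
  by apply: le_trans h3 _; rewrite le_eqVlt; apply/orP; left; apply/eqP; ring.
apply: level_value_Fmeas => k; apply: measurable_funB.
  by apply: fchain_path_Fmeas; [exact: HB'|rewrite -gamS].
by apply: fchain_path_Fmeas; [exact: HB'|].
Qed.

(** Joint independence is used with the whole space at the other levels. *)
Lemma levels_indep r s A A' : (r <= N)%N -> (s <= N)%N -> r != s ->
  path_sigma_algebra (Bs r) A -> path_sigma_algebra (Bs s) A' ->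
  P (A `&` A') = (P A * P A')%E.
Proof.
move=> rN sN rs mA mA'; case: HBs => _ ind.
pose E k := if k == r then A else if k == s then A' else setT.
have hE k : (k <= N)%N -> path_sigma_algebra (Bs k) (E k).
  move=> _; rewrite /E; case: eqP => [->//|_]; case: eqP => [->//|_].
  exact: (@measurableT _ (g_sigma_algebraType _)).
have := ind E hE.
have -> : \bigcap_(k in [set k | (k <= N)%N]) E k = A `&` A'.
  rewrite predeqE => w; split.
    move=> h; split; first by have := h r rN; rewrite /E eqxx.
    by have := h s sN; rewrite /E eq_sym (negbTE rs) eqxx.
  by move=> [wA wA'] k _; rewrite /E; case: eqP => // _; case: eqP.
move=> ->.
rewrite (bigD1 (Ordinal (rN : (r < N.+1)%N)))//= /E eqxx.
have sr : Ordinal (sN : (s < N.+1)%N) != Ordinal (rN : (r < N.+1)%N).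
  by rewrite -val_eqE /= eq_sym.
rewrite (bigD1 (Ordinal (sN : (s < N.+1)%N)))//= eq_sym (negbTE rs) eqxx.
rewrite big1 ?mule1// => k /andP[]; rewrite -!val_eqE /= => /negbTE -> /negbTE ->.
exact: probability_setT.
Qed.

Hypothesis HH3 : H3 pi pig f eta0 a delta c3.

(** The error is a sum of centred, pairwise independent levels plus the constant [beta], so its
    second moment is the sum of the variances plus [beta ^+ 2]. *)
Lemma mse_bound :
  (Lnorm P 2%:E (fun w => (mlmc b sigma Bs N gam tau Th x0 f w)%:E
     - \int[pi]_y (f y)%:E)%E
   <= (L * Num.sqrt (mse_var + mse_bias ^+ 2))%:E)%E.
Proof.
have [c30 _ _ h3] := HH3.
have [nu gnu] := incr_gaussian HB (gam0 N).
have [EN _] := pig_mixing (gam_le N) gnu.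
(* As an inequality in the extended reals, (H3) forces pi(f) to be finite. *)
have [_ _ pifin pib] : [/\ (\int[pi]_y (f y)%:E)%E \is a fin_num,
   (0%E : \bar R) \is a fin_num, (\int[pi]_y (f y)%:E)%E \is a fin_num &
   `|fine (\int[pi]_y (f y)%:E)%E - pimean (gam N)| <= c3 * L * gam N `^ delta].
  have := h3 _ (gam_le N); rewrite EN.
  by case: (\int[pi]_y _)%E => [p| |] //=; rewrite ?leye_eq// lee_fin.
set mu := fine (\int[pi]_y (f y)%:E)%E in pib.
pose Yc r w := level r w - Ex P (level r).
have sYc r : (r <= N)%N -> sqi P (Yc r).
  by move=> rN; have [h _ _ _] := level_spec rN; apply: sqiB => //; exact: cst_sqi.
have EYc r : (r <= N)%N -> Ex P (Yc r) = 0.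
  by move=> rN; have [h _ _ _] := level_spec rN; exact: Ex_center.
pose beta := \sum_(r < N.+1) Ex P (level r) - mu.
have YE w : mlmc b sigma Bs N gam tau Th x0 f w - mu =
    \sum_(r < N.+1) Yc r w + beta.
  by rewrite mlmc_levels /Yc sumrB /beta; ring.
have sdpi n : \sum_(r < n.+1) dpi r = pimean (gam n).
  elim: n => [|n ih]; first by rewrite big_ord1.
  by rewrite big_ord_recr ih /= gamS addrC subrK.
have hbeta : `|beta| <= L * mse_bias.
  have -> : beta = \sum_(r < N.+1) (Ex P (level r) - dpi r) - (mu - pimean (gam N)).
    by rewrite sumrB sdpi /beta; ring.
  apply: le_trans (ler_normB _ _) _.
  rewrite /mse_bias mulrDr addrC; apply: lerD.
    by apply: le_trans pib _; rewrite le_eqVlt; apply/orP; left; apply/eqP; ring.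
  apply: le_trans (ler_norm_sum _ _ _) _; rewrite mulr_sumr; apply: ler_sum => r _.
  by have [_ _ h _] := level_spec (ltn_ord r : (r <= N)%N).
have sS : sqi P (fun w => \sum_(r < N.+1) Yc r w).
  by apply: sqi_sum => k kN; exact: sYc.
have ES : Ex P (fun w => \sum_(r < N.+1) Yc r w) = 0.
  have [_ ->] := Ex_sum (n := N.+1) (fun k kN => sqi_integrable (sYc k kN)).
  by apply: big1 => r _; apply: EYc; exact: (ltn_ord r).
have cross r s : (r <= N)%N -> (s <= N)%N -> r != s ->
    Ex P (fun w => Yc r w * Yc s w) = 0.
  move=> rN sN rs; have [_ _ _ m1] := level_spec rN; have [_ _ _ m2] := level_spec sN.
  rewrite (indep_Ex_mul (sYc _ rN) (sYc _ sN)) ?EYc ?mul0r// => A A' mA mA'.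
  have sg k : sigma_algebra setT (path_sigma_algebra (Bs k)).
    exact: smallest_sigma_algebra.
  apply: (levels_indep rN sN rs); apply: (Fmeas_preimage (sg _)) => //;
    by apply: measurable_funB.
have Evar : Ex P (fun w => (\sum_(r < N.+1) Yc r w) ^+ 2) <= L ^+ 2 * mse_var.
  have iC (r s : nat) : (r < N.+1)%N -> (s < N.+1)%N ->
     P.-integrable setT (EFin \o (fun w => Yc r w * Yc s w)).
    by move=> rN sN; apply: mul_integrable; exact: sYc.
  have -> : (fun w => (\sum_(r < N.+1) Yc r w) ^+ 2) =
      (fun w => \sum_(r < N.+1) \sum_(s < N.+1) Yc r w * Yc s w).
    by apply/funext => w; rewrite expr2 mulr_suml; apply: eq_bigr => k _;
      rewrite mulr_sumr.
  have i1 (r : nat) (rN : (r < N.+1)%N) := Ex_sum (n := N.+1) (fun s sN => iC r s rN sN).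
  have [_ ->] := Ex_sum (n := N.+1) (X := fun r w => \sum_(s < N.+1) Yc r w * Yc s w)
    (fun r rN => (i1 r rN).1).
  rewrite /mse_var mulr_sumr; apply: ler_sum => r _.
  rewrite (i1 r (ltn_ord r)).2 (bigD1 r)//= big1 ?addr0; last first.
    move=> s sr; apply: cross; [exact: (ltn_ord r)|exact: (ltn_ord s)|].
    by rewrite eq_sym.
  have [_ h _ _] := level_spec (ltn_ord r : (r <= N)%N).
  apply: le_trans h; rewrite le_eqVlt; apply/orP; left; apply/eqP.
  by congr Ex; apply/funext => w; rewrite expr2.
have V0 : 0 <= mse_var + mse_bias ^+ 2.
  apply: addr_ge0; last exact: sqr_ge0.
  apply: sumr_ge0 => r _; have /andP[a0 _] := ha.
  have lv A C D : 0 <= A -> 0 < D -> 0 <= level_var alpha A C D.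
    move=> A0 D0; rewrite /level_var mulr_ge0//.
      by rewrite divr_ge0 ?mulr_ge0// ltW.
    by rewrite mulr_ge0 ?divr_ge0 ?(ltW a0)// addr_ge0// le_max lexx.
  have TD k : (k <= N)%N -> 0 < Th k - tau by move=> kN; rewrite subr_gt0 hTh.
  case: r => -[|s] sN /=; apply: lv; rewrite ?TD//.
  by rewrite mulr_ge0 ?powR_ge0//; case: HH2 => /ltW.
have sD : sqi P (fun w => \sum_(r < N.+1) Yc r w + beta).
  exact: sqiD sS (cst_sqi P beta).
have main : L2le P (fun w => \sum_(r < N.+1) Yc r w + beta)
    (L * Num.sqrt (mse_var + mse_bias ^+ 2)).
  apply: L2leP => //; first by rewrite mulr_ge0// sqrtr_ge0.
  rewrite exprMn sqr_sqrtr//.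
  have -> : (fun w => (\sum_(r < N.+1) Yc r w + beta) ^+ 2) =
      (fun w => ((\sum_(r < N.+1) Yc r w) ^+ 2 +
        (2 * beta) * (\sum_(r < N.+1) Yc r w)) + beta ^+ 2).
    by apply/funext => w; ring.
  have i1 := sqr_integrable sS.
  have i2 := integrable_scale (2 * beta) (sqi_integrable sS).
  have i3 := sqi_integrable (cst_sqi P (beta ^+ 2)).
  rewrite (ExD (integrable_add i1 i2) i3) (ExD i1 i2) (ExZ _ (sqi_integrable sS)).
  rewrite ES mulr0 addr0 (Ex_cst P) mulrDr; apply: lerD => //.
  rewrite -exprMn -[leLHS]real_normK ?num_real//.
  by rewrite lerXn2r ?nnegrE// (le_trans (normr_ge0 beta)).
apply: le_trans (le_L2norm main); rewrite /L2norm.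
rewrite le_eqVlt; apply/orP; left; apply/eqP; apply: eq_Lnorm => w.
by rewrite -YE EFinB /mu fineK.
Qed.

End Estimator.

End Levels.

(** * Choice of the horizons *)

Section PowersOfTwo.
Context {R : realType}.
Implicit Types x y : R.

Lemma ln2_bounds : 1 / 2 <= ln (2 : R) <= 1.
Proof.
apply/andP; split.
  rewrite -[leLHS](expRK (1 / 2)) ler_ln ?posrE ?expR_gt0//.
  exact: expR_half_le2.
have -> : 2 = 1 + 1 :> R by ring.
by apply: le_ln1Dx; lra.
Qed.

Lemma pow2E x : 2 `^ x = expR (x * ln 2).
Proof. by rewrite /powR pnatr_eq0. Qed.

Lemma pow2D x y : 2 `^ (x + y) = 2 `^ x * 2 `^ y.
Proof. by rewrite !pow2E mulrDl expRD. Qed.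

Lemma pow2_gt0 x : 0 < 2 `^ x.
Proof. by rewrite pow2E expR_gt0. Qed.

Lemma ler_pow2 x y : x <= y -> 2 `^ x <= 2 `^ y.
Proof. by move=> xy; apply: ler_powR; [rewrite ler1n|]. Qed.

Lemma pow2_le4 x : x <= 2 -> 2 `^ x <= 4.
Proof.
move=> /ler_pow2 /le_trans; apply.
by rewrite (powR_mulrn 2)// expr2 -natrM.
Qed.

(** Used at y = (a-1)/2, where it gives a gap of (a-1)/8 below 1: the origin of (a-1)^(-2) in
    [d_const]. *)
Lemma one_sub_pow2_ge y : 0 <= y <= 1 -> y / 4 <= 1 - 2 `^ (- y).
Proof.
move=> /andP[y0 y1]; have /andP[l1 l2] := ln2_bounds.
rewrite powRN pow2E; set z := y * ln 2.
have z0 : 0 <= z by rewrite mulr_ge0//; lra.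
have z1 : y / 2 <= z by rewrite /z; nra.
have ez := expR_ge1Dx z.
have h : (expR z)^-1 <= (1 + y / 2)^-1.
  by rewrite lef_pV2 ?posrE ?expR_gt0//; [lra|lra].
have : (1 + y / 2)^-1 <= 1 - y / 4.
  by rewrite -[leLHS]mul1r ler_pdivrMr; [nra|lra].
lra.
Qed.

End PowersOfTwo.

(** Multiplication by (1 - x)^2 telescopes the sum. *)
Lemma sum_geom_deriv_le {R : realType} (x : R) n : 0 <= x < 1 ->
  \sum_(s < n) s.+1%:R * x ^+ s <= (1 - x) ^- 2.
Proof.
move=> /andP[x0 x1]; have d0 : 0 < (1 - x) ^+ 2 by rewrite exprn_gt0// subr_gt0.
have E : (1 - x) ^+ 2 * \sum_(s < n) s.+1%:R * x ^+ s =
    1 - (n.+1%:R * x ^+ n - n%:R * x ^+ n.+1).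
  elim: n => [|n ih]; first by rewrite big_ord0 expr0; ring.
  by rewrite big_ord_recr /= mulrDr ih !exprS -!natr1; ring.
rewrite -[leRHS]mul1r ler_pdivlMr// mulrC E gerBl subr_ge0.
apply: ler_pM => //; first exact: exprn_ge0.
  by rewrite ler_nat.
by rewrite exprS ler_piMl ?exprn_ge0// ltW.
Qed.

Lemma log_plus_le {R : realType} (x : R) : 0 <= x -> log_plus x <= x.
Proof.
move=> x0; rewrite /log_plus ge_max x0 /=.
move: x0; rewrite le_eqVlt => /predU1P[<-|x0]; first by rewrite ln0.
by rewrite ltW// ln_sublinear.
Qed.

Lemma log_plusM {R : realType} (x y : R) : 0 <= x -> 0 <= y ->
  log_plus (x * 2 `^ y) <= log_plus x + y.
Proof.
move=> x0 y0; have /andP[l1 l2] := @ln2_bounds R; rewrite /log_plus ge_max.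
apply/andP; split; first by rewrite addr_ge0// le_max lexx.
move: x0; rewrite le_eqVlt => /predU1P[<-|x0].
  by rewrite mul0r ln0// addr_ge0// le_max lexx.
rewrite lnM ?posrE ?pow2_gt0// pow2E expRK; apply: lerD.
  by rewrite le_max lexx orbT.
by rewrite ler_piMr.
Qed.

(** * Variance, bias and cost for the chosen horizons *)

Section Numerics.
Context {R : realType}.
Variables (alpha a delta gamma0 r0 th eps c2 c4 : R).
Hypotheses (ha : 0 < alpha <= 1) (haa : 1 <= a <= 2) (hg0 : 0 < gamma0)
  (hr0 : 1 <= r0) (hth : 0 < th) (heps : 0 < eps < 1) (hd : 0 < delta <= 1)
  (hc2 : 0 < c2) (hc4 : 0 <= c4).

Let u : R := (1 + a) / 2.
Let N := nlevels delta r0 eps.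
Let Th := horizon a delta r0 th eps.
(** The extra factor of the horizons at a = 1; with it, [horizonE] is one formula for both cases. *)
Definition kappa : R := if a == 1 then N%:R ^+ 2 else 1.

Let a_gt1 : a != 1 -> 1 < a.
Proof. by move=> a1; case/andP: haa => h _; rewrite lt_def a1. Qed.

Let eps0 : 0 < eps. Proof. by case/andP: heps. Qed.
Let u1 : 1 <= u. Proof. by rewrite /u; case/andP: haa => *; lra. Qed.
Let u0 : 0 <= u. Proof. exact: le_trans u1. Qed.
Let u2 : u <= 2. Proof. by rewrite /u; case/andP: haa => *; lra. Qed.

Lemma horizonE r : Th r = th * eps ^- 2 * kappa * 2 `^ (- (u * r%:R)).
Proof.
rewrite /Th /horizon /kappa /u; case: eqP => [->|_].
  rewrite (_ : (1 + 1) / 2 = 1 :> R); last by field.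
  by rewrite mul1r powRN powR_mulrn.
by rewrite mulr1 mulNr.
Qed.

Lemma ratio_gt1 : 1 < r0 / eps.
Proof.
case/andP: heps => e0 e1; rewrite ltr_pdivlMr// mul1r.
exact: lt_le_trans hr0.
Qed.

Let lnE_gt0 : 0 < ln (r0 / eps). Proof. exact: ln_gt0 ratio_gt1. Qed.

Lemma nlevels_bounds : delta^-1 * (ln (r0 / eps) / ln 2) <= N%:R <
  delta^-1 * (ln (r0 / eps) / ln 2) + 1.
Proof.
have /andP[l1 l2] := @ln2_bounds R.
have /andP[d0 d1] := hd.
set x := delta^-1 * _.
have x0 : 0 < x.
  by rewrite /x mulr_gt0 ?invr_gt0// divr_gt0//; lra.
have c0 : 0 < Num.ceil x by rewrite ceil_gt0.
have NE : N%:R = (Num.ceil x)%:~R :> R.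
  by rewrite /N /nlevels -/x natr_absz gtr0_norm.
have /andP[h1 h2] := ceil_itv x; rewrite NE h2 /=.
by move: h1; rewrite intrB; lra.
Qed.

Lemma nlevels_gt0 : (0 < N)%N.
Proof.
have /andP[h1 _] := nlevels_bounds; rewrite -(ltr0n R).
apply: lt_le_trans h1; have /andP[l1 l2] := @ln2_bounds R.
have /andP[d0 d1] := hd.
by rewrite mulr_gt0 ?invr_gt0// divr_gt0//; lra.
Qed.

Lemma kappa_ge1 : 1 <= kappa.
Proof.
rewrite /kappa; case: ifP => // _; have := nlevels_gt0.
by rewrite -(ler1n R) => h; rewrite exprn_ege1.
Qed.

Let kappa0 : 0 < kappa. Proof. by apply: lt_le_trans kappa_ge1. Qed.

Lemma horizon_gt0 r : 0 < Th r.
Proof.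
by rewrite horizonE !mulr_gt0 ?invr_gt0 ?exprn_gt0 ?pow2_gt0.
Qed.

Lemma horizon_le r : (r <= N)%N -> Th N <= Th r.
Proof.
move=> rN; rewrite !horizonE; apply: ler_wpM2l.
  by rewrite ltW// !mulr_gt0 ?invr_gt0 ?exprn_gt0.
by apply: ler_pow2; rewrite lerN2 ler_wpM2l ?ler_nat.
Qed.

Lemma horizon_gap tau r : tau <= Th N / 2 -> (r <= N)%N ->
  Th r / 2 <= Th r - tau.
Proof. by move=> h rN; have := horizon_le rN; lra. Qed.

Lemma inv_horizon r :
  (Th r)^-1 = eps ^+ 2 / (th * kappa) * 2 `^ (u * r%:R).
Proof.
rewrite horizonE powRN; field.
by rewrite !gt_eqF ?pow2_gt0.
Qed.

(** This is what the number of levels is chosen for: by (H3) the bias of the finest scheme scales as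
    2^(- delta N), here at most eps/r0. *)
Lemma pow2_nlevels_ge : r0 / eps <= 2 `^ (delta * N%:R).
Proof.
have /andP[h1 _] := nlevels_bounds; have /andP[d0 d1] := hd.
have /andP[l1 l2] := @ln2_bounds R.
have l0 : 0 < ln (2 : R) by lra.
have r1 := ratio_gt1.
have rp : r0 / eps \is Num.pos by rewrite posrE (lt_trans _ r1).
rewrite -{1}(lnK rp) pow2E ler_expR.
apply: (@le_trans _ _ (delta * (delta^-1 * (ln (r0 / eps) / ln 2)) * ln 2)).
  by rewrite le_eqVlt; apply/orP; left; apply/eqP; field; rewrite !gt_eqF.
by rewrite ler_pM2r// ler_pM2l.
Qed.

(** Rounding the number of levels up costs at most 2^u <= 4. *)
Lemma pow2_nlevels_le : 2 `^ (u * N%:R) <= 4 * (r0 / eps) `^ (u / delta).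
Proof.
have /andP[_ h1] := nlevels_bounds; have /andP[d0 d1] := hd.
have /andP[l1 l2] := @ln2_bounds R.
have l0 : 0 < ln (2 : R) by lra.
have r1 := ratio_gt1.
apply: (@le_trans _ _ (2 `^ (u * (delta^-1 * (ln (r0 / eps) / ln 2) + 1)))).
  by apply: ler_pow2; rewrite ler_wpM2l ?(ltW h1).
rewrite mulrDr mulr1 pow2D mulrC; apply: ler_pM; rewrite ?powR_ge0 ?pow2_le4//.
rewrite pow2E /powR gt_eqF ?(lt_trans _ r1)// ler_expR.
by rewrite le_eqVlt; apply/orP; left; apply/eqP; field; rewrite !gt_eqF.
Qed.

(** The ratio between successive levels both of the variance factor gamma_r^a / T_r and of the cost
    T_r / gamma_r: the horizons balance the two. *)
Let x : R := 2 `^ (- ((a - 1) / 2)).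

Let x_bounds : 0 <= x <= 1.
Proof.
rewrite powR_ge0 /= /x -[leRHS](powRr0 2); apply: ler_pow2.
by case/andP: haa => *; lra.
Qed.

(** At a = 1 the ratio is 1 and the sum is quadratic in [N], which [kappa] compensates. For a > 1
    the sum is at most (1 - x)^(-2), and 64 is the square of the 8 in 1 - x >= (a-1)/8. *)
Lemma weighted_geom_le :
  \sum_(s < N) s.+1%:R * x ^+ s <= kappa * (64 * d_const a).
Proof.
have /andP[x0 x1] := x_bounds; have /andP[a1 a2] := haa.
rewrite /kappa /d_const; case: eqP => [_|/eqP an].
  apply: (@le_trans _ _ (\sum_(s < N) N%:R)).
    apply: ler_sum => s _; rewrite -[leRHS]mulr1; apply: ler_pM => //.
    - exact: exprn_ge0.
    - by rewrite ler_nat.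
    - exact: exprn_ile1.
  rewrite sumr_const card_ord -[leLHS]mulr_natr -expr2 ler_peMr ?sqr_ge0//; lra.
have := a_gt1 an => a1'.
have h := @one_sub_pow2_ge R ((a - 1) / 2).
have {}h : (a - 1) / 8 <= 1 - x.
  apply: le_trans (h _); last by apply/andP; split; lra.
  by lra.
have hx : 0 <= x < 1 by rewrite x0 /=; lra.
apply: le_trans (sum_geom_deriv_le _ hx) _; rewrite mul1r.
have -> : 64 * (a - 1) ^- 2 = ((a - 1) / 8) ^- 2.
  by field; rewrite subr_eq0 an.
rewrite lef_pV2 ?posrE ?exprn_gt0//; [|lra|lra].
by rewrite lerXn2r ?nnegrE//; lra.
Qed.

Let A0 : R := c2 * gamma0 `^ (a / 2).
Let Q : R := c2 ^+ 2 * gamma0 `^ a + c4 ^+ 2.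

Let A0_gt0 : 0 < A0. Proof. by rewrite mulr_gt0 ?powR_gt0. Qed.

Lemma A0_sqr : A0 ^+ 2 = c2 ^+ 2 * gamma0 `^ a.
Proof.
rewrite /A0 exprMn; congr (_ * _); rewrite -powR_mulrn ?powR_ge0//.
by rewrite -powRrM divfK.
Qed.

Lemma correction_scale s :
  c2 * mlstep gamma0 s `^ (a / 2) = A0 * 2 `^ (- (a / 2 * s%:R)).
Proof.
rewrite /mlstep /A0 powRM ?invr_ge0 ?exprn_ge0 ?(ltW hg0)// mulrA; congr (_ * _).
by rewrite -powR_mulrn// -powRN -powRrM; congr (_ `^ _); ring.
Qed.

Lemma level_var_le (A C D D' : R) : 0 < A -> 0 < D' -> D' / 2 <= D ->
  level_var alpha A C D <= 4 * (A ^+ 2 * (log_plus (C / A) + 3)) / alpha / D'.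
Proof.
move=> hA hD hDD; have /andP[a0 _] := ha.
have D0 : 0 < D by apply: lt_le_trans hDD; rewrite divr_gt0.
have l0 : 0 <= log_plus (C / A) + 3 by rewrite addr_ge0// le_max lexx.
have -> : level_var alpha A C D = (2 * A ^+ 2 * (log_plus (C / A) + 3) / alpha) * D^-1.
  by rewrite /level_var; field; rewrite !gt_eqF.
have -> : 4 * (A ^+ 2 * (log_plus (C / A) + 3)) / alpha / D' =
    (2 * A ^+ 2 * (log_plus (C / A) + 3) / alpha) * (D' / 2)^-1.
  by field; rewrite !gt_eqF.
apply: ler_wpM2l; first by rewrite divr_ge0 ?(ltW a0)// mulr_ge0// mulr_ge0// sqr_ge0.
by rewrite lef_pV2 ?posrE ?divr_gt0.
Qed.

(** The logarithm is at most 2 c4 / A0 + s. Its first term, from ln y <= y, is absorbed because A0^2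
    (2 c4 / A0) <= Q, so no log(1/gamma0) enters; the second gives the factor s + 1. The 64 is 4
    from [level_var_le], 4 from [main] and 4 >= 2^u. *)
Lemma correction_var_le tau s : tau <= Th N / 2 -> (s < N)%N ->
  level_var alpha (c2 * mlstep gamma0 s `^ (a / 2)) (2 * c4) (Th s.+1 - tau) <=
  64 * Q / (alpha * th) * eps ^+ 2 * (s.+1%:R * x ^+ s / kappa).
Proof.
move=> htau sN; have /andP[al0 _] := ha; have /andP[a1 a2] := haa.
have hT := horizon_gt0 s.+1; have hgap := horizon_gap htau sN.
rewrite correction_scale; set y := a / 2 * s%:R.
have y0 : 0 <= y by rewrite mulr_ge0//; lra.
have ys : y <= s%:R by rewrite ler_piMl//; lra.
set A := A0 * _; have hA : 0 < A by rewrite mulr_gt0 ?pow2_gt0.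
apply: le_trans (level_var_le _ hA hT hgap) _.
have AE : A ^+ 2 = A0 ^+ 2 * 2 `^ (- (a * s%:R)).
  rewrite /A exprMn; congr (_ * _); rewrite -powR_mulrn ?powR_ge0// -powRrM.
  by congr (_ `^ _); rewrite /y; field.
have lp : log_plus (2 * c4 / A) <= 2 * c4 / A0 + s%:R.
  have -> : 2 * c4 / A = 2 * c4 / A0 * 2 `^ y.
    by rewrite /A powRN; field; rewrite !gt_eqF ?pow2_gt0.
  have c0 : 0 <= 2 * c4 / A0 by apply: divr_ge0; [exact: mulr_ge0|exact: ltW].
  apply: le_trans (log_plusM c0 y0) _; apply: lerD => //; exact: log_plus_le.
have Q0 : 0 <= Q.
  by apply: addr_ge0; [apply: mulr_ge0; [exact: sqr_ge0|exact: powR_ge0]|exact: sqr_ge0].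
have QE : Q = A0 ^+ 2 + c4 ^+ 2 by rewrite A0_sqr.
have main : A0 ^+ 2 * (log_plus (2 * c4 / A) + 3) <= 4 * Q * s.+1%:R.
  apply: (@le_trans _ _ (A0 ^+ 2 * (2 * c4 / A0 + s%:R + 3))).
    by rewrite ler_wpM2l ?sqr_ge0// lerD2r.
  have -> : A0 ^+ 2 * (2 * c4 / A0 + s%:R + 3) = 2 * c4 * A0 + A0 ^+ 2 * (s%:R + 3).
    by field; rewrite gt_eqF.
  have s0 : 0 <= s%:R :> R by [].
  have h1 := sqr_ge0 (A0 - c4); have h2 := sqr_ge0 c4.
  have h3 : A0 ^+ 2 * (s%:R + 3) <= Q * (s%:R + 3).
    by rewrite ler_wpM2r ?addr_ge0// QE lerDl.
  have h4 : 2 * c4 * A0 <= Q by rewrite QE; lra.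
  have h5 : 0 <= Q * s%:R by rewrite mulr_ge0.
  rewrite -[s.+1%:R]natr1; lra.
rewrite AE inv_horizon.
have xE : x ^+ s = 2 `^ (- (a * s%:R)) * 2 `^ (u * s%:R).
  rewrite -pow2D /x -powR_mulrn ?powR_ge0// -powRrM; congr (_ `^ _).
  by rewrite /u; field.
have uE : 2 `^ (u * s.+1%:R) = 2 `^ (u * s%:R) * 2 `^ u.
  by rewrite -pow2D -[s.+1%:R]natr1 mulrDr mulr1.
have -> : 4 * (A0 ^+ 2 * 2 `^ (- (a * s%:R)) * (log_plus (2 * c4 / A) + 3)) / alpha *
    (eps ^+ 2 / (th * kappa) * 2 `^ (u * s.+1%:R)) =
  (A0 ^+ 2 * (log_plus (2 * c4 / A) + 3)) * 2 `^ u *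
    (4 / (alpha * th) * eps ^+ 2 * (x ^+ s / kappa)).
  by rewrite uE xE; field; rewrite !gt_eqF.
have -> : 64 * Q / (alpha * th) * eps ^+ 2 * (s.+1%:R * x ^+ s / kappa) =
  (4 * Q * s.+1%:R) * 4 * (4 / (alpha * th) * eps ^+ 2 * (x ^+ s / kappa)).
  by field; rewrite !gt_eqF.
have /andP[x0 _] := x_bounds.
apply: ler_wpM2r.
  apply: mulr_ge0; last by apply: divr_ge0; [exact: exprn_ge0|exact: ltW].
  apply: mulr_ge0; last exact: sqr_ge0.
  by apply: divr_ge0 => //; apply: mulr_ge0; exact: ltW.
apply: ler_pM => //; rewrite ?powR_ge0 ?pow2_le4//.
by rewrite mulr_ge0 ?sqr_ge0// addr_ge0// le_max lexx.
Qed.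

Lemma base_var_le tau : tau <= Th N / 2 ->
  level_var alpha c4 c4 (Th 0%N - tau) <= 12 * c4 ^+ 2 / (alpha * th) * eps ^+ 2.
Proof.
move=> htau; have /andP[al0 _] := ha.
have hT := horizon_gt0 0; have hgap := horizon_gap htau (leq0n N).
move: hc4; rewrite le_eqVlt => /predU1P[<-|c0].
  by rewrite /level_var !(mulr0, mul0r, expr0n).
apply: le_trans (level_var_le _ c0 hT hgap) _.
rewrite divff ?gt_eqF// /log_plus ln1 maxxx add0r inv_horizon mulr0 powRr0 mulr1.
have -> : 4 * (c4 ^+ 2 * 3) / alpha * (eps ^+ 2 / (th * kappa)) =
  12 * c4 ^+ 2 / (alpha * th) * eps ^+ 2 * kappa^-1.
  by field; rewrite !gt_eqF.
rewrite ler_piMr ?invf_le1 ?kappa_ge1//.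
apply: mulr_ge0; last exact: sqr_ge0.
apply: divr_ge0; first by apply: mulr_ge0 => //; exact: sqr_ge0.
by apply: mulr_ge0; exact: ltW.
Qed.

Lemma d_const_ge1 : 1 <= d_const a.
Proof.
rewrite /d_const; case: eqP => // /eqP an; have a1 := a_gt1 an.
have /andP[_ a2] := haa.
by rewrite invf_ge1 ?exprn_gt0 ?subr_gt0// exprn_ile1//; lra.
Qed.

(** The base level gives 12 and the corrections 64 * 64, rounded up to 5000 in all. *)
Lemma mse_var_le tau : tau <= Th N / 2 ->
  mse_var alpha a c2 c4 gamma0 tau Th N <=
  5000 * (d_const a * Q / (alpha * th)) * eps ^+ 2.
Proof.
move=> htau; have /andP[al0 _] := ha.
have at0 : 0 < alpha * th by rewrite mulr_gt0.
rewrite /mse_var big_ord_recl /=.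
have d1 := d_const_ge1.
have Q0 : 0 <= Q.
  by apply: addr_ge0; [apply: mulr_ge0; [exact: sqr_ge0|exact: powR_ge0]|exact: sqr_ge0].
have cQ : c4 ^+ 2 <= Q.
  by rewrite /Q lerDr; apply: mulr_ge0; [exact: sqr_ge0|exact: powR_ge0].
have dQ : Q <= d_const a * Q by rewrite ler_peMl.
apply: (@le_trans _ _ (12 * c4 ^+ 2 / (alpha * th) * eps ^+ 2 +
   64 * Q / (alpha * th) * eps ^+ 2 * (64 * d_const a))).
  apply: lerD; first exact: base_var_le.
  apply: (@le_trans _ _ (\sum_(s < N)
    64 * Q / (alpha * th) * eps ^+ 2 * (s.+1%:R * x ^+ s / kappa))).
    by apply: ler_sum => s _; exact: (correction_var_le htau (ltn_ord s)).
  rewrite -mulr_sumr ler_wpM2l//.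
    apply: mulr_ge0; last exact: sqr_ge0.
    by apply: divr_ge0; [exact: mulr_ge0|exact: ltW].
  by rewrite -mulr_suml ler_pdivrMr// mulrC; exact: weighted_geom_le.
have -> : 12 * c4 ^+ 2 / (alpha * th) * eps ^+ 2 +
   64 * Q / (alpha * th) * eps ^+ 2 * (64 * d_const a) =
   (12 * c4 ^+ 2 + 4096 * (d_const a * Q)) * (eps ^+ 2 / (alpha * th)).
  by field; rewrite !gt_eqF.
have -> : 5000 * (d_const a * Q / (alpha * th)) * eps ^+ 2 =
   (5000 * (d_const a * Q)) * (eps ^+ 2 / (alpha * th)).
  by field; rewrite !gt_eqF.
rewrite ler_wpM2r ?divr_ge0 ?sqr_ge0 ?(ltW at0)//; lra.
Qed.

Lemma sum_inv_horizon_le :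
  \sum_(r < N.+1) (Th r)^-1 <= 8 / th * (r0 / eps) `^ (u / delta) * eps ^+ 2.
Proof.
under eq_bigr do rewrite inv_horizon.
rewrite -mulr_sumr.
(* Successive terms at least double, as u >= 1, so the last one carries half of the bound. *)
have geo n : \sum_(r < n.+1) 2 `^ (u * r%:R) <= 2 * 2 `^ (u * n%:R).
  elim: n => [|n ih]; first by rewrite big_ord1 mulr0 powRr0; lra.
  rewrite big_ord_recr /=; have := ih.
  have -> : 2 `^ (u * n.+1%:R) = 2 `^ (u * n%:R) * 2 `^ u.
    by rewrite -pow2D -[n.+1%:R]natr1 mulrDr mulr1.
  have := pow2_gt0 (u * n%:R); have : 2 <= 2 `^ u.
    by rewrite -{1}(powRr1 (_ : 0 <= 2 :> R))//; apply: ler_pow2.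
  nra.
apply: (@le_trans _ _ (eps ^+ 2 / (th * kappa) * (2 * (4 * (r0 / eps) `^ (u / delta))))).
  apply: ler_wpM2l.
    by apply: divr_ge0; [exact: sqr_ge0|apply: mulr_ge0; exact: ltW].
  by apply: le_trans (geo N) _; rewrite ler_wpM2l// pow2_nlevels_le.
have -> : eps ^+ 2 / (th * kappa) * (2 * (4 * (r0 / eps) `^ (u / delta))) =
  8 / th * (r0 / eps) `^ (u / delta) * eps ^+ 2 * kappa^-1.
  by field; rewrite !gt_eqF.
rewrite ler_piMr ?invf_le1 ?kappa_ge1//.
apply: mulr_ge0; last exact: sqr_ge0.
apply: mulr_ge0; last exact: powR_ge0.
by apply: divr_ge0 => //; exact: ltW.
Qed.

(** The first term is (H3) at the finest step, the second the transients of all levels, with 128 = 2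
    * 4 * 2 * 8. Nonnegativity is recorded so that the bound can be squared. *)
Lemma mse_bias_le tau c3 (d : nat) (y0 : 'cV[R]_d) (c1 : 'cV[R]_d -> R) :
  0 <= tau -> tau <= Th N / 2 -> 0 < c3 ->
  0 <= mse_bias y0 c1 alpha delta c3 gamma0 tau Th N <=
  c3 * gamma0 `^ delta / r0 * eps + 128 * `|c1 y0| / (alpha * th) *
    (expR (- alpha * tau) * ((r0 / eps) `^ (u / delta) * eps ^+ 2)).
Proof.
move=> t0 htau c30; have /andP[al0 _] := ha; have /andP[d0 d1] := hd.
have gap r : (r <= N)%N -> 0 < Th r - tau.
  move=> rN; apply: lt_le_trans (horizon_gap htau rN).
  by rewrite divr_gt0 ?horizon_gt0.
set K := 2 * `|c1 y0| * (4 / alpha * expR (- alpha * tau)).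
have K0 : 0 <= K.
  apply: mulr_ge0; first exact: mulr_ge0.
  by apply: mulr_ge0; [apply: divr_ge0 => //; exact: ltW|exact: expR_ge0].
apply/andP; split.
  rewrite /mse_bias addr_ge0 ?mulr_ge0 ?powR_ge0 ?(ltW c30)//.
  by apply: sumr_ge0 => r _; rewrite divr_ge0// ltW// gap// -ltnS ltn_ord.
rewrite /mse_bias; apply: lerD.
  have E : mlstep gamma0 N `^ delta = gamma0 `^ delta * (2 `^ (delta * N%:R))^-1.
    rewrite /mlstep powRM ?invr_ge0 ?exprn_ge0 ?(ltW hg0)//; congr (_ * _).
    by rewrite -powR_mulrn// -!powRN -powRrM; congr (_ `^ _); ring.
  have h : (2 `^ (delta * N%:R))^-1 <= eps / r0.
    rewrite -[leRHS]invf_div lef_pV2 ?posrE ?pow2_gt0 ?pow2_nlevels_ge//.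
    exact: lt_trans ratio_gt1.
  have -> : c3 * gamma0 `^ delta / r0 * eps = c3 * gamma0 `^ delta * (eps / r0).
    by ring.
  rewrite E mulrA; apply: ler_wpM2l => //.
  by apply: mulr_ge0; [exact: ltW|exact: powR_ge0].
apply: (@le_trans _ _ (\sum_(r < N.+1) K * 2 * (Th r)^-1)).
  apply: ler_sum => r _; rewrite -/K -mulrA ler_wpM2l//.
  have rN : (r <= N)%N by rewrite -ltnS ltn_ord.
  rewrite -[X in X * _]invrK -invfM mulrC lef_pV2 ?posrE ?gap ?divr_gt0 ?horizon_gt0//.
  exact: horizon_gap.
rewrite -mulr_sumr; apply: le_trans (ler_wpM2l _ sum_inv_horizon_le) _.
  by rewrite mulr_ge0.
by rewrite /K le_eqVlt; apply/orP; left; apply/eqP; field; rewrite !gt_eqF.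
Qed.

(** The two grids of level r >= 1 cost at most 3/2 T_r / gamma_r = 3/2 W x^r. At a = 1 these powers
    sum to at most N, and 1 + 3N/2 <= 5N/2; for a > 1 they sum to at most x / (1 - x), which is 1 /
    (2^((a-1)/2) - 1). *)
Lemma cost_bound_holds : cost_bound a delta gamma0 r0 th eps.
Proof.
rewrite /cost_bound /complexity -/N -/Th.
have /andP[a1 a2] := haa.
have g (r : nat) : 0 < mlstep gamma0 r by rewrite divr_gt0// exprn_gt0.
have tr (r s : nat) : (Num.truncn (Th r / mlstep gamma0 s))%:R <= Th r / mlstep gamma0 s.
  by rewrite truncn_le divr_ge0 ?ltW ?horizon_gt0.
rewrite natrD natr_sum big_add1 /= big_mkord.
pose W := th * eps ^- 2 * kappa / gamma0.
have W0 : 0 <= W by rewrite ltW// !mulr_gt0 ?invr_gt0 ?exprn_gt0.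
have xE (r : nat) : x ^+ r = 2 `^ (- (u * r%:R)) * 2 ^+ r.
  rewrite -(powR_mulrn r (_ : 0 <= 2 :> R))// -pow2D /x -powR_mulrn ?powR_ge0// -powRrM.
  by congr (_ `^ _); rewrite /u; field.
apply: (@le_trans _ _ (W * (1 + 3 / 2 * \sum_(r < N) x ^+ r.+1))).
  rewrite mulrDr mulr1; apply: lerD.
    apply: le_trans (tr 0%N 0%N) _; rewrite horizonE mulr0 oppr0 powRr0 mulr1.
    by rewrite /mlstep expr0 divr1.
  rewrite mulrCA mulr_sumr mulr_sumr; apply: ler_sum => r _.
  rewrite natrD; apply: le_trans (lerD (tr r.+1 r.+1) (tr r.+1 r)) _.
  rewrite horizonE /mlstep xE /W (exprS 2 r) le_eqVlt; apply/orP; left; apply/eqP.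
  by field; rewrite !gt_eqF// exprn_gt0.
have -> : (if a == 1 then eps ^- 2 * N%:R ^+ 3 else eps ^- 2) =
    eps ^- 2 * kappa * (if a == 1 then N%:R else 1).
  by rewrite /kappa; case: eqP => _; ring.
have -> : cost_const a * gamma0^-1 * th *
    (eps ^- 2 * kappa * (if a == 1 then N%:R else 1)) =
    W * (cost_const a * (if a == 1 then N%:R else 1)).
  rewrite /W; move: (if a == 1 then N%:R else 1) (cost_const a) (kappa) => X C K.
  by field; rewrite !gt_eqF.
rewrite ler_wpM2l//.
have /andP[x0 x1] := x_bounds.
have N1 : 1 <= N%:R :> R by rewrite ler1n nlevels_gt0.
rewrite /cost_const; case: eqP => [_|/eqP an].
  have : \sum_(r < N) x ^+ r.+1 <= N%:R.
    apply: (@le_trans _ _ (\sum_(r < N) 1)); last by rewrite sumr_const card_ord.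
    by apply: ler_sum => r _; exact: exprn_ile1.
  lra.
have a1' := a_gt1 an.
rewrite mulr1 lerD2l ler_wpM2l//.
have xlt : x < 1.
  have := @one_sub_pow2_ge R ((a - 1) / 2); rewrite -/x => h.
  have : (a - 1) / 2 / 4 <= 1 - x by apply: h; apply/andP; split; lra.
  lra.
have hx : 0 <= x < 1 by rewrite x0.
under eq_bigr do rewrite exprS.
rewrite -mulr_sumr; apply: le_trans (ler_wpM2l x0 (geom_sum_le _ hx)) _.
have xp : 0 < x by exact: pow2_gt0.
have -> : 2 `^ ((a - 1) / 2) = x^-1 by rewrite /x powRN invrK.
have -> : x^-1 - 1 = (1 - x) / x by rewrite mulrBl mul1r divff ?gt_eqF.
by rewrite invf_div.
Qed.

End Numerics.

(** * Choice of tau and the error constants *)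

Section Assembly.
Context {R : realType} (alpha a delta gamma0 r0 th c2 c3 c4 : R)
  {d : nat} {disp : measure_display} {Omega : measurableType disp}
  {P : probability Omega R} {B : R -> Omega -> 'cV[R]_d}
  {b : 'cV[R]_d -> 'cV[R]_d} {sigma : 'cV[R]_d -> 'M[R]_d}
  (pi : probability (Borel R d) R) (pig : R -> probability (Borel R d) R)
  {x0 : 'cV[R]_d} {eta0 : R} {f : 'cV[R]_d -> R} {c1 : 'cV[R]_d -> R}.
Hypotheses (ha : 0 < alpha <= 1) (haa : 1 <= a <= 2) (hg0 : 0 < gamma0)
  (hr0 : 1 <= r0) (hth : 0 < th) (he : 0 < eta0 <= 1 / 2) (hge : gamma0 <= eta0)
  (Hset : mlmc_setting P B b sigma eta0 pi pig) (Hf : lipschitzR f)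
  (HH1 : H1 P B b sigma pig f eta0 alpha c1)
  (HH2 : H2 P B b sigma x0 eta0 a c2) (HH3 : H3 pi pig f eta0 a delta c3)
  (HH4 : H4 P B b sigma x0 eta0 c1 c4).

Let u : R := (1 + a) / 2.
(** The transients exceed [eps] by a factor of order eps^(-c), for which exp(- alpha tau) has to
    make up; c / alpha is the threshold for tau_1 in (i). *)
Let c : R := u / delta - 1.

(** The range of delta in (H3) enters here: u / delta <= 2 keeps the shortest horizon from vanishing
    as eps tends to 0, and strictness for a > 1 makes it grow. *)
Lemma delta_bounds : [/\ 0 < delta, delta <= 1, u / delta <= 2 &
  a != 1 -> u / delta < 2].
Proof.
have [_ h1 h2 _] := HH3; have /andP[a1 a2] := haa.
have [ae|an] := eqVneq a 1.
  have /andP[d1 d2] := h1 ae; have d0 : 0 < delta by lra.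
  split => //; rewrite ler_pdivrMr// /u ae; lra.
have /andP[d1 d2] : (1 + a) / 4 < delta <= 1 by apply: h2; rewrite lt_def an.
have d0 : 0 < delta by lra.
have h : u / delta < 2 by rewrite ltr_pdivrMr// /u; lra.
by split => //; exact: ltW.
Qed.

Let c_ge0 : 0 <= c.
Proof.
have [d0 d1 _ _] := delta_bounds; have /andP[a1 _] := haa.
by rewrite /c subr_ge0 ler_pdivlMr// mul1r /u; lra.
Qed.

(** (H4) at time 0, where the scheme sits at x_0. *)
Lemma c1_le_c4 : `|c1 x0| <= c4.
Proof.
have HB : brownian P B by case: Hset.
have c40 : 0 <= c4 by case: HH4.
have hg : 0 < gamma0 <= eta0 by rewrite hg0.
have [_ /Ex_sqr_le] := chain_L2 Hset HH4 0%N HB hg.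
rewrite /= Ex_cst => h.
by rewrite -(ler_pXn2r (isT : (0 < 2)%N)) ?nnegrE// real_normK ?num_real.
Qed.

Variables (eps tau : R).
Hypothesis heps : 0 < eps < 1.
Let N := nlevels delta r0 eps.
Let Th := horizon a delta r0 th eps.
Let l : R := ln eps^-1.

Lemma eps_exp : eps = expR (- l).
Proof. by case/andP: heps => e0 _; rewrite /l lnV ?opprK ?lnK. Qed.

Lemma l_gt0 : 0 < l.
Proof. by case/andP: heps => e0 e1; rewrite ln_gt0// invf_gt1. Qed.

Lemma ratio_exp : (r0 / eps) `^ (u / delta) * eps = r0 `^ (u / delta) * expR (c * l).
Proof.
have /andP[e0 _] := heps.
rewrite powRM ?invr_ge0 ?(ltW e0) ?(le_trans ler01)// -mulrA; congr (_ * _).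
rewrite {2}eps_exp /powR invr_eq0 gt_eqF// -expRD; congr expR.
by rewrite /c -/l; ring.
Qed.

(** Common end of (i) and (ii), which differ only in how they bound [Cv] and [Cb], the variance and
    the bias with [f]_1 and eps scaled out. *)
Lemma error_and_cost Bs Cv Cb : 0 <= tau <= Th N / 2 ->
  independent_brownians P N Bs ->
  5000 * (d_const a * (c2 ^+ 2 * gamma0 `^ a + c4 ^+ 2) / (alpha * th)) <= Cv ->
  c3 * gamma0 `^ delta / r0 + 128 * `|c1 x0| / (alpha * th) *
    (expR (- alpha * tau) * (r0 `^ (u / delta) * expR (c * l))) <= Cb ->
  error_bound P pi f (mlmc b sigma Bs N (mlstep gamma0) tau Th x0 f)
    (Num.sqrt (Cv + Cb ^+ 2)) eps /\
  cost_bound a delta gamma0 r0 th eps.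
Proof.
move=> /andP[t0 tT] HBs hCv hCb.
have [d0 d1 _ _] := delta_bounds; have /andP[e0 e1] := heps.
have hd : 0 < delta <= 1 by rewrite d0.
have [c20 _] := HH2; have [c40 _ _] := HH4; have [c30 _ _ _] := HH3.
have [L0 _] := lip_bounds Hf.
split; last exact: cost_bound_holds.
have hTh r : (r <= N)%N -> tau < Th r.
  move=> rN; have := horizon_gap haa hr0 hth heps hd tT rN.
  have : 0 < horizon a delta r0 th eps r by exact: horizon_gt0.
  rewrite -/(Th r); lra.
have hg : 0 < gamma0 <= eta0 by rewrite hg0.
have M := mse_bound ha he Hset Hf HH1 HH2 HH4 hg t0 hTh HBs HH3.
have V := mse_var_le ha haa hg0 hr0 hth heps hd c20 c40 tT.
have /andP[b0 Bb] := mse_bias_le ha haa hg0 hr0 hth heps hd x0 c1 t0 tT c30.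
apply: le_trans M _; rewrite lee_fin -mulrA mulrCA; apply: ler_wpM2l => //.
rewrite -[X in _ <= _ * X](ger0_norm (ltW e0)) -sqrtr_sqr mulrC -sqrtrM ?sqr_ge0//.
apply: ler_wsqrtr; rewrite mulrDr -exprMn; apply: lerD.
  by apply: le_trans V _; rewrite [leRHS]mulrC ler_wpM2r ?sqr_ge0.
have hB : mse_bias x0 c1 alpha delta c3 gamma0 tau Th N <= eps * Cb.
  apply: le_trans Bb _; rewrite [leLHS](_ : _ = eps * (c3 * gamma0 `^ delta / r0 +
    128 * `|c1 x0| / (alpha * th) *
      (expR (- alpha * tau) * ((r0 / eps) `^ (u / delta) * eps)))).
    by rewrite ratio_exp; apply: ler_wpM2l => //; exact: ltW.
  by rewrite -/u; ring.
by rewrite lerXn2r ?nnegrE// (le_trans b0).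
Qed.

(** As gamma0 <= 1/2, ln(1/gamma0) >= 1/2, so the maximum in t_0 controls c2^2 gamma0^a up to a
    factor 2; the 3 is this 2 plus 1 for c4^2. *)
Lemma t0_control : t0_const alpha a gamma0 c2 c4 <= th ->
  d_const a * (c2 ^+ 2 * gamma0 `^ a + c4 ^+ 2) <= 3 * (alpha * th) /\
  d_const a * c4 ^+ 2 <= alpha * th.
Proof.
rewrite /t0_const; set m := Num.max _ _; have /andP[al0 _] := ha => h.
have d1 : 0 <= d_const a by apply: le_trans (d_const_ge1 haa).
have {}h : d_const a * m <= alpha * th.
  by rewrite mulrAC ler_pdivrMr// [th * _]mulrC in h.
have m1 : c2 ^+ 2 * gamma0 `^ a * ln gamma0^-1 <= m by rewrite le_max lexx.
have m2 : c4 ^+ 2 <= m by rewrite le_max lexx orbT.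
have lg : 1 / 2 <= ln gamma0^-1.
  have /andP[l1 _] := @ln2_bounds R; apply: le_trans l1 _.
  rewrite ler_ln ?posrE ?invr_gt0// -[leLHS]invrK lef_pV2 ?posrE ?invr_gt0//.
  by case/andP: he => _ h2; apply: le_trans hge (le_trans h2 _); rewrite div1r.
have q0 : 0 <= c2 ^+ 2 * gamma0 `^ a by apply: mulr_ge0; [exact: sqr_ge0|exact: powR_ge0].
have q1 : c2 ^+ 2 * gamma0 `^ a * (1 / 2) <= c2 ^+ 2 * gamma0 `^ a * ln gamma0^-1.
  by rewrite ler_wpM2l.
split; last by apply: le_trans h; rewrite ler_wpM2l.
apply: (@le_trans _ _ (d_const a * (3 * m))); first by rewrite ler_wpM2l//; lra.
lra.
Qed.

(* [exp(- alpha tau)] beats [eps^(1 - u/delta)] either because [tau] exceeds the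
   critical multiple of [ln (1/eps)], or because [tau >= T_N / 2] and [T_N] is at
   least quadratic in [ln (1/eps)]. *)
Definition tail_const : R := let p := 2 - u / delta in
  th / 4 * r0 `^ (- (u / delta)) * (if a == 1 then 1 else p ^+ 2 / 4).

Lemma tail_const_gt0 : 0 < tail_const.
Proof.
have [_ _ _ h] := delta_bounds; rewrite /tail_const.
apply: mulr_gt0; first by rewrite mulr_gt0 ?powR_gt0 ?divr_gt0// (lt_le_trans _ hr0).
case: eqP => // /eqP /h h'; rewrite divr_gt0// exprn_gt0// subr_gt0//.
Qed.

(** By [pow2_nlevels_le], T_N is at least a multiple of [kappa] times exp(p l), with p = 2 -
    u/delta. For a > 1, exp(p l) >= (p l / 2)^2 with p > 0; at a = 1, p may be 0, and the square
    comes from kappa = N^2 >= l^2. *)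
Lemma horizon_log_sqr : tail_const * l ^+ 2 <= Th N.
Proof.
have [d0 d1 p2 p2'] := delta_bounds; have /andP[e0 e1] := heps.
have hd : 0 < delta <= 1 by rewrite d0.
have r00 : 0 < r0 by exact: lt_le_trans hr0.
have U := pow2_nlevels_le haa hr0 heps hd.
rewrite /Th horizonE -/N -/u powRN.
have k1 : 0 < kappa a delta r0 eps by apply: lt_le_trans (kappa_ge1 a hr0 heps hd).
apply: (@le_trans _ _ (th * eps ^- 2 * kappa a delta r0 eps *
    (4 * (r0 / eps) `^ (u / delta))^-1)); last first.
  apply: ler_wpM2l; first by rewrite ltW// !mulr_gt0 ?invr_gt0 ?exprn_gt0.
  by rewrite lef_pV2 ?posrE ?pow2_gt0 ?mulr_gt0 ?powR_gt0 ?divr_gt0.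
set p := 2 - u / delta.
have -> : th * eps ^- 2 * kappa a delta r0 eps * (4 * (r0 / eps) `^ (u / delta))^-1 =
    th / 4 * r0 `^ (- (u / delta)) * (kappa a delta r0 eps * expR (p * l)).
  have -> : expR (p * l) = eps ^- 2 * (eps^-1 `^ (u / delta))^-1.
    have E2 : eps ^- 2 = expR (2 * l).
      by rewrite eps_exp -expRM_natl -expRN; congr expR; ring.
    have E3 : eps^-1 `^ (u / delta) = expR (u / delta * l).
      by rewrite /powR invr_eq0 gt_eqF.
    by rewrite E2 E3 -expRN -expRD; congr expR; rewrite /p; ring.
  rewrite powRN powRM ?invr_ge0 ?(ltW e0) ?(ltW r00)//; field.
  by rewrite !gt_eqF ?powR_gt0 ?invr_gt0.
rewrite /tail_const -/p -!mulrA; apply: ler_wpM2l; first exact: ltW.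
apply: ler_wpM2l; first by rewrite invr_ge0.
apply: ler_wpM2l; first exact: powR_ge0.
have l0 := l_gt0.
have p0 : 0 <= p by rewrite subr_ge0.
have pl0 : 0 <= p * l by rewrite mulr_ge0// ltW.
rewrite /kappa; case: eqP => _.
  have ex : 1 <= expR (p * l) by rewrite -expR0 ler_expR.
  have lN : l <= N%:R.
    have /andP[h1 _] := nlevels_bounds hr0 heps hd; apply: le_trans h1.
    have /andP[l1 l2] := @ln2_bounds R.
    have ln20 : 0 < ln (2 : R) by lra.
    have hl : l <= ln (r0 / eps).
      by rewrite ler_ln ?posrE ?divr_gt0 ?invr_gt0// ler_pMl ?invr_gt0.
    apply: (le_trans hl).
    have q0 : 0 <= ln (r0 / eps) / ln 2.
      by apply: divr_ge0; apply: ltW => //; exact: lt_le_trans hl.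
    apply: (@le_trans _ _ (ln (r0 / eps) / ln 2)).
      by rewrite ler_peMr ?invf_ge1// (le_trans (ltW l0)).
    by rewrite ler_peMl// invf_ge1.
  rewrite mul1r -[leLHS]mulr1; apply: ler_pM => //; first exact: sqr_ge0.
  by rewrite lerXn2r ?nnegrE// ltW.
rewrite mul1r.
have h1 := expR_ge1Dx (p * l / 2).
have -> : expR (p * l) = expR (p * l / 2) ^+ 2.
  by rewrite -expRM_natl; congr expR; field.
have : (p * l / 2) ^+ 2 <= expR (p * l / 2) ^+ 2.
  rewrite lerXn2r ?nnegrE ?expR_ge0//; [by rewrite divr_ge0|lra].
move=> h2; apply: le_trans h2; rewrite le_eqVlt; apply/orP; left; apply/eqP.
by field.
Qed.

(** Either branch of the minimum suffices. In the first the exponent is at most 0; in the second it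
    is at most c l - alpha K l^2 / 2 with K = [tail_const], a parabola in l with maximum c^2 / (2
    alpha K). *)
Lemma tail_control_large tau1 :
  (1 + a - 2 * delta) / (2 * alpha * delta) < tau1 ->
  Num.min (tau1 * l) (Th N / 2) <= tau ->
  expR (- alpha * tau) * expR (c * l) <= expR (c ^+ 2 / (2 * alpha * tail_const)).
Proof.
have [d0 d1 _ _] := delta_bounds; have /andP[al0 al1] := ha.
have l0 := l_gt0; have K0 := tail_const_gt0.
move=> h1; rewrite -expRD ler_expR ge_min => /orP[h|h].
  apply: (@le_trans _ _ 0); last first.
    apply: divr_ge0; first exact: sqr_ge0.
    by apply: mulr_ge0; [apply: mulr_ge0 => //|]; exact: ltW.
  have ca : c <= alpha * tau1.
    have -> : c = alpha * ((1 + a - 2 * delta) / (2 * alpha * delta)).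
      by rewrite /c /u; field; rewrite !gt_eqF.
    by rewrite ler_pM2l// ltW.
  have : c * l <= alpha * tau1 * l by rewrite ler_pM2r.
  have : alpha * (tau1 * l) <= alpha * tau by rewrite ler_pM2l.
  lra.
have H := horizon_log_sqr.
have aK : 0 < 2 * alpha * tail_const.
  by apply: mulr_gt0 => //; exact: mulr_gt0.
rewrite ler_pdivlMr//.
have : 0 <= (alpha * tail_const * l - c) ^+ 2 by exact: sqr_ge0.
have : alpha * tail_const * (alpha * (Th N / 2)) <= alpha * tail_const * (alpha * tau).
  by apply: ler_wpM2l; [apply: mulr_ge0; exact: ltW|rewrite ler_pM2l].
have : alpha * tail_const * (alpha * (tail_const * l ^+ 2)) <=
    alpha * tail_const * (alpha * Th N).
  by apply: ler_wpM2l; [apply: mulr_ge0; exact: ltW|rewrite ler_pM2l].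
nra.
Qed.

(** Here alpha tau_1 = 2 c, twice what is needed, and tau_2 is chosen to turn r0^(u/delta) into d_a
    c4. For c4 = 0 both sides vanish, whatever the default value of tau_2. *)
Lemma tail_control_small :
  tau1_const alpha a delta * `|ln eps| + tau2_const alpha a delta r0 c4 <= tau ->
  c4 * (expR (- alpha * tau) * (r0 `^ (u / delta) * expR (c * l))) <=
  d_const a * c4 ^+ 2.
Proof.
have [d0 d1 _ _] := delta_bounds; have /andP[al0 al1] := ha.
have l0 := l_gt0; have [c40 _ _] := HH4; have /andP[e0 e1] := heps.
have dc := d_const_ge1 haa.
have r00 : 0 < r0 by exact: lt_le_trans hr0.
move: c40; rewrite le_eqVlt => /predU1P[<-|c40 h]; first by rewrite mul0r expr0n mulr0.
have -> : d_const a * c4 ^+ 2 = c4 * (d_const a * c4) by ring.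
rewrite ler_pM2l//.
have dc4 : 0 < d_const a * c4 by rewrite mulr_gt0// (lt_le_trans _ dc).
have rp : 0 < r0 `^ (u / delta) by rewrite powR_gt0.
have labs : `|ln eps| = l by rewrite ler0_norm ?ln_le0 ?(ltW e1)// /l lnV.
have h2 : ln (r0 `^ (u / delta)) - ln (d_const a * c4) <=
    alpha * tau2_const alpha a delta r0 c4.
  rewrite -ler_pdivrMl// /tau2_const le_max.
  have -> : (1 + a) / (2 * delta) = u / delta by rewrite /u; field; rewrite gt_eqF.
  have -> : ln (r0 `^ (u / delta) * (d_const a * c4)^-1) =
      ln (r0 `^ (u / delta)) - ln (d_const a * c4).
    by rewrite lnM ?lnV ?posrE ?invr_gt0.
  by rewrite lexx orbT.
rewrite -(lnK (rp : r0 `^ (u / delta) \is Num.pos)) -expRD -expRD.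
rewrite -[leRHS]lnK ?posrE// ler_expR.
have h3 : alpha * (tau1_const alpha a delta * `|ln eps| +
   tau2_const alpha a delta r0 c4) <= alpha * tau by rewrite ler_pM2l.
have h4 : alpha * tau1_const alpha a delta = 2 * c.
  by rewrite /tau1_const /c /u; field; rewrite !gt_eqF.
have h5 : 0 <= c * l by rewrite mulr_ge0// ltW.
move: h3; rewrite labs mulrDr mulrA h4; lra.
Qed.

End Assembly.

Unset Implicit Arguments.

Theorem theorem2p1 (R : realType) :
  (* (i) *)
  (forall alpha a delta gamma0 r0 th tau1 c1x0 c2 c3 c4 : R,
     0 < alpha <= 1 -> 1 <= a <= 2 -> 0 < gamma0 -> 1 <= r0 -> 0 < th ->
     (1 + a - 2 * delta) / (2 * alpha * delta) < tau1 ->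
     exists C1 : R,
     forall (d : nat) (disp : measure_display) (Omega : measurableType disp)
       (P : probability Omega R) (B : R -> Omega -> 'cV[R]_d)
       (b : 'cV[R]_d -> 'cV[R]_d) (sigma : 'cV[R]_d -> 'M[R]_d)
       (pi : probability (Borel R d) R)
       (pig : R -> probability (Borel R d) R)
       (x0 : 'cV[R]_d) (eta0 : R) (f : 'cV[R]_d -> R) (c1 : 'cV[R]_d -> R),
     0 < eta0 <= 1 / 2 -> gamma0 <= eta0 ->
     mlmc_setting P B b sigma eta0 pi pig -> lipschitzR f ->
     H1 P B b sigma pig f eta0 alpha c1 ->
     H2 P B b sigma x0 eta0 a c2 ->
     H3 pi pig f eta0 a delta c3 ->
     H4 P B b sigma x0 eta0 c1 c4 ->
     c1 x0 = c1x0 ->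
     forall eps tau : R, 0 < eps < 1 ->
       let N := nlevels delta r0 eps in
       let Th := horizon a delta r0 th eps in
       Num.min (tau1 * ln eps^-1) (Th N / 2) <= tau <= Th N / 2 ->
       forall Bs : nat -> R -> Omega -> 'cV[R]_d,
       independent_brownians P N Bs ->
       error_bound P pi f (mlmc b sigma Bs N (mlstep gamma0) tau Th x0 f)
         C1 eps /\
       cost_bound a delta gamma0 r0 th eps) /\
  (* (ii) *)
  (exists C1 : R,
     forall (alpha a delta gamma0 r0 th c2 c3 c4 : R)
       (d : nat) (disp : measure_display) (Omega : measurableType disp)
       (P : probability Omega R) (B : R -> Omega -> 'cV[R]_d)
       (b : 'cV[R]_d -> 'cV[R]_d) (sigma : 'cV[R]_d -> 'M[R]_d)
       (pi : probability (Borel R d) R)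
       (pig : R -> probability (Borel R d) R)
       (x0 : 'cV[R]_d) (eta0 : R) (f : 'cV[R]_d -> R) (c1 : 'cV[R]_d -> R),
     0 < alpha <= 1 -> 1 <= a <= 2 -> 0 < gamma0 -> 1 <= r0 -> 0 < th ->
     0 < eta0 <= 1 / 2 -> gamma0 <= eta0 ->
     mlmc_setting P B b sigma eta0 pi pig -> lipschitzR f ->
     H1 P B b sigma pig f eta0 alpha c1 ->
     H2 P B b sigma x0 eta0 a c2 ->
     H3 pi pig f eta0 a delta c3 ->
     H4 P B b sigma x0 eta0 c1 c4 ->
     Num.max 1 (c3 * gamma0 `^ delta) <= r0 ->
     t0_const alpha a gamma0 c2 c4 <= th ->
     forall eps tau : R,
       let N := nlevels delta r0 eps in
       let Th := horizon a delta r0 th eps in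
       0 < eps < eps0_const alpha a delta r0 th c4 ->
       tau1_const alpha a delta * `|ln eps| + tau2_const alpha a delta r0 c4
         <= tau <= Th N / 2 ->
       forall Bs : nat -> R -> Omega -> 'cV[R]_d,
       independent_brownians P N Bs ->
       error_bound P pi f (mlmc b sigma Bs N (mlstep gamma0) tau Th x0 f)
         C1 eps /\
       cost_bound a delta gamma0 r0 th eps).
Proof.
split.
  move=> alpha a delta gamma0 r0 th tau1 c1x0 c2 c3 c4 ha haa hg0 hr0 hth htau1.
  pose v := (1 + a) / 2 / delta.
  pose Cv := 5000 * (d_const a * (c2 ^+ 2 * gamma0 `^ a + c4 ^+ 2) / (alpha * th)).
  pose Cb := c3 * gamma0 `^ delta / r0 + 128 * `|c1x0| / (alpha * th) *
    (r0 `^ v * expR ((v - 1) ^+ 2 / (2 * alpha * tail_const a delta r0 th))).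
  exists (Num.sqrt (Cv + Cb ^+ 2)).
  move=> d disp Omega P B b sigma pi pig x0 eta0 f c1 he hge Hset Hf HH1 HH2 HH3 HH4.
  move=> c1E eps tau heps N Th /andP[htau tT] Bs HBs.
  have /andP[al0 _] := ha; have /andP[a1 _] := haa.
  have [d0 d1 _ _] := delta_bounds haa HH3.
  have l0 := l_gt0 heps.
  have tau1_gt0 : 0 < tau1.
    by apply: le_lt_trans htau1; rewrite divr_ge0 ?mulr_ge0 ?(ltW al0) ?(ltW d0)//; lra.
  have hd : 0 < delta <= 1 by rewrite d0.
  have t0 : 0 <= tau.
    apply: le_trans htau; rewrite le_min mulr_ge0 ?(ltW tau1_gt0) ?(ltW l0)//=.
    by rewrite divr_ge0// ltW// horizon_gt0.
  have tail := tail_control_large ha haa hr0 hth HH3 heps htau1 htau.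
  apply: (error_and_cost ha haa hg0 hr0 hth he hge Hset Hf HH1 HH2 HH3 HH4) => //.
    by rewrite t0.
  rewrite /Cb lerD2l c1E; apply: ler_wpM2l.
    by apply: divr_ge0; [exact: mulr_ge0|apply: mulr_ge0; exact: ltW].
  by rewrite mulrCA; apply: ler_wpM2l; [exact: powR_ge0|exact: tail].
(* The 3 comes from [t0_control]. In the bias, 1 is c3 gamma0^delta <= r0, and 128 is left of the
   transients because |c1(x_0)| <= c4 and d_a c4^2 <= alpha t. *)
exists (Num.sqrt (5000 * 3 + (1 + 128) ^+ 2)).
move=> alpha a delta gamma0 r0 th c2 c3 c4 d disp Omega P B b sigma pi pig x0 eta0 f c1.
move=> ha haa hg0 hr0 hth he hge Hset Hf HH1 HH2 HH3 HH4 hr ht eps tau N Th.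
move=> /andP[e0 elt] /andP[htau tT] Bs HBs.
(* eps_0 <= 1, as a supremum of numbers at most 1, or 0 if there are none. *)
have heps : 0 < eps < 1.
  rewrite e0; apply: lt_le_trans elt _; rewrite /eps0_const.
  set E := [set _ | _]; have [E0|/set0P/negP/negPn/eqP ->] := pselect (E !=set0).
    by apply: ge_sup => // x [/andP[]].
  by rewrite sup0.
have /andP[al0 _] := ha; have /andP[a1 _] := haa.
have [d0 d1 _ _] := delta_bounds haa HH3.
have t0 : 0 <= tau.
  apply: le_trans htau; rewrite addr_ge0 ?le_max ?lexx// mulr_ge0//.
  by rewrite divr_ge0 ?mulr_ge0 ?(ltW al0) ?(ltW d0)//; lra.
have [h1 h2] := t0_control ha haa hg0 he hge ht.
have at0 : 0 < alpha * th by rewrite mulr_gt0.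
have h3 := tail_control_small ha haa hr0 HH3 HH4 heps htau.
have h4 := c1_le_c4 hg0 hge Hset HH4.
apply: (error_and_cost ha haa hg0 hr0 hth he hge Hset Hf HH1 HH2 HH3 HH4) => //.
- by rewrite t0.
- by apply: ler_wpM2l; [exact: ler0n|rewrite ler_pdivrMr].
apply: lerD.
  rewrite ler_pdivrMr ?(lt_le_trans _ hr0)// mul1r.
  by apply: le_trans hr; rewrite le_max lexx orbT.
set Z := expR _ * _; have -> : 128 * `|c1 x0| / (alpha * th) * Z =
    128 * (`|c1 x0| * Z) / (alpha * th) by ring.
rewrite ler_pdivrMr//; apply: ler_wpM2l; first exact: ler0n.
apply: le_trans h2; apply: le_trans h3.
by apply: ler_wpM2r => //; rewrite !mulr_ge0 ?expR_ge0 ?powR_ge0.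
Qed.
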